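(* For every $m\ge0$ and all sufficiently large $n$, the map $\pi_n$ is injective on $\Lambda^{\circ,\le m}$ and $T_n(\pi_n(\Lambda^{\circ,\le m}))\subseteq\pi_n(\Lambda^{\circ,\le m})$; for every $f\in\Lambda^{\circ,\le m}$ the elements $g_n\in\Lambda^{\circ,\le m}$ with $\pi_n(g_n)=n^2(T_n-\mathbf 1)\pi_n(f)$ converge in $\Lambda^{\circ,\le m}$ to an element $Af$, defining a linear operator $A:\Lambda^\circ\to\Lambda^\circ$. The operator $A$ (with domain $\Lambda^\circ\subset C(\Omega)$) is closable in $C(\Omega)$, its closure generates a conservative Markov semigroup $\{T(t)\}_{t\ge0}$ in $C(\Omega)$, and for every $f\in C(\Omega)$ and $t\ge0$, $$\lim_{n\to\infty}\big\|T_n^{[n^2t]}\pi_n(f)-\pi_n(T(t)f)\big\|_n=0,$$ uniformly in $t$ on bounded intervals.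
   Context: $\mathbb Y_n$ is the set of Young diagrams with $n$ boxes; $\mu\nearrow\lambda$ (equivalently $\lambda\searrow\mu$) means $\mu\subset\lambda$, $|\lambda|=|\mu|+1$; $(z)_\theta=\prod_{(i,j)\in\theta}(z+j-i)$ for a skew diagram $\theta$ ($(i,j)$ = row $i$, column $j$); $\dim\lambda$ is the number of standard Young tableaux of shape $\lambda$. Modified Frobenius coordinates: $\lambda=(a_1,\dots,a_d\mid b_1,\dots,b_d)$, $d$ the number of diagonal boxes, $a_i=\lambda_i-i+\frac12$, $b_i=\lambda'_i-i+\frac12$. $(z,z')$ is fixed in the principal series ($z\notin\mathbb R$, $z'=\bar z$) or complementary series ($z,z'\in(N,N+1)$, $N\in\mathbb Z$). $p^\downarrow(\nu,\lambda)=\dim\lambda/\dim\nu$ if $\lambda\nearrow\nu$, else 0; for $\lambda\in\mathbb Y_n$, $p^\uparrow(\lambda,\nu)=\frac{(z)_{\nu/\lambda}(z')_{\nu/\lambda}}{zz'+n}\frac{\dim\nu}{(n+1)\dim\lambda}$ if $\nu\searrow\lambda$, else 0. $C(\mathbb Y_n)$: real functions on $\mathbb Y_n$ with norm $\|g\|_n=\max|g|$; $(T_ng)(\lambda)=\sum_{\nu\in\mathbb Y_{n+1}}p^\uparrow(\lambda,\nu)\sum_{\tilde\lambda\in\mathbb Y_n}p^\downarrow(\nu,\tilde\lambda)g(\tilde\lambda)$ (up–down Markov chain whose invariant law is the z-measure $M_n(\lambda)=\frac{(z)_\lambda(z')_\lambda}{(zz')_n}\frac{(\dim\lambda)^2}{n!}$);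 $\mathbf 1$ = identity. Thoma simplex $\Omega$: pairs $(\alpha,\beta)$ of nonincreasing sequences of nonnegative reals with $\sum_i(\alpha_i+\beta_i)\le1$, topology induced from $[0,1]^\infty\times[0,1]^\infty$ (compact); $C(\Omega)$ real continuous functions with sup norm. $\iota_n:\mathbb Y_n\to\Omega$, $\alpha_i=a_i/n$, $\beta_i=b_i/n$ ($i\le d$), 0 otherwise; $\pi_n:C(\Omega)\to C(\mathbb Y_n)$, $\pi_nf=f\circ\iota_n$. $\Lambda=\mathbb R[p_1,p_2,\dots]$ symmetric functions, $\Lambda^\circ=\Lambda/(p_1-1)$ with filtration $\Lambda^{\circ,\le m}$ = image of elements of degree $\le m$, realized as a dense subalgebra of $C(\Omega)$ via $p_1^\circ=1$, $p_k^\circ(\alpha,\beta)=\sum_i\alpha_i^k+(-1)^{k-1}\sum_i\beta_i^k$ ($k\ge2$). A conservative Markov semigroup is a strongly continuous semigroup of contractions preserving nonnegative functions and the constant $1$. *)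

(* Defs.v *)
From HB Require Import structures.
From mathcomp Require Import all_boot all_order all_algebra.
From mathcomp Require Import all_classical all_reals all_analysis.
From mathcomp Require Import complex.

Set Implicit Arguments.
Unset Strict Implicit.
Unset Printing Implicit Defensive.

Import Order.TTheory GRing.Theory Num.Theory.
Import numFieldNormedType.Exports.
Local Open Scope classical_set_scope.
Local Open Scope ring_scope.

Definition is_partition (lam : seq nat) : bool :=
  sorted geq lam && all (fun x => 0 < x)%N lam.

Fixpoint seqs_upto (k b : nat) : seq (seq nat) :=
  if k is k'.+1 then
    [::] :: [seq x :: s | x <- iota 0 b, s <- seqs_upto k' b]
  else [:: [::]].

(* Yn n : an enumeration of Y_n, the Young diagrams with n boxes
   (every such diagram has at most n rows, each of length at most n). *)
Definition Yn (n : nat) : seq (seq nat) :=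
  [seq l <- undup (seqs_upto n n.+1) | is_partition l && (sumn l == n)].

Definition subdiag (mu nu : seq nat) : bool :=
  (size mu <= size nu)%N &&
  all (fun i => nth 0 mu i <= nth 0 nu i)%N (iota 0 (size mu)).

Definition covers (nu mu : seq nat) : bool :=
  [&& is_partition nu, is_partition mu, sumn nu == (sumn mu).+1 & subdiag mu nu].

(* dim lam = number of standard Young tableaux of shape lam, computed by
   the removal of the box containing the largest entry:
   dim(empty) = 1, dim nu = sum_{mu ↗ nu} dim mu. *)
Fixpoint dimY (n : nat) (lam : seq nat) : nat :=
  if n is n'.+1 then \sum_(mu <- Yn n' | covers lam mu) dimY n' mu
  else (lam == [::]).
Definition dimD (lam : seq nat) : nat := dimY (sumn lam) lam.

Definition poch (R : realType) (z : R[i]) (nu mu : seq nat) : R[i] :=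
  \prod_(i < size nu) \prod_(nth 0 mu i <= j < nth 0 nu i) (z + j%:R - i%:R).

Definition admissible (R : realType) (z z' : R[i]) : Prop :=
  (complex.Im z != 0 /\ z' = conjc z) \/
  (exists N : int, complex.Im z = 0 /\ complex.Im z' = 0 /\
     N%:~R < complex.Re z < N%:~R + 1 /\ N%:~R < complex.Re z' < N%:~R + 1).

(* transition probabilities (their values are real for admissible z, z';
   we take the real part of the complex expression) *)
Definition p_down (R : realType) (nu lam : seq nat) : R :=
  if covers nu lam then (dimD lam)%:R / (dimD nu)%:R else 0.

Definition p_up (R : realType) (z z' : R[i]) (n : nat) (lam nu : seq nat) : R :=
  if covers nu lam then
    complex.Re (poch z nu lam * poch z' nu lam / (z * z' + n%:R)) *
    ((dimD nu)%:R / ((n.+1)%:R * (dimD lam)%:R))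
  else 0.

Definition Tn (R : realType) (z z' : R[i]) (n : nat) (g : seq nat -> R)
    (lam : seq nat) : R :=
  \sum_(nu <- Yn n.+1) p_up z z' n lam nu *
     \sum_(lt <- Yn n) p_down R nu lt * g lt.

Definition Th (R : realType) := ((nat -> R) * (nat -> R))%type.

Definition Omega (R : realType) : set (Th R) :=
  [set w | (forall i, 0 <= w.1 i /\ 0 <= w.2 i) /\
           (forall i, w.1 i.+1 <= w.1 i /\ w.2 i.+1 <= w.2 i) /\
           (forall k, \sum_(i < k) (w.1 i + w.2 i) <= 1)].
Arguments Omega R : clear implicits.

(* continuity on Omega for the product topology of [0,1]^oo x [0,1]^oo
   (basic neighbourhoods constrain finitely many coordinates) *)
Definition contO (R : realType) (f : Th R -> R) : Prop :=
  forall w, Omega R w -> forall e : R, 0 < e ->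
    exists k : nat, exists2 d : R, 0 < d &
      forall w', Omega R w' ->
        (forall i, (i < k)%N -> `|w.1 i - w'.1 i| < d /\ `|w.2 i - w'.2 i| < d) ->
        `|f w - f w'| < e.

(* sup norm of C(Omega); functions are identified when equal on Omega *)
Definition nrmO (R : realType) (f : Th R -> R) : R :=
  sup [set `|f w| | w in Omega R].

(* the embedding iota_n : Y_n -> Omega via modified Frobenius coordinates
   (0-indexed row i: a_i = lam_i - i - 1/2, b_i = lam'_i - i - 1/2, i < d) *)
Definition conj_row (lam : seq nat) (i : nat) : nat := count (fun x => i < x)%N lam.
Definition frob_d (lam : seq nat) : nat := count (fun i => i < nth 0 lam i)%N (iota 0 (size lam)).

Definition iotaY (R : realType) (n : nat) (lam : seq nat) : Th R :=
  (fun i => if (i < frob_d lam)%N then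
              ((nth 0 lam i)%:R - i%:R - 2^-1) / n%:R else 0,
   fun i => if (i < frob_d lam)%N then
              ((conj_row lam i)%:R - i%:R - 2^-1) / n%:R else 0).

Definition piY (R : realType) (n : nat) (f : Th R -> R) : seq nat -> R :=
  fun lam => f (iotaY R n lam).

Definition pO (R : realType) (k : nat) (w : Th R) : R :=
  if k == 1%N then 1
  else limn (fun N => \sum_(i < N) (w.1 i) ^+ k) + (-1) ^+ k.-1 * limn (fun N => \sum_(i < N) (w.2 i) ^+ k).

Definition pOrho (R : realType) (rho : seq nat) (w : Th R) : R :=
  \prod_(k <- rho) pO k w.

(* Lambda^{°,<=m}: images of the elements of Lambda of degree <= m, i.e.
   the linear span of the p°_rho, |rho| <= m (as functions on Omega) *)
Definition LamO_le (R : realType) (m : nat) (f : Th R -> R) : Prop :=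
  exists c : seq nat -> R, forall w, Omega R w ->
    f w = \sum_(k < m.+1) \sum_(rho <- Yn k) c rho * pOrho rho w.

Definition LamO (R : realType) (f : Th R -> R) : Prop := exists m, LamO_le m f.

Definition closable (R : realType) (D : (Th R -> R) -> Prop)
    (A : (Th R -> R) -> (Th R -> R)) : Prop :=
  forall (fk : nat -> Th R -> R) (h : Th R -> R),
    (forall k, D (fk k)) -> contO h ->
    (fun k => nrmO (fk k)) @ \oo --> 0 ->
    (fun k => nrmO (fun w => A (fk k) w - h w)) @ \oo --> 0 ->
    forall w, Omega R w -> h w = 0.

Definition closure_graph (R : realType) (D : (Th R -> R) -> Prop)
    (A : (Th R -> R) -> (Th R -> R)) (f h : Th R -> R) : Prop :=
  contO f /\ contO h /\
  exists fk : nat -> Th R -> R, (forall k, D (fk k)) /\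
    (fun k => nrmO (fun w => fk k w - f w)) @ \oo --> 0 /\
    (fun k => nrmO (fun w => A (fk k) w - h w)) @ \oo --> 0.

Definition generator_graph (R : realType) (T : R -> (Th R -> R) -> (Th R -> R))
    (f h : Th R -> R) : Prop :=
  contO f /\ contO h /\
  (fun t => nrmO (fun w => (T t f w - f w) / t - h w)) @ 0^'+ --> 0.

Definition conservative_markov_semigroup (R : realType)
    (T : R -> (Th R -> R) -> (Th R -> R)) : Prop :=
  (forall t f, 0 <= t -> contO f -> contO (T t f)) /\
  (forall t a b f g, 0 <= t -> contO f -> contO g -> forall w, Omega R w ->
     T t (fun x => a * f x + b * g x) w = a * T t f w + b * T t g w) /\
  (forall f, contO f -> forall w, Omega R w -> T 0 f w = f w) /\
  (forall s t f, 0 <= s -> 0 <= t -> contO f -> forall w, Omega R w ->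
     T (s + t) f w = T s (T t f) w) /\
  (forall f, contO f -> (fun t => nrmO (fun w => T t f w - f w)) @ 0^'+ --> 0) /\
  (forall t f, 0 <= t -> contO f -> nrmO (T t f) <= nrmO f) /\
  (forall t f, 0 <= t -> contO f -> (forall w, Omega R w -> 0 <= f w) ->
     forall w, Omega R w -> 0 <= T t f w) /\
  (forall t, 0 <= t -> forall w, Omega R w -> T t (fun _ => 1) w = 1).

(* Main.v *)
(* Write c = j - i for the content of a box. The Frobenius formula for dim lambda
   turns the up and down transition probabilities into residues of rational
   functions with zeros and poles at shifted contents, so the moments of the
   content of the added (removed) box are polynomials in the functions
   p_k(lambda) = sum_i a_i^k + (-1)^(k-1) sum_i b_i^k, with controlled degree. Hence
   T_n p_rho = p_rho - d (d - 1 + z z') / ((z z' + n)(n + 1)) p_rho + (terms of degree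
   < d = |rho| divided by z z' + n, n + 1 or their product). Dividing by n^d, this
   gives the limit operator A, which is triangular with the distinct diagonal entries
   - d (d - 1 + z z'); so Lambda^o is spanned by eigenfunctions of A, and on it the
   semigroup is a finite sum of terms exp (- d (d - 1 + z z') t) f_d. For an
   eigenfunction the convergence of T_n^[n^2 t] is elementary because T_n is a
   contraction; as the points iota_n(lambda) fill Omega, the limit is a positive
   contraction for the sup norm and extends to C(Omega) by Stone-Weierstrass.
   Its generator is the closure of A since (1 - A) maps Lambda^o onto itself. *)

Require Import Defs.
From HB Require Import structures.
From mathcomp Require Import all_boot all_order all_algebra.
From mathcomp Require Import all_classical all_reals all_analysis.
From mathcomp Require Import complex.
From mathcomp Require Import zify ring lra.
Set Implicit Arguments.
Unset Strict Implicit.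
Unset Printing Implicit Defensive.
Import Order.TTheory GRing.Theory Num.Theory.
Import numFieldNormedType.Exports.
Local Open Scope classical_set_scope.
Local Open Scope ring_scope.

(** * Residue sums and power sums *)

(** The time scale n^2 comes from a cancellation. Let p_k have degree k and a content c degree 1.
    Adding a box changes p_rho by terms of degree |rho| - 1. Averaging a positive power of c over
    the added box loses one degree (the average of c^2 is n = p_1), while the factor (z + c)(z' + c)
    gains two, so an up step has leading part |rho| p_rho / (zz' + n). A down step has leading part
    - |rho| p_rho / (n + 1), and what is left of the two is of order n^-2. Degrees are therefore
    tracked through filtrations, and only the top term of each quantity is computed. Elements of
    Lambda^o are handled as functions on Omega, given by spanning sets in which one element may have
    several expansions. Uniqueness of the limit A f then rests on the density of the points
    iota_n(lambda), and injectivity of pi_n for large n on interpolation at finitely many points of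
    Omega. *)

Section PartialFractions.
Variable F : numFieldType.
Implicit Types (s : nat -> F) (q : F) (ys qs : seq F).

(** All coefficients up to degree n are carried along, highest degree first, because each step of
    the recursion calls every earlier one. *)
Fixpoint newton_seq s (n : nat) : seq F :=
  if n is n'.+1 then
    (\sum_(k < n'.+1) s k.+1 * nth 0 (newton_seq s n') k) / n'.+1%:R
      :: newton_seq s n'
  else [:: 1].

(* The coefficient of t^n in the power series exp (\sum_(k >= 1) s k * t^k / k). *)
Definition newton s (n : nat) : F := head 0 (newton_seq s n).

Lemma nth_newton_seq s n k : (k <= n)%N ->
  nth 0 (newton_seq s n) k = newton s (n - k).
Proof.
elim: n k => [|n IHn] [|k] //= lekn.
by rewrite subSS -IHn.
Qed.

Lemma newton0 s : newton s 0 = 1. Proof. by []. Qed.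

Lemma newtonS s n :
  n.+1%:R * newton s n.+1 = \sum_(k < n.+1) s k.+1 * newton s (n - k).
Proof.
rewrite [newton s _.+1]/newton /= mulrC mulfVK ?pnatr_eq0 //.
by apply: eq_bigr => k _; rewrite nth_newton_seq // -ltnS.
Qed.

(** The recursion is the equation E' = S E with S = s_1 + s_2 t + ..., which determines the series;
    later identities between series are proved by checking it. *)
Lemma newton_uniq s (e : nat -> F) : e 0 = 1 ->
  (forall n, n.+1%:R * e n.+1 = \sum_(k < n.+1) s k.+1 * e (n - k)%N) ->
  forall n, e n = newton s n.
Proof.
move=> e0 eS n; have [m] := ubnP n; elim: m n => // m IHm [|n] // /ltnSE ltnm.
have nz : n.+1%:R != 0 :> F by rewrite pnatr_eq0.
apply: (mulfI nz); rewrite eS newtonS; apply: eq_bigr => k _.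
by rewrite IHm // (leq_ltn_trans (leq_subr _ _)).
Qed.

Lemma eq_newton s s' n : (forall k, s k.+1 = s' k.+1) -> newton s n = newton s' n.
Proof.
move=> ss'; apply: newton_uniq => // {}n; rewrite newtonS.
by apply: eq_bigr => k _; rewrite ss'.
Qed.

(* Multiplication of the series by the factor 1 - q t. *)
Lemma newton_zero s q n :
  newton (fun k => s k - q ^+ k) n.+1 = newton s n.+1 - q * newton s n.
Proof.
pose e i := if i is i'.+1 then newton s i - q * newton s i' else 1.
suff <- : e n.+1 = newton (fun k => s k - q ^+ k) n.+1 by [].
apply: newton_uniq => // {}n.
(* The left side is a coefficient of q / (1 - q t) times (1 - q t) E. *)
have Eq r : \sum_(k < r.+1) q ^+ k.+1 * e (r - k)%N = q * newton s r.
  elim: r => [|r IHr]; first by rewrite big_ord_recl big_ord0 /= !mulr1 addr0.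
  rewrite big_ord_recl /= subn0 expr1.
  have -> : \sum_(i < r.+1) q ^+ (bump 0 i).+1 * e (r.+1 - bump 0 i)%N =
            q * \sum_(i < r.+1) q ^+ i.+1 * e (r - i)%N.
    by rewrite mulr_sumr; apply: eq_bigr => i _; rewrite /bump exprS mulrA subSS.
  by rewrite IHr; ring.
under eq_bigr do rewrite mulrBl.
rewrite sumrB Eq big_ord_recr /= subnn /= mulr1.
have -> : \sum_(i < n) s i.+1 * e (n - i)%N =
   \sum_(i < n) s i.+1 * newton s (n - i) -
   q * \sum_(i < n) s i.+1 * newton s (n.-1 - i).
  rewrite mulr_sumr -sumrB; apply: eq_bigr => i _.
  have -> : (n - i)%N = (n.-1 - i).+1 by have := ltn_ord i; lia.
  by rewrite /e; ring.
have -> : \sum_(i < n) s i.+1 * newton s (n.-1 - i) = n%:R * newton s n.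
  by case: n => [|n]; rewrite ?big_ord0 ?mul0r // newtonS.
have := newtonS s n; rewrite big_ord_recr /= subnn newton0 mulr1.
rewrite -natr1 => E; have : n.+1%:R * newton s n.+1 = (n%:R + 1) * newton s n.+1 by rewrite natr1.
move: E; set A := \sum_(i < n) _; set N := newton s n.+1; set M := newton s n.
rewrite -natr1 => E _.
have -> : A = (n%:R + 1) * N - s n.+1 by rewrite E; ring.
by ring.
Qed.

(* [newton s (a - b)] with the convention that coefficients of negative index vanish. *)
Definition newton_sub s (a b : nat) : F := if (b <= a)%N then newton s (a - b) else 0.

Lemma newton_sub_zero s q a b :
  newton_sub (fun k => s k - q ^+ k) a.+1 b =
  newton_sub s a.+1 b - q * newton_sub s a b.
Proof.
rewrite /newton_sub; case: (ltngtP b a.+1) => // [||->].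
- by move=> /ltnSE leba; rewrite leba subSn // newton_zero.
- by move=> ltab; rewrite leqNgt (ltnW ltab) /= mulr0 subr0.
- by rewrite ltnn subnn mulr0 subr0 !newton0.
Qed.

(** For distinct [ys], the sum of the residues of x^r prod (x - q) / prod (x - y) at its finite
    poles. *)
Definition residue_sum ys qs (r : nat) : F :=
  \sum_(y <- ys)
    y ^+ r * (\prod_(q <- qs) (y - q)) / \prod_(x <- ys | x != y) (y - x).

Definition psums ys (k : nat) : F := \sum_(y <- ys) y ^+ k.

Lemma residue_sum_zero ys q qs r :
  residue_sum ys (q :: qs) r = residue_sum ys qs r.+1 - q * residue_sum ys qs r.
Proof.
rewrite /residue_sum mulr_sumr -sumrB; apply: eq_bigr => y _.
by rewrite big_cons exprS; ring.
Qed.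

(** Multiplying the rational function by x - y cancels its pole at y. *)
Lemma residue_sum_pole y ys r : uniq (y :: ys) ->
  residue_sum (y :: ys) [::] r.+1 - y * residue_sum (y :: ys) [::] r =
  residue_sum ys [::] r.
Proof.
case/andP=> yNys uys; rewrite /residue_sum mulr_sumr -sumrB big_cons.
rewrite exprS !mulrA subrr add0r !big_seq; apply: eq_bigr => x xys.
rewrite !big_nil big_cons.
have yx : y != x by apply: contraNneq yNys => ->.
rewrite yx invfM !mulr1.
have ne : x - y != 0 by rewrite subr_eq0 eq_sym.
transitivity (x ^+ r * ((x - y) * (x - y)^-1) / \prod_(j <- ys | j != x) (x - j)).
  by rewrite exprS; ring.
by rewrite divff // mulr1.
Qed.

Lemma perm_residue_sum ys ys' r : perm_eq ys ys' ->
  residue_sum ys [::] r = residue_sum ys' [::] r.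
Proof.
move=> yy'; rewrite /residue_sum (perm_big _ yy') /=; apply: eq_bigr => y _.
by rewrite (perm_big _ yy').
Qed.

Lemma psums_cons y ys k : psums (y :: ys) k = y ^+ k + psums ys k.
Proof. by rewrite /psums big_cons. Qed.

Lemma residue_sum_poles ys r : uniq ys ->
  residue_sum ys [::] r = newton_sub (psums ys) r.+1 (size ys).
Proof.
have [m] := ubnP (size ys); elim: m ys r => // m IHm [|y ys] r /=.
  move=> _ _; rewrite /residue_sum /newton_sub big_nil /= subn0.
  have nz : r.+1%:R != 0 :> F by rewrite pnatr_eq0.
  apply/esym/(mulfI nz); rewrite newtonS mulr0 big1 // => k _.
  by rewrite /psums big_nil mul0r.
move=> ltm uys.
have IH r' : residue_sum ys [::] r' = newton_sub (psums ys) r'.+1 (size ys).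
  by apply: IHm; [lia | case/andP: uys].
elim: r => [|r IHr].
  case: ys => [|y' ys] in ltm uys IH *.
    by rewrite /residue_sum big_seq1 !big_nil big_cons big_nil eqxx mulr1 divr1 /newton_sub.
  (* With two poles y and y' the value at r = 0 must vanish: cancelling either pole leaves the same
     number by induction, so (y - y') times this value is 0. *)
  rewrite /newton_sub /=.
  have P1 := residue_sum_pole 0 uys.
  have pe : perm_eq [:: y, y' & ys] [:: y', y & ys].
    by rewrite -cat1s -[y' :: ys]cat1s perm_catCA.
  have uys' : uniq [:: y', y & ys] by rewrite -(perm_uniq pe).
  have := residue_sum_pole 0 uys'; rewrite -!(perm_residue_sum _ pe) => P2.
  rewrite IH in P1.
  have IHy : residue_sum (y :: ys) [::] 0 = newton_sub (psums (y :: ys)) 1 (size (y :: ys)).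
    by apply: IHm; [move: ltm; rewrite /= ltnS | case/andP: uys'].
  rewrite IHy in P2.
  have ne : y - y' != 0.
    by rewrite subr_eq0; case/andP: uys; rewrite inE negb_or => /andP[].
  apply: (mulfI ne); rewrite mulr0.
  have : newton_sub (psums (y' :: ys)) 1 (size (y' :: ys)) =
         newton_sub (psums (y :: ys)) 1 (size (y :: ys)).
    by rewrite /newton_sub /=; case: (size ys).
  rewrite -P1 -P2; set A := residue_sum _ _ 1; set B := residue_sum _ _ 0.
  by move=> E; rewrite mulrBl; move/eqP: E; rewrite -subr_eq0 => /eqP E; rewrite -oppr0 -E; ring.
have := residue_sum_pole r uys; rewrite IH IHr => /eqP.
rewrite subr_eq => /eqP ->.
have := newton_sub_zero (psums (y :: ys)) y r.+1 (size ys).+1 => /= E.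
have {}E : newton_sub (psums ys) r.+2 (size ys).+1 =
  newton_sub (psums (y :: ys)) r.+2 (size ys).+1 - y * newton_sub (psums (y :: ys)) r.+1 (size ys).+1.
  rewrite -E /newton_sub; case: ifP => // _; apply: eq_newton => k.
  by rewrite psums_cons addrC addKr.
have -> : newton_sub (psums ys) r.+1 (size ys) = newton_sub (psums ys) r.+2 (size ys).+1.
  by rewrite /newton_sub ltnS subSS.
by rewrite E subrK.
Qed.

(** Each zero q multiplies the generating series by 1 - q t: [residue_sum_zero] and
    [newton_sub_zero] are the same recursion, started from [residue_sum_poles]. *)
Lemma residue_sumE ys qs r : uniq ys ->
  residue_sum ys qs r =
  newton_sub (fun k => psums ys k - psums qs k) (r + size qs).+1 (size ys).
Proof.
move=> uys; elim: qs r => [|q qs IHq] r.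
  rewrite residue_sum_poles // addn0 /newton_sub; case: ifP => // _.
  by apply: eq_newton => k; rewrite /psums [X in _ - X]big_nil subr0.
rewrite residue_sum_zero !IHq /= addnS addSn -newton_sub_zero /newton_sub.
by case: ifP => // _; apply: eq_newton => k; rewrite psums_cons; ring.
Qed.

End PartialFractions.

(** * Adding and removing boxes *)

Section Diagrams.
Implicit Types (lam mu nu : seq nat) (n i j : nat).

Lemma mem_seqs_upto k b s :
  (s \in seqs_upto k b) = (size s <= k)%N && all (fun x => x < b)%N s.
Proof.
elim: k s => [|k IHk] [|x s] //=.
rewrite inE ltnS /=; apply/allpairsP/idP => [[[y t] /= [yb tk [-> ->]]]|].
  by move: yb tk; rewrite mem_iota IHk /= add0n => -> /andP[-> ->].
case/and3P => sk xb sb; exists (x, s) => /=; split => //; first by rewrite mem_iota.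
by rewrite IHk sk.
Qed.

Lemma is_partitionP lam : is_partition lam <->
  (forall i, nth 0%N lam i.+1 <= nth 0%N lam i)%N /\
  (forall i, i < size lam -> 0 < nth 0%N lam i)%N.
Proof.
split=> [/andP[/(sortedP 0%N) srt /all_nthP pos]|[dec pos]].
  split=> [i|i /pos -> //]; have [|le] := ltnP i.+1 (size lam); first exact: srt.
  by rewrite nth_default.
apply/andP; split; last by apply/(all_nthP 0%N).
by apply/(sortedP 0%N) => i _; apply: dec.
Qed.

Lemma nth_partition lam i j : is_partition lam -> (i <= j)%N ->
  (nth 0%N lam j <= nth 0%N lam i)%N.
Proof.
move=> /is_partitionP[dec _]; elim: j => [|j IHj]; first by rewrite leqn0 => /eqP->.
by rewrite leq_eqVlt => /predU1P[->//|/ltnSE /IHj]; apply: leq_trans.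
Qed.

Lemma nth_partition_gt0 lam i : is_partition lam -> (0 < nth 0%N lam i)%N = (i < size lam)%N.
Proof.
move=> /is_partitionP[_ pos]; have [/pos ->|le] := ltnP i (size lam) => //.
by rewrite nth_default.
Qed.

(** Parts are positive, so the length is the first index at which the default value 0 is read. *)
Lemma partition_eq lam mu : is_partition lam -> is_partition mu ->
  (forall i, nth 0%N lam i = nth 0%N mu i) -> lam = mu.
Proof.
move=> plam pmu E; apply: (@eq_from_nth _ 0%N) => [|i _]; last exact: E.
apply/eqP; rewrite eqn_leq; apply/andP; split; rewrite leqNgt; apply/negP.
  by rewrite -(nth_partition_gt0 _ plam) E nth_partition_gt0 // ltnn.
by rewrite -(nth_partition_gt0 _ pmu) -E nth_partition_gt0 // ltnn.
Qed.

Lemma sumn_nth lam L : (size lam <= L)%N -> sumn lam = (\sum_(i < L) nth 0%N lam i)%N.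
Proof.
move=> sL; rewrite sumnE (big_nth 0%N) -(big_mkord xpredT (fun i => nth 0%N lam i)).
rewrite (big_cat_nat _ sL) //= [X in (_ + X)%N]big_nat [X in (_ + X)%N]big1 ?addn0 //.
by move=> i /andP[si _]; rewrite nth_default.
Qed.

Lemma size_partition lam : is_partition lam -> (size lam <= sumn lam)%N.
Proof.
move=> plam; rewrite (sumn_nth (leqnn _)) -[X in (X <= _)%N]card_ord -sum1_card.
by apply: leq_sum => i _; rewrite nth_partition_gt0.
Qed.

Lemma nth_leq_sumn lam i : (nth 0%N lam i <= sumn lam)%N.
Proof.
have [il|le] := ltnP i (size lam); last by rewrite nth_default.
by rewrite (sumn_nth (leqnn _)) (bigD1 (Ordinal il)) //= leq_addr.
Qed.

Lemma mem_Yn n lam : (lam \in Yn n) = is_partition lam && (sumn lam == n).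
Proof.
rewrite mem_filter mem_undup mem_seqs_upto; apply: andb_idr.
case/andP=> plam /eqP <-; rewrite size_partition //=.
by apply/(all_nthP 0%N) => i _; rewrite ltnS nth_leq_sumn.
Qed.

Lemma YnP n lam : lam \in Yn n -> is_partition lam /\ sumn lam = n.
Proof. by rewrite mem_Yn => /andP[plam /eqP]. Qed.

Lemma Yn_partition n lam : lam \in Yn n -> is_partition lam.
Proof. by case/YnP. Qed.

Lemma uniq_Yn n : uniq (Yn n).
Proof. by rewrite filter_uniq // undup_uniq. Qed.

Lemma sumn_incr_nth lam i : sumn (incr_nth lam i) = (sumn lam).+1.
Proof.
elim: lam i => [|x lam IH] [|i] //=; last by rewrite IH addnS.
by elim: i => //= i ->.
Qed.

Lemma incr_nth_size_le lam i : is_partition (incr_nth lam i) -> (i <= size lam)%N.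
Proof.
move=> p; rewrite leqNgt; apply/negP => lt.
have := nth_partition p (ltnW lt).
rewrite !nth_incr_nth eqxx !(nth_default 0) // ?(ltnW lt) //.
by rewrite (gtn_eqF lt).
Qed.

(** Containment compares rows and the sums differ by one, so exactly one row grows, by one box. The
    row may be new, which [incr_nth] covers at i = size lam. *)
Lemma coversP nu lam : reflect
  (exists i, [/\ is_partition nu, is_partition lam & nu = incr_nth lam i])
  (covers nu lam).
Proof.
apply: (iffP and4P) => [[pnu plam /eqP sE /andP[sz /allP sub]]|[i [pnu plam E]]].
  have le i : (nth 0%N lam i <= nth 0%N nu i)%N.
    have [il|ge] := ltnP i (size lam); last by rewrite [X in (X <= _)%N]nth_default.
    by apply: sub; rewrite mem_iota.
  have [i lti] : exists i, (nth 0%N lam i < nth 0%N nu i)%N.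
    apply: contrapT => /forallNP H; move: sE.
    rewrite (sumn_nth (leqnn (size nu))) (sumn_nth sz) => /eqP; apply/negP.
    rewrite neq_ltn ltnS leq_sum // => j _.
    by rewrite leqNgt; apply/negP/H.
  exists i; split => //.
  have eqj j : nth 0%N nu j = ((i == j) + nth 0%N lam j)%N.
    pose M := maxn (size nu) (maxn i.+1 j.+1).
    have iM : (i < M)%N by rewrite /M; lia.
    have jM : (j < M)%N by rewrite /M; lia.
    have sM : (size nu <= M)%N by rewrite /M; lia.
    have sM' : (size lam <= M)%N by apply: leq_trans sM.
    move: sE; rewrite (sumn_nth sM) (sumn_nth sM').
    rewrite (bigD1 (Ordinal iM)) //= [in RHS](bigD1 (Ordinal iM)) //=.
    have [<-|nij] := eqVneq i j.
      have : (\sum_(k < M | k != Ordinal iM) nth 0%N lam k <=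
              \sum_(k < M | k != Ordinal iM) nth 0%N nu k)%N by apply: leq_sum.
      move: lti; rewrite add1n; move: (bigop.body _ _ _) (bigop.body _ _ _). 
      by move: (nth _ nu i) (nth _ lam i) => a b; clear; lia.
    have jne : Ordinal jM != Ordinal iM by rewrite -val_eqE /= eq_sym.
    rewrite (bigD1 (Ordinal jM)) //= [in RHS](bigD1 (Ordinal jM)) //=.
    have : (\sum_(k < M | (k != Ordinal iM) && (k != Ordinal jM)) nth 0%N lam k <=
            \sum_(k < M | (k != Ordinal iM) && (k != Ordinal jM)) nth 0%N nu k)%N
      by apply: leq_sum.
    move: (le j) lti; move: (bigop.body _ _ _) (bigop.body _ _ _).
    move: (nth _ nu i) (nth _ lam i) (nth _ nu j) (nth _ lam j) => a b c d.
    by clear; lia.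
  have isz : (i <= size lam)%N.
    rewrite leqNgt; apply/negP => lt; have := nth_partition pnu (ltnW lt).
    by rewrite !eqj eqxx (gtn_eqF lt) !nth_default // ltnW.
  have nE j : nth 0%N nu j = nth 0%N (incr_nth lam i) j by rewrite eqj nth_incr_nth.
  apply: partition_eq => //; apply/is_partitionP; split => [j|j].
    by rewrite -!nE; apply: (nth_partition pnu).
  rewrite size_incr_nth nth_incr_nth; have [<-|ne] := eqVneq i j; first by [].
  rewrite add0n nth_partition_gt0 //; have [il|il] := ltnP i (size lam) => //.
  by move: ne isz il => /eqP; clear; lia.
have nE j : nth 0%N nu j = ((i == j) + nth 0%N lam j)%N by rewrite E nth_incr_nth.
split => //; first by rewrite E sumn_incr_nth.
apply/andP; split.
  by rewrite E size_incr_nth; case: ltnP => // h; apply: leqW.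
by apply/allP => j _; rewrite nE leq_addl.
Qed.

(** A row of length 1 is dropped, as partitions have no zero parts. Cutting off everything below it
    is correct for a removable row, which is then the last one. *)
Definition decr_nth nu i : seq nat :=
  if nth 0%N nu i == 1%N then take i nu else set_nth 0%N nu i (nth 0%N nu i).-1.

Definition removable nu i := (nth 0%N nu i.+1 < nth 0%N nu i)%N.

Lemma decr_nthP nu i : is_partition nu -> removable nu i ->
  is_partition (decr_nth nu i) /\ incr_nth (decr_nth nu i) i = nu.
Proof.
rewrite /removable => pnu lti.
have isz : (i < size nu)%N by rewrite -(nth_partition_gt0 _ pnu); move: lti; lia.
have nE j : nth 0%N (decr_nth nu i) j = (nth 0%N nu j - (i == j))%N.
  rewrite /decr_nth; case: ifPn => [/eqP e1|ne1].
    have [<-|] := eqVneq i j; first by rewrite nth_default ?e1 // size_take isz.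
    have [ji _|ij ne] := ltnP j i; first by rewrite nth_take // subn0.
    rewrite nth_default ?size_take ?isz //.
    have := nth_partition pnu (_ : i.+1 <= j)%N.
    by move: ne lti => /eqP; lia.
  by rewrite nth_set_nth /= eq_sym; case: eqVneq => [->|]; lia.
have pd : is_partition (decr_nth nu i).
  apply/is_partitionP; split => [j|j].
    rewrite !nE; have := nth_partition pnu (leqnSn j).
    have [e|_] := eqVneq i j; last first.
      by rewrite /= subn0 (leq_trans (leq_subr _ _)) // nth_partition.
    rewrite -e (ltn_eqF (ltnSn i)) /= subn0; move: lti; clear.
    by move: (nth _ nu i) (nth _ nu i.+1); lia.
  rewrite nE /decr_nth; case: ifPn => [_|/eqP e1].
    rewrite size_take isz => ji; rewrite (gtn_eqF ji) subn0 nth_partition_gt0 //.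
    exact: ltn_trans isz.
  rewrite size_set_nth (maxn_idPr isz) => js.
  have : (0 < nth 0%N nu j)%N by rewrite nth_partition_gt0.
  by have [<-|] := eqVneq i j; lia.
split=> //; apply: (@eq_from_nth _ 0%N); last first.
  by move=> j _; rewrite nth_incr_nth nE; case: eqVneq => [<-|]; lia.
rewrite size_incr_nth; have [e1|ne1] := eqVneq (nth 0%N nu i) 1%N; last first.
  by rewrite /decr_nth (negPf ne1) size_set_nth (maxn_idPr isz) isz.
rewrite /decr_nth e1 eqxx size_take isz ltnn; apply/eqP; rewrite eqn_leq isz leqNgt /=.
by rewrite -(nth_partition_gt0 _ pnu); move: lti; rewrite e1; lia.
Qed.

Lemma incr_nthK lam i : is_partition lam -> is_partition (incr_nth lam i) ->
  removable (incr_nth lam i) i /\ decr_nth (incr_nth lam i) i = lam.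
Proof.
move=> plam pinc.
have rm : removable (incr_nth lam i) i.
  by rewrite /removable !nth_incr_nth eqxx ltn_eqF // add0n ltnS; apply: nth_partition.
split=> //; have [pd E] := decr_nthP pinc rm; apply: partition_eq => // j.
by have := congr1 (fun s => nth 0%N s j) E; rewrite !nth_incr_nth => /addnI.
Qed.

(** The strict bound on the size leaves room for the box that opens a new row; any later row gives
    no partition. *)
Lemma big_covers_up (T : Type) (idx : T) (op : Monoid.com_law idx)
    lam n L (f : seq nat -> T) : lam \in Yn n -> (size lam < L)%N ->
  \big[op/idx]_(nu <- Yn n.+1 | covers nu lam) f nu =
  \big[op/idx]_(i < L | is_partition (incr_nth lam i)) f (incr_nth lam i).
Proof.
rewrite mem_Yn => /andP[plam /eqP sl] szL.
rewrite -(big_mkord (fun i => is_partition (incr_nth lam i)) (fun i => f (incr_nth lam i))).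
rewrite -big_filter -[RHS]big_filter -(big_map (incr_nth lam) xpredT f).
apply: perm_big; apply: uniq_perm; first by rewrite filter_uniq ?uniq_Yn.
  rewrite map_inj_in_uniq ?filter_uniq ?iota_uniq // => i j _ _ E.
  apply/eqP; have := congr1 (fun s => nth 0%N s i) E; rewrite !nth_incr_nth eqxx.
  by move/addIn; case: (eqVneq j i) => // ->.
move=> nu; rewrite mem_filter mem_Yn; apply/andP/mapP.
  move=> [/coversP[i [pnu _ E]] _]; exists i => //.
  rewrite mem_filter -E pnu mem_iota subn0 add0n (leq_ltn_trans _ szL) //.
  by apply: incr_nth_size_le; rewrite -E.
case=> i; rewrite mem_filter => /andP[pin _] ->; split.
  by apply/coversP; exists i.
by rewrite pin sumn_incr_nth sl eqxx.
Qed.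

Lemma big_covers_down (T : Type) (idx : T) (op : Monoid.com_law idx)
    nu n L (f : seq nat -> T) : nu \in Yn n.+1 -> (size nu <= L)%N ->
  \big[op/idx]_(mu <- Yn n | covers nu mu) f mu =
  \big[op/idx]_(i < L | removable nu i) f (decr_nth nu i).
Proof.
rewrite mem_Yn => /andP[pnu /eqP sl] szL.
rewrite -(big_mkord (fun i => removable nu i) (fun i => f (decr_nth nu i))).
rewrite -big_filter -[RHS]big_filter -(big_map (decr_nth nu) xpredT f).
apply: perm_big; apply: uniq_perm; first by rewrite filter_uniq ?uniq_Yn.
  rewrite map_inj_in_uniq ?filter_uniq ?iota_uniq // => i j.
  rewrite !mem_filter => /andP[/(decr_nthP pnu)[_ Ei] _] /andP[/(decr_nthP pnu)[_ Ej] _] E.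
  apply/eqP; have := congr1 (fun s => nth 0%N s i) (etrans Ei (esym Ej)).
  by rewrite E !nth_incr_nth eqxx => /addIn; case: (eqVneq j i) => // ->.
move=> mu; rewrite mem_filter mem_Yn; apply/andP/mapP.
  move=> [/coversP[i [pnu' pmu E]] _]; exists i.
    have [] := incr_nthK pmu (i := i); rewrite -E // => rm _.
    rewrite mem_filter rm mem_iota subn0 add0n (leq_trans _ szL) //.
    by rewrite -(nth_partition_gt0 _ pnu); move: rm; rewrite /removable; lia.
  by rewrite E; case: (incr_nthK (i := i) pmu) => //; rewrite -E.
case=> i; rewrite mem_filter => /andP[/(decr_nthP pnu)[pd E] _] ->; split.
  by apply/coversP; exists i; rewrite E.
by rewrite pd -eqSS -sl -{2}E sumn_incr_nth eqxx.
Qed.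

End Diagrams.

(** * The Frobenius formula and the moments of the transition probabilities *)

Lemma big_mkseq (T I : Type) (idx : T) (op : T -> T -> T) (f : nat -> I) L
    (P : pred I) (F : I -> T) :
  \big[op/idx]_(x <- mkseq f L | P x) F x =
  \big[op/idx]_(i < L | P (f i)) F (f i).
Proof.
by rewrite -(big_mkord (fun i => P (f i)) (fun i => F (f i))) /index_iota subn0 big_map.
Qed.

Section Moments.
Variable R : realType.
Implicit Types (lam mu nu : seq nat) (n i j : nat).

(** The content of the box that would be added at the end of row i, rows and columns being counted
    from 0; the last box of the row has content one less. Empty rows give -i. *)
Definition content lam i : R := (nth 0%N lam i)%:R - i%:R.

Lemma content_lt lam i j : is_partition lam -> (i < j)%N ->
  content lam j < content lam i.
Proof.
move=> plam ij; rewrite /content ltrBlDr -addrA.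
have -> : - i%:R + j%:R = (j - i)%:R :> R by rewrite natrB 1?ltnW // addrC.
rewrite -natrD ltr_nat; have := nth_partition plam (ltnW ij).
by move: (nth _ _ _) (nth _ _ _); lia.
Qed.

Lemma content_inj lam : is_partition lam -> injective (content lam).
Proof.
move=> plam i j /eqP E; apply/eqP; apply: contraTT E.
by rewrite neq_ltn => /orP[] /(content_lt plam) /lt_eqF; rewrite ?(eq_sym (content _ i)) => ->.
Qed.

Lemma content_incr lam i j :
  content (incr_nth lam i) j = content lam j + (i == j)%:R.
Proof. by rewrite /content nth_incr_nth natrD; ring. Qed.

Definition vandermonde_prod L (c : nat -> R) : R :=
  \prod_(i < L) \prod_(j < L | (i < j)%N) (c i - c j).

Lemma vandermonde_prod_split L (c : nat -> R) (i0 : 'I_L) : vandermonde_prod L c =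
  (\prod_(j < L | j != i0) ((if (i0 < j)%N then 1 else -1) * (c i0 - c j))) *
  \prod_(i < L | i != i0) \prod_(j < L | (i < j)%N && (j != i0)) (c i - c j).
Proof.
rewrite /vandermonde_prod (bigD1 i0) //=.
have -> : \prod_(i < L | i != i0) \prod_(j < L | (i < j)%N) (c i - c j) =
  \prod_(i < L | i != i0) ((if (i < i0)%N then c i - c i0 else 1) *
     \prod_(j < L | (i < j)%N && (j != i0)) (c i - c j)).
  apply: eq_bigr => i ne; case: ifPn => lt; first by rewrite (bigD1 i0).
  rewrite mul1r; apply: eq_bigl => j; apply/esym/andb_idr => ij.
  by apply: contraNneq lt => <-.
rewrite big_split /= mulrA; congr (_ * _).
rewrite [X in _ = X](bigID (fun j : 'I_L => (i0 < j)%N)) /=; congr (_ * _).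
  apply: eq_big => [j|j ->]; last by rewrite mul1r.
  by apply/esym/andb_idl; rewrite -val_eqE /= => /gtn_eqF ->.
rewrite [RHS]big_mkcondr /=; apply: eq_bigr => j ne.
have : (j < i0)%N = ~~ (i0 < j)%N.
  by rewrite -leqNgt ltn_neqAle -[val j == val i0]/(j == i0) ne.
by move=> ->; case: (i0 < j)%N => /=; ring.
Qed.

(** The signs caused by the order of the indices are the same for [c] and [c'], so they disappear
    from the ratio. *)
Lemma vandermonde_prod_upd L (c c' : nat -> R) (i0 : 'I_L) :
  (forall j : 'I_L, j != i0 -> c' j = c j) ->
  \prod_(j < L | j != i0) (c i0 - c j) != 0 ->
  vandermonde_prod L c' = vandermonde_prod L c *
    (\prod_(j < L | j != i0) (c' i0 - c j) / \prod_(j < L | j != i0) (c i0 - c j)).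
Proof.
move=> cc' nz; rewrite !(vandermonde_prod_split _ i0) !big_split /=.
have -> : \prod_(i < L | i != i0) \prod_(j < L | (i < j)%N && (j != i0)) (c' i - c' j) =
          \prod_(i < L | i != i0) \prod_(j < L | (i < j)%N && (j != i0)) (c i - c j).
  by apply: eq_bigr => i ne; apply: eq_bigr => j /andP[_ nj]; rewrite !cc'.
have -> : \prod_(j < L | j != i0) (c' i0 - c' j) = \prod_(j < L | j != i0) (c' i0 - c j).
  by apply: eq_bigr => j ne; rewrite (cc' j).
by field.
Qed.

(** The first-column hook lengths of the diagram, padded with empty rows to L rows. *)
Definition row_hook lam L i : nat := (nth 0 lam i + (L - i.+1))%N.

(* Up to a constant depending on L only, the Frobenius formula for dim lam. *)
Definition frobenius_dim L lam : R :=
  (sumn lam)`!%:R * (\prod_(i < L) (row_hook lam L i)`!%:R^-1) *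
  vandermonde_prod L (content lam).

(** The Plancherel growth probability dim nu / ((n + 1) dim lam) of a box in row i ([dimD_up]).
    Likewise [down_weight] is |nu| dim mu / dim nu for the box removed from row i ([dimD_down]). *)
Definition up_weight L lam i : R :=
  \prod_(j < L | j != i :> nat) (content lam i + 1 - content lam j) /
  ((content lam i + L%:R) *
   \prod_(j < L | j != i :> nat) (content lam i - content lam j)).

Definition down_weight L lam i : R :=
  (content lam i + L%:R - 1) *
  \prod_(j < L | j != i :> nat) (content lam i - 1 - content lam j) /
  \prod_(j < L | j != i :> nat) (content lam i - content lam j).

Lemma prod_content_neq0 L lam i : is_partition lam ->
  \prod_(j < L | j != i :> nat) (content lam i - content lam j) != 0.
Proof.
move=> plam; apply/prodf_neq0 => j ne; rewrite subr_eq0.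
by apply: contraNneq ne => /(content_inj plam) ->.
Qed.

Lemma row_hookE lam L i : (i < L)%N ->
  (row_hook lam L i).+1%:R = content lam i + L%:R.
Proof.
move=> iL; rewrite /row_hook /content -addnS -subSn // subSS natrD natrB 1?ltnW //.
by ring.
Qed.

Lemma content_addL_gt0 lam L i : (i < L)%N -> 0 < content lam i + L%:R.
Proof. by move=> iL; rewrite -row_hookE. Qed.

Lemma prod_row_hook_incr L lam i : (i < L)%N ->
  \prod_(j < L) (row_hook (incr_nth lam i) L j)`!%:R^-1 =
  \prod_(j < L) (row_hook lam L j)`!%:R^-1 / (content lam i + L%:R).
Proof.
move=> iL; rewrite (bigD1 (Ordinal iL)) //= [in RHS](bigD1 (Ordinal iL)) //=.
have -> : row_hook (incr_nth lam i) L i = (row_hook lam L i).+1.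
  by rewrite /row_hook nth_incr_nth eqxx.
rewrite factS natrM row_hookE // invfM.
have -> : \prod_(j < L | j != Ordinal iL) (row_hook (incr_nth lam i) L j)`!%:R^-1 =
          \prod_(j < L | j != Ordinal iL) (row_hook lam L j)`!%:R^-1 :> R.
  apply: eq_bigr => j; rewrite -val_eqE /= => ne.
  by rewrite /row_hook nth_incr_nth eq_sym (negPf ne).
by ring.
Qed.

Lemma frobenius_dim_incr L lam i : is_partition lam -> (i < L)%N ->
  frobenius_dim L (incr_nth lam i) =
  (sumn lam).+1%:R * frobenius_dim L lam * up_weight L lam i.
Proof.
move=> plam iL; rewrite /frobenius_dim sumn_incr_nth factS natrM.
rewrite prod_row_hook_incr // (@vandermonde_prod_upd L (content lam) _ (Ordinal iL)).
- rewrite /= content_incr eqxx /up_weight.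
  have nz := prod_content_neq0 L i plam.
  have nz' := lt0r_neq0 (content_addL_gt0 lam iL).
  by field; rewrite ?nz ?nz'.
- by move=> j; rewrite -val_eqE /= => ne; rewrite content_incr eq_sym (negPf ne) addr0.
- exact: prod_content_neq0.
Qed.

Lemma frobenius_dim_decr L mu i : is_partition mu -> is_partition (incr_nth mu i) ->
  (i < L)%N ->
  (sumn mu).+1%:R * frobenius_dim L mu =
  frobenius_dim L (incr_nth mu i) * down_weight L (incr_nth mu i) i.
Proof.
move=> pmu pinc iL; rewrite /frobenius_dim sumn_incr_nth factS natrM.
rewrite prod_row_hook_incr //.
rewrite (@vandermonde_prod_upd L (content (incr_nth mu i)) (content mu) (Ordinal iL)).
- rewrite /down_weight /= content_incr eqxx /=.
  have nz := prod_content_neq0 L i pinc; rewrite content_incr eqxx /= in nz.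
  have nz' := lt0r_neq0 (content_addL_gt0 mu iL).
  have -> : content mu i + 1%:R + L%:R - 1 = content mu i + L%:R by ring.
  have -> : content mu i + 1%:R - 1 = content mu i by ring.
  by field; rewrite ?nz ?nz'.
- by move=> j; rewrite -val_eqE /= => ne; rewrite content_incr eq_sym (negPf ne) addr0.
- exact: prod_content_neq0.
Qed.

Lemma residue_sum_mkseq L (f : nat -> R) qs r : injective f ->
  residue_sum (mkseq f L) qs r =
  \sum_(i < L) f i ^+ r * (\prod_(q <- qs) (f i - q)) /
      \prod_(j < L | j != i :> nat) (f i - f j).
Proof.
move=> finj; rewrite /residue_sum big_mkseq.
apply: eq_bigr => i _; rewrite big_mkseq.
by congr (_ / _); apply: eq_bigl => j; rewrite (inj_eq finj).
Qed.

(** For k >= 1 this is the sum of c^k over the addable boxes minus the sum over the removable ones: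
    the other terms cancel between consecutive rows. Subtracting the empty rows makes it independent
    of padding. *)
Definition content_psum k lam : R :=
  \sum_(i < size lam)
    ((content lam i ^+ k - (content lam i - 1) ^+ k) -
     ((- i%:R) ^+ k - (- i%:R - 1) ^+ k)).

Lemma content_psum_widen k lam L : (size lam <= L)%N ->
  content_psum k lam = \sum_(i < L)
    ((content lam i ^+ k - (content lam i - 1) ^+ k) -
     ((- i%:R) ^+ k - (- i%:R - 1) ^+ k)).
Proof.
move=> sL; rewrite /content_psum.
rewrite -!(big_mkord xpredT (fun i => (content lam i ^+ k - (content lam i - 1) ^+ k) -
     ((- i%:R) ^+ k - (- i%:R - 1) ^+ k))).
rewrite [RHS](big_cat_nat _ sL) //= [X in _ = _ + X]big_nat [X in _ = _ + X]big1 ?addr0 //.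
by move=> i /andP[si _]; rewrite /content nth_default // sub0r subrr.
Qed.

(** The terms of the empty rows telescope; the exponent is positive, so the end at 0 contributes
    nothing. *)
Lemma content_psumE k lam L : (size lam <= L)%N ->
  content_psum k.+1 lam =
  \sum_(i < L) (content lam i ^+ k.+1 - (content lam i - 1) ^+ k.+1) +
  (- L%:R) ^+ k.+1.
Proof.
move=> sL; rewrite (content_psum_widen _ sL) sumrB; congr (_ + _).
rewrite -(big_mkord xpredT (fun i => (- i%:R) ^+ k.+1 - (- i%:R - 1) ^+ k.+1)) -sumrN.
rewrite (telescope_sumr_eq (fun i => (- i%:R) ^+ k.+1)) //; first by rewrite oppr0 expr0n /= subr0.
by move=> i _; rewrite opprB -natr1 opprD.
Qed.

Lemma content_shift_inj lam : is_partition lam -> injective (fun i => content lam i - 1).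
Proof. by move=> plam i j /addIr /(content_inj plam). Qed.

(** The weights are residues of a function with poles at the contents of K + 1 rows and zeros at the
    contents minus 1 of K rows, so the exponent of the series is poles minus zeros, that is
    [content_psum]. *)
Lemma up_weight_moment K lam r : is_partition lam -> (size lam <= K)%N ->
  \sum_(i < K.+1) up_weight K.+1 lam i * content lam i ^+ r =
  newton (content_psum^~ lam) r.
Proof.
move=> plam sK; set f := content lam.
transitivity (residue_sum (mkseq f K.+1) (mkseq (fun j => f j - 1) K) r).
  rewrite residue_sum_mkseq; last exact: content_inj.
  apply: eq_bigr => i _; rewrite big_mkseq.
  have nz := prod_content_neq0 K.+1 i plam.
  have nz' := lt0r_neq0 (content_addL_gt0 lam (ltn_ord i)).
  rewrite /up_weight -/f; rewrite -/f in nz nz'.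
  (* Row K is empty, so f K = -K and its factor f i + 1 + K cancels the denominator f i + K.+1; the
     factor j = i is 1. *)
  have -> : \prod_(j < K) (f i - (f j - 1)) =
     (\prod_(j < K.+1 | j != i :> nat) (f i + 1 - f j)) / (f i + K.+1%:R).
    apply: (mulIf nz'); rewrite divfK //.
    transitivity (\prod_(j < K.+1) (f i + 1 - f j)).
      rewrite big_ord_recr /=; congr (_ * _); first by apply: eq_bigr => j _; ring.
      by rewrite [f K]/content nth_default // -natr1; ring.
    rewrite (bigD1 i) //= -[RHS]mul1r; congr (_ * _); first by ring.
  move: (f i + K.+1%:R) nz' (bigop.body _ _ _) nz => a anz b bnz.
  by field; rewrite anz bnz.
rewrite residue_sumE; last by rewrite mkseq_uniq //; apply: content_inj.
rewrite !size_mkseq /newton_sub -addnS leq_addl addnK.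
apply: eq_newton => k; rewrite (content_psumE _ (leqW sK)) /psums.
rewrite !big_mkseq.
rewrite sumrB [X in _ - X + _]big_ord_recr /=.
have -> : content lam K - 1 = - K.+1%:R.
  by rewrite /content nth_default // -natr1; ring.
by rewrite -/f; ring.
Qed.

(** Zeros and poles trade places, which changes the sign in the exponent. There is one more zero
    (-L) than there are poles, whence the index r + 2. *)
Lemma down_weight_moment L lam r : is_partition lam -> (size lam <= L)%N ->
  \sum_(i < L) down_weight L lam i * (content lam i - 1) ^+ r =
  - newton (fun k => - content_psum k lam) r.+2.
Proof.
move=> plam sL; set f := content lam.
transitivity (- residue_sum (mkseq (fun j => f j - 1) L) (- L%:R :: mkseq f L) r).
  rewrite residue_sum_mkseq; last exact: content_shift_inj.
  rewrite -sumrN; apply: eq_bigr => i _; rewrite big_cons big_mkseq.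
  have nz := prod_content_neq0 L i plam.
  rewrite /down_weight -/f; rewrite -/f in nz.
  (* The zero f i next to the pole f i - 1 contributes the factor -1, the source of the sign in
     front. *)
  rewrite [X in _ * (_ * X)](bigD1 i) //=.
  have -> : \prod_(j < L | j != i :> nat) (f i - 1 - (f j - 1)) =
            \prod_(j < L | j != i :> nat) (f i - f j).
    by apply: eq_bigr => j _; ring.
  by field; rewrite nz.
rewrite residue_sumE; last by rewrite mkseq_uniq //; apply: content_shift_inj.
rewrite /= !size_mkseq /newton_sub addnS -addSn -addSn leq_addl addnK; congr (- _).
apply: eq_newton => k; rewrite (content_psumE _ sL) /psums big_cons.
rewrite !big_mkseq sumrB -/f.
by ring.
Qed.

Lemma content_psum1 lam : content_psum 1 lam = 0.
Proof. by rewrite /content_psum big1 // => i _; rewrite !expr1; ring. Qed.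

Lemma content_psum2 lam : content_psum 2 lam = 2 * (sumn lam)%:R.
Proof.
rewrite /content_psum (sumn_nth (leqnn _)) natr_sum mulr_sumr; apply: eq_bigr => i _.
by rewrite /content; ring.
Qed.

Lemma newton1 s : newton s 1 = s 1%N :> R.
Proof. by have := newtonS s 0; rewrite big_ord_recl big_ord0 !mul1r mulr1 addr0. Qed.

Lemma newton2 s : s 1%N = 0 -> newton s 2 = s 2%N / 2 :> R.
Proof.
move=> s1; have := newtonS s 1; rewrite !big_ord_recl big_ord0 /= s1 newton0.
by rewrite mul0r !add0r addr0 mulr1 => <-; field.
Qed.

(** The branching rule dim nu = sum of dim mu in terms of weights; [dimY_frobenius] rests on it. *)
Lemma down_weight_sum L lam : is_partition lam -> (size lam <= L)%N ->
  \sum_(i < L) down_weight L lam i = (sumn lam)%:R.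
Proof.
move=> plam sL; have := down_weight_moment 0 plam sL.
rewrite newton2 ?content_psum1 ?oppr0 // content_psum2.
under eq_bigr do rewrite expr0 mulr1.
by move=> ->; field.
Qed.

(** The next row has the same length, so its content is that of row i minus 1 and a factor vanishes.
    In the last row, which is then empty, the factor with L vanishes instead. *)
Lemma down_weight_eq0 L lam i : is_partition lam -> (size lam <= L)%N -> (i < L)%N ->
  ~~ removable lam i -> down_weight L lam i = 0.
Proof.
move=> plam sL iL; rewrite /removable -leqNgt => le.
have E : nth 0%N lam i.+1 = nth 0%N lam i.
  by apply/eqP; rewrite eqn_leq le (nth_partition plam).
have [iL'|] := ltnP i.+1 L.
  rewrite /down_weight (bigD1 (Ordinal iL')) /= ?gtn_eqF //.
  have -> : content lam i - 1 - content lam i.+1 = 0.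
    by rewrite /content E -natr1; ring.
  by rewrite mul0r mulr0 mul0r.
move=> Li; have {Li} EL : L = i.+1 by apply/eqP; rewrite eqn_leq Li iL.
rewrite /down_weight.
have -> : content lam i + L%:R - 1 = 0.
  by rewrite /content -E nth_default -?EL // EL -natr1; ring.
by rewrite !mul0r.
Qed.

(** Row 0 always admits a box; any other blocked row is as long as the row above, whose content is
    larger by exactly 1, so a factor vanishes. *)
Lemma up_weight_eq0 L lam i : is_partition lam -> (i < L)%N ->
  ~~ is_partition (incr_nth lam i) -> (size lam < L)%N -> up_weight L lam i = 0.
Proof.
move=> plam iL np sL.
have [k ik E] : exists2 k, i = k.+1 & nth 0%N lam k = nth 0%N lam i.
  case: i iL np => [|k] iL np.
    case/negP: np; apply/is_partitionP; split=> [[|j]|j]; rewrite ?nth_incr_nth /=.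
    - by rewrite add0n (leq_trans (nth_partition plam (leqnSn 0))) // leq_addl.
    - by rewrite !add0n; apply: nth_partition.
    rewrite size_incr_nth; case: j => [|j] //=; rewrite add0n nth_partition_gt0 //.
    by case: (ltnP 0 (size lam)).
  exists k => //; apply/eqP; rewrite eqn_leq (nth_partition plam (leqnSn k)) andbT.
  rewrite leqNgt; apply/negP => lt; case/negP: np; apply/is_partitionP.
  have ks : (k < size lam)%N by rewrite -(nth_partition_gt0 _ plam); apply: leq_ltn_trans lt.
  split=> j; rewrite ?nth_incr_nth.
    have [<-|ne] := eqVneq k j; first by rewrite eqxx (gtn_eqF (ltnSn k)) add1n add0n.
    rewrite eqSS (negPf ne) add0n; apply: leq_trans (nth_partition plam (leqnSn j)) _.
    exact: leq_addl.
  rewrite size_incr_nth; have [<-|ne] := eqVneq k.+1 j; first by [].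
  rewrite add0n nth_partition_gt0 //; case: (ltnP k.+1 (size lam)) => // sk.
  by move: ks sk ne => + + /eqP; clear; lia.
have kL : (k < L)%N by apply: ltn_trans iL; rewrite ik.
rewrite /up_weight (bigD1 (Ordinal kL)) /=; last by rewrite ik ltn_eqF.
have -> : content lam i + 1 - content lam k = 0.
  by rewrite /content E ik -natr1; ring.
by rewrite !mul0r.
Qed.

(** Both sides obey the branching recursion, the right one by [frobenius_dim_decr] and
    [down_weight_sum]; the value at the empty diagram fixes the constant. *)
Lemma dimY_frobenius L n lam : lam \in Yn n -> (size lam <= L)%N ->
  (dimY n lam)%:R * frobenius_dim L [::] = frobenius_dim L lam.
Proof.
elim: n lam => [|n IHn] lam lamY sL.
  move: lamY; rewrite mem_Yn => /andP[/size_partition s0 /eqP E].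
  by move: s0; rewrite E leqn0 size_eq0 => /eqP -> /=; rewrite mul1r.
have [plam sE] := YnP lamY.
rewrite /= (big_covers_down _ _ lamY sL) natr_sum mulr_suml.
have nz : n.+1%:R != 0 :> R by rewrite pnatr_eq0.
apply: (mulfI nz); rewrite mulr_sumr -[in RHS]sE mulrC -(down_weight_sum plam sL) mulr_sumr.
rewrite [RHS](bigID (fun i : 'I_L => removable lam i)) /= [X in _ = _ + X]big1 ?addr0.
  apply: eq_bigr => i rm; have [pd E] := decr_nthP plam rm.
  have sd : sumn (decr_nth lam i) = n.
    by apply/eqP; rewrite -eqSS -sE -[in X in _ == X]E sumn_incr_nth.
  have szd : (size (decr_nth lam i) <= L)%N.
    apply: leq_trans sL; rewrite -[X in (_ <= size X)%N]E size_incr_nth.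
    by case: ltnP => // h; apply: leqW.
  have := @frobenius_dim_decr L _ i pd; rewrite E sd => F.
  by rewrite IHn ?F ?mem_Yn ?pd ?sd ?eqxx.
by move=> i /(down_weight_eq0 plam sL (ltn_ord i)) ->; rewrite mulr0.
Qed.

Lemma frobenius_dim_gt0 L lam : is_partition lam -> 0 < frobenius_dim L lam.
Proof.
move=> plam; apply: mulr_gt0; first apply: mulr_gt0.
- by rewrite ltr0n fact_gt0.
- by apply: prodr_gt0 => i _; rewrite invr_gt0 ltr0n fact_gt0.
- by apply: prodr_gt0 => i _; apply: prodr_gt0 => j ij; rewrite subr_gt0 content_lt.
Qed.

Lemma dimD_frobenius L lam : is_partition lam -> (size lam <= L)%N ->
  (dimD lam)%:R = frobenius_dim L lam / frobenius_dim L [::].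
Proof.
move=> plam sL; have nz := lt0r_neq0 (frobenius_dim_gt0 L (isT : is_partition [::])).
apply: (mulIf nz); rewrite divfK //; apply: dimY_frobenius => //.
by rewrite mem_Yn plam eqxx.
Qed.

Lemma dimD_up n lam i L : lam \in Yn n -> is_partition (incr_nth lam i) -> (i < L)%N ->
  (size lam < L)%N ->
  (dimD (incr_nth lam i))%:R / (n.+1%:R * (dimD lam)%:R) = up_weight L lam i.
Proof.
move=> /YnP[plam <-] pinc iL sL.
rewrite (dimD_frobenius plam (ltnW sL)) (@dimD_frobenius L) //; last first.
  by rewrite size_incr_nth; case: ltnP => // _; apply: ltnW.
rewrite frobenius_dim_incr //.
have nz := lt0r_neq0 (frobenius_dim_gt0 L (isT : is_partition [::])).
have nz' := lt0r_neq0 (frobenius_dim_gt0 L plam).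
have nn : (sumn lam).+1%:R != 0 :> R by rewrite pnatr_eq0.
move: (_.+1%:R) nn => a nn.
by field; rewrite nz nz' nn.
Qed.

Lemma dimD_down n nu i L : nu \in Yn n.+1 -> removable nu i -> (i < L)%N ->
  (size nu <= L)%N ->
  (dimD (decr_nth nu i))%:R / (dimD nu)%:R = down_weight L nu i / n.+1%:R :> R.
Proof.
move=> /YnP[pnu sE] rm iL sL.
have [pd E] := decr_nthP pnu rm.
have sd : sumn (decr_nth nu i) = n.
  by apply/eqP; rewrite -eqSS -sE -[in X in _ == X]E sumn_incr_nth.
have szd : (size (decr_nth nu i) <= L)%N.
  apply: leq_trans sL; rewrite -[X in (_ <= size X)%N]E size_incr_nth.
  by case: ltnP => // h; apply: leqW.
rewrite (dimD_frobenius pd szd) (dimD_frobenius pnu sL).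
have := frobenius_dim_decr pd (_ : is_partition (incr_nth (decr_nth nu i) i)) iL.
rewrite E sd => /(_ pnu) F.
have nz := lt0r_neq0 (frobenius_dim_gt0 L (isT : is_partition [::])).
have nz' := lt0r_neq0 (frobenius_dim_gt0 L pnu).
have nn : n.+1%:R != 0 :> R by rewrite pnatr_eq0.
have -> : frobenius_dim L (decr_nth nu i) = frobenius_dim L nu * down_weight L nu i / n.+1%:R.
  by apply: (mulfI nn); rewrite F [RHS]mulrC divfK.
move: (_.+1%:R) nn {F} => a nn.
by field; rewrite nz nz' nn.
Qed.

End Moments.

(** * The filtration by degree *)

Section Span.
Variables (R : realType) (X : Type) (D : X -> Prop) (g : seq nat -> X -> R).

(* Linear combinations on D of the g rho over partitions rho of weight < d. *)
Inductive span (d : nat) (f : X -> R) : Prop :=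
| span_nil of (forall x, D x -> f x = 0)
| span_cons c rho f' of is_partition rho & (sumn rho < d)%N & span d f' &
    (forall x, D x -> f x = c * g rho x + f' x).

Lemma eq_span d f f' : (forall x, D x -> f x = f' x) -> span d f -> span d f'.
Proof.
move=> E [H|c rho h prho ltd sh H].
  by apply: span_nil => x Dx; rewrite -E ?H.
by apply: (@span_cons _ _ c rho h) => // x Dx; rewrite -E ?H.
Qed.

Lemma span0 d : span d (fun _ => 0). Proof. exact: span_nil. Qed.

Lemma span_le d e f : (d <= e)%N -> span d f -> span e f.
Proof.
move=> de; elim=> {f} [f H|f c rho h prho ltd sh IH H]; first exact: span_nil.
by apply: (@span_cons _ _ c rho h) => //; apply: leq_trans de.
Qed.

Lemma spanD d f h : span d f -> span d h -> span d (fun x => f x + h x).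
Proof.
move=> + sh; elim=> {f} [f H|f c rho f' prho ltd _ IH H].
  by apply: eq_span sh => x Dx; rewrite H ?add0r.
by apply: (span_cons (c := c) prho ltd IH) => x Dx; rewrite H ?addrA.
Qed.

Lemma spanZ d a f : span d f -> span d (fun x => a * f x).
Proof.
elim=> {f} [f H|f c rho f' prho ltd _ IH H].
  by apply: span_nil => x Dx; rewrite H ?mulr0.
by apply: (span_cons (c := a * c) prho ltd IH) => x Dx; rewrite H // mulrDr mulrA.
Qed.

Lemma spanN d f : span d f -> span d (fun x => - f x).
Proof. by move=> /(spanZ (-1)); apply: eq_span => x _; rewrite mulN1r. Qed.

Lemma spanB d f h : span d f -> span d h -> span d (fun x => f x - h x).
Proof. by move=> sf /spanN; apply: spanD. Qed.

Lemma span_sum (I : Type) (r : seq I) (P : pred I) (F : I -> X -> R) d :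
  (forall i, P i -> span d (F i)) -> span d (fun x => \sum_(i <- r | P i) F i x).
Proof.
move=> H; elim: r => [|i r IH].
  by apply: span_nil => x _; rewrite big_nil.
have [Pi|nPi] := boolP (P i); last first.
  by apply: eq_span IH => x _; rewrite big_cons (negPf nPi).
by apply: (eq_span _ (spanD (H i Pi) IH)) => x _; rewrite big_cons Pi.
Qed.

Lemma span_gen d rho : is_partition rho -> (sumn rho < d)%N -> span d (g rho).
Proof.
move=> prho ltd; apply: (span_cons (c := 1) prho ltd (span0 d)) => x _.
by rewrite mul1r addr0.
Qed.

Lemma span_lt0 f : span 0 f -> forall x, D x -> f x = 0.
Proof. by case. Qed.

Hypothesis gM : forall rho sigma, is_partition rho -> is_partition sigma ->
  exists tau, [/\ is_partition tau, sumn tau = (sumn rho + sumn sigma)%N &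
                  forall x, D x -> g tau x = g rho x * g sigma x].

(** Degree bounds are strict: degrees at most a - 1 and b - 1 multiply to at most a + b - 2, which
    is below c. *)
Lemma spanM a b c f h : (a + b <= c.+1)%N -> span a f -> span b h ->
  span c (fun x => f x * h x).
Proof.
move=> abc + sh; elim=> {f} [f H|f k rho f' prho lta _ IH H].
  by apply: span_nil => x Dx; rewrite H ?mul0r.
suff S : span c (fun x => k * (g rho x * h x)).
  by apply: eq_span (spanD S IH) => x Dx; rewrite H // mulrDl mulrA.
apply: spanZ => {H IH f f'}; elim: sh => {h} [h H|h l sigma h' psig ltb _ IH H].
  by apply: span_nil => x Dx; rewrite H ?mulr0.
have [tau [ptau stau gtau]] := gM prho psig.
have ltc : (sumn tau < c)%N by rewrite stau; move: abc lta ltb; clear; lia.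
apply: (span_cons (c := l) ptau ltc IH) => x Dx.
by rewrite H // gtau //; ring.
Qed.

End Span.

Arguments span_nil {R X D g d f}.
Arguments span_cons {R X D g d f}.

Lemma sort_partition (s : seq nat) : all (fun x => 0 < x)%N s ->
  is_partition (sort geq s).
Proof.
by move=> pos; rewrite /is_partition sort_sorted ?all_sort.
Qed.

Lemma partition_cat rho sigma : is_partition rho -> is_partition sigma ->
  is_partition (sort geq (rho ++ sigma)).
Proof.
move=> /andP[_ prho] /andP[_ psig]; apply: sort_partition.
by rewrite all_cat prho.
Qed.

Lemma sumn_sort (s : seq nat) : sumn (sort geq s) = sumn s.
Proof. by apply: perm_sumn; rewrite perm_sort. Qed.

(** * Polynomials in the content of one box *)

Section LowDegree.
Variable R : realType.

Definition low_poly (d : nat) (f : R -> R) : Prop :=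
  exists a : nat -> R, forall x, f x = \sum_(j < d) a j * x ^+ j.

Lemma low_polyD d f h : low_poly d f -> low_poly d h -> low_poly d (fun x => f x + h x).
Proof.
move=> [a Ha] [b Hb]; exists (fun j => a j + b j) => x.
by rewrite Ha Hb -big_split; apply: eq_bigr => j _; rewrite mulrDl.
Qed.

Lemma low_polyZ d c f : low_poly d f -> low_poly d (fun x => c * f x).
Proof.
move=> [a Ha]; exists (fun j => c * a j) => x.
by rewrite Ha mulr_sumr; apply: eq_bigr => j _; rewrite mulrA.
Qed.

Lemma low_polyXM d f : low_poly d f -> low_poly d.+1 (fun x => x * f x).
Proof.
move=> [a Ha]; exists (fun j => if j is j'.+1 then a j' else 0) => x.
rewrite big_ord_recl mul0r add0r Ha mulr_sumr; apply: eq_bigr => j _ /=.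
by rewrite exprS; ring.
Qed.

Lemma low_poly_le d e f : (d <= e)%N -> low_poly d f -> low_poly e f.
Proof.
move=> de [a Ha]; exists (fun j => if (j < d)%N then a j else 0) => x; rewrite Ha.
rewrite (big_ord_widen e (fun j => a j * x ^+ j)) // big_mkcond /=.
by apply: eq_bigr => j _; case: ifP; rewrite ?mul0r.
Qed.

Lemma low_polyXn d k : (k < d)%N -> low_poly d (fun x => x ^+ k).
Proof.
move=> kd; exists (fun j => (j == k)%:R) => x.
rewrite (bigD1 (Ordinal kd)) //= eqxx mul1r big1 ?addr0 // => j.
by rewrite -val_eqE /= => /negPf ->; rewrite mul0r.
Qed.

(* The increment of the k-th power sum when a box of content c is added. *)
Definition box_incr (k : nat) (c : R) : R := (c + 2^-1) ^+ k - (c - 2^-1) ^+ k.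

Lemma box_incr_top k :
  low_poly k.-1 (fun c => box_incr k c - k%:R * c ^+ k.-1).
Proof.
(* Raising the exponent by one mixes the difference and the sum of the two powers, so their leading
   terms are found together. *)
pose psi (j : nat) (c : R) := (c + 2^-1) ^+ j + (c - 2^-1) ^+ j.
suff : low_poly k.-1 (fun c => box_incr k c - k%:R * c ^+ k.-1) /\
       low_poly k (fun c => psi k c - 2 * c ^+ k) by case.
elim: k => [|k [IH1 IH2]].
  by split; exists (fun _ => 0) => x; rewrite big_ord0 /box_incr /psi !expr0; ring.
split=> /=.
  have [a Ha] : low_poly k (fun c => c * (box_incr k c - k%:R * c ^+ k.-1)
                          + 2^-1 * (psi k c - 2 * c ^+ k)).
    apply: low_polyD; last exact: low_polyZ.
    case: (k) IH1 => [|k'] IH1; last exact: low_polyXM.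
    by exists (fun _ => 0) => x; rewrite big_ord0 /box_incr !expr0; ring.
  exists a => x; rewrite -Ha /box_incr /psi !exprS -natr1.
  have -> : x * ((x + 2^-1) ^+ k - (x - 2^-1) ^+ k - k%:R * x ^+ k.-1) =
       x * ((x + 2^-1) ^+ k - (x - 2^-1) ^+ k) - k%:R * x ^+ k.
    by case: (k) => [|k'] /=; rewrite ?exprS ?expr0; ring.
  by field.
have H : low_poly k.+1 (fun c => c * (psi k c - 2 * c ^+ k) +
      (2^-1 * (box_incr k c - k%:R * c ^+ k.-1) + (k%:R / 2) * c ^+ k.-1)).
  apply: low_polyD; first exact: low_polyXM.
  apply: low_polyD; apply: low_polyZ; last by apply: low_polyXn; case: (k).
  by apply: low_poly_le IH1; case: (k) => //= k'; apply: leqW.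
case: H => a Ha; exists a => x; rewrite -Ha /box_incr /psi !exprS.
by field.
Qed.

End LowDegree.

(** * Power sums of a diagram and the degrees of content moments *)

Section Filtration.
Variable R : realType.
Implicit Types (lam mu nu rho : seq nat).

(** The function p_k of the Frobenius coordinates in row form ([diag_psum_frobenius] links the two).
    Summing over rows makes the effect of one added box a single term, whatever happens to the
    diagonal. *)
Definition diag_psum k lam : R :=
  \sum_(i < size lam) ((content R lam i - 2^-1) ^+ k - (- i%:R - 2^-1) ^+ k).

Definition diag_psum_prod rho lam : R := \prod_(k <- rho) diag_psum k lam.

Lemma diag_psum_widen k lam L : (size lam <= L)%N ->
  diag_psum k lam =
  \sum_(i < L) ((content R lam i - 2^-1) ^+ k - (- i%:R - 2^-1) ^+ k).
Proof.
move=> sL; rewrite /diag_psum.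
rewrite -!(big_mkord xpredT (fun i => (content R lam i - 2^-1) ^+ k - (- i%:R - 2^-1) ^+ k)).
rewrite [RHS](big_cat_nat _ sL) //= [X in _ = _ + X]big_nat [X in _ = _ + X]big1 ?addr0 //.
by move=> i /andP[si _]; rewrite /content nth_default // sub0r subrr.
Qed.

Lemma diag_psum_incr k lam i :
  diag_psum k (incr_nth lam i) = diag_psum k lam + box_incr k (content R lam i).
Proof.
pose L := maxn i.+1 (size lam).
have iL : (i < L)%N by rewrite leq_maxl.
rewrite !(@diag_psum_widen _ _ L) ?leq_maxr //; last first.
  by rewrite size_incr_nth /L; case: ltnP => _; rewrite ?leq_maxr // leq_maxl.
rewrite (bigD1 (Ordinal iL)) //= [in RHS](bigD1 (Ordinal iL)) //=.
rewrite content_incr eqxx /=.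
have -> : \sum_(j < L | j != Ordinal iL)
    ((content R (incr_nth lam i) j - 2^-1) ^+ k - (- j%:R - 2^-1) ^+ k) =
  \sum_(j < L | j != Ordinal iL) ((content R lam j - 2^-1) ^+ k - (- j%:R - 2^-1) ^+ k).
  apply: eq_bigr => j; rewrite -val_eqE /= => ne.
  by rewrite content_incr eq_sym (negPf ne) addr0.
rewrite /box_incr; have -> : content R lam i + 1%:R - 2^-1 = content R lam i + 2^-1 by field.
by ring.
Qed.

Lemma diag_psum0 lam : diag_psum 0 lam = 0.
Proof. by rewrite /diag_psum big1 // => i _; rewrite !expr0 subrr. Qed.

Lemma diag_psum1 lam : diag_psum 1 lam = (sumn lam)%:R.
Proof.
rewrite /diag_psum (sumn_nth (leqnn _)) natr_sum; apply: eq_bigr => i _.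
by rewrite !expr1 /content; ring.
Qed.

Notation spanY := (span (is_partition : seq nat -> Prop) diag_psum_prod).

Lemma diag_psum_prodM rho sigma : is_partition rho -> is_partition sigma ->
  exists tau, [/\ is_partition tau, sumn tau = (sumn rho + sumn sigma)%N &
    forall lam, is_partition lam ->
      diag_psum_prod tau lam = diag_psum_prod rho lam * diag_psum_prod sigma lam].
Proof.
move=> prho psig; exists (sort geq (rho ++ sigma)).
split; rewrite ?partition_cat ?sumn_sort ?sumn_cat // => lam _.
rewrite /diag_psum_prod -big_cat; apply: perm_big; rewrite perm_sort; exact: perm_refl.
Qed.

Lemma spanYM a b c f h : (a + b <= c.+1)%N -> spanY a f -> spanY b h ->
  spanY c (fun x => f x * h x).
Proof. exact: (spanM diag_psum_prodM). Qed.

Lemma spanY_cst c : spanY 1 (fun _ => c).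
Proof.
apply: (span_cons c [::] (fun _ => 0)) => //; first exact: span0.
by move=> lam _; rewrite /diag_psum_prod big_nil mulr1 addr0.
Qed.

Lemma spanY_psum k : spanY k.+1 (diag_psum k).
Proof.
case: k => [|k]; first by apply: span_nil => lam _; rewrite diag_psum0.
have := @span_gen R _ is_partition diag_psum_prod k.+2 [:: k.+1] isT.
rewrite /= addn0 => /(_ (ltnSn _)); apply: eq_span => lam _.
by rewrite /diag_psum_prod big_seq1.
Qed.

(** c^(k+1) - (c - 1)^(k+1) is [box_incr] at c - 1/2, and powers of c - 1/2, summed over rows
    against empty rows, are the functions [diag_psum]. *)
Lemma content_psum_top k : spanY k (fun lam => content_psum R k.+1 lam - k.+1%:R * diag_psum k lam).
Proof.
have [a Ha] := box_incr_top R k.+1; rewrite /= in Ha.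
have S : spanY k (fun lam => \sum_(j < k) a j * diag_psum j lam).
  apply: span_sum => j _; apply: spanZ; apply: span_le (spanY_psum j).
  exact: ltn_ord.
apply: eq_span S => lam _; rewrite /content_psum /diag_psum mulr_sumr -sumrB.
under eq_bigr do rewrite mulr_sumr.
rewrite exchange_big /=; apply: eq_bigr => i _.
under eq_bigr do rewrite mulrBr.
rewrite sumrB -!Ha /box_incr.
have -> : content R lam i - 2^-1 - 2^-1 = content R lam i - 1 by field.
have -> : - i%:R - 2^-1 - 2^-1 = - i%:R - 1 :> R by field.
by rewrite !subrK; ring.
Qed.

Lemma content_psum_span k : spanY k.+1 (content_psum R k.+1).
Proof.
have S := spanD (span_le (leqnSn k) (content_psum_top k)) (spanZ k.+1%:R (spanY_psum k)).
by apply: eq_span S => lam _; rewrite subrK.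
Qed.

(** In the recursion for the coefficient of index r + 1, a product of s_(k+1) and the coefficient of
    index r - k > 0 has degree k + (r - k - 1) < r; only s_(r+1) reaches degree r. The scalar e is 1
    for up and -1 for down moments. *)
Lemma newton_top e r : spanY r (fun lam =>
  newton (fun k => e * content_psum R k lam) r.+1 - e * diag_psum r lam).
Proof.
have [m] := ubnP r; elim: m r => // m IHm r /ltnSE ltrm.
have S : spanY r (fun lam => r.+1%:R^-1 *
    (e * (content_psum R r.+1 lam - r.+1%:R * diag_psum r lam) +
     \sum_(k < r) (e * content_psum R k.+1 lam) *
        newton (fun k => e * content_psum R k lam) (r - k.+1).+1)).
  apply: spanZ; apply: spanD; first by apply/spanZ/content_psum_top.
  apply: span_sum => k _; have kr := ltn_ord k.
  apply: (@spanYM k.+1 (r - k.+1).+1).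
  - by move: kr; clear; lia.
  - by apply: spanZ; apply: content_psum_span.
  have lm : (r - k.+1 < m)%N by move: kr ltrm; clear; lia.
  have {}IH := IHm _ lm.
  have S := spanD (span_le (leqnSn _) IH) (spanZ e (spanY_psum (r - k.+1))).
  by apply: eq_span S => lam _; rewrite subrK.
apply: eq_span S => lam _; set s := fun k => e * content_psum R k lam.
have := newtonS s r; rewrite big_ord_recr /= subnn newton0 mulr1.
have -> : \sum_(i < r) s i.+1 * newton s (r - i) =
          \sum_(k < r) e * content_psum R k.+1 lam * newton s (r - k.+1).+1.
  by apply: eq_bigr => i _; rewrite subnSK.
rewrite -/s; set A := \sum_(_ < _) _ => E.
have nz : r.+1%:R != 0 :> R by rewrite pnatr_eq0.
apply: (mulfI nz); rewrite mulVKf // [RHS]mulrBr E /s; ring.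
Qed.

Lemma newton_span e r : spanY r.+1 (fun lam =>
  newton (fun k => e * content_psum R k lam) r.+1).
Proof.
have S := spanD (span_le (leqnSn r) (newton_top e r)) (spanZ e (spanY_psum r)).
by apply: eq_span S => lam _; rewrite subrK.
Qed.

Definition up_moment r lam : R := newton (content_psum R ^~ lam) r.
Definition down_moment r lam : R := - newton (fun k => - content_psum R k lam) r.+2.

Lemma up_moment0 lam : up_moment 0 lam = 1. Proof. exact: newton0. Qed.

Lemma up_moment1 lam : up_moment 1 lam = 0.
Proof. by rewrite /up_moment newton1 content_psum1. Qed.

Lemma up_moment2 lam : up_moment 2 lam = (sumn lam)%:R.
Proof. by rewrite /up_moment newton2 ?content_psum1 // content_psum2; field. Qed.

Lemma up_momentE r lam : up_moment r lam = newton (fun k => 1 * content_psum R k lam) r.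
Proof. by apply: eq_newton => k; rewrite mul1r. Qed.

Lemma down_momentE r lam :
  down_moment r lam = - newton (fun k => -1 * content_psum R k lam) r.+2.
Proof. by congr (- _); apply: eq_newton => k; rewrite mulN1r. Qed.

Lemma up_moment_top r : spanY r (fun lam => up_moment r.+1 lam - diag_psum r lam).
Proof. by apply: eq_span (newton_top 1 r) => lam _; rewrite up_momentE mul1r. Qed.

(** The moment of order r has degree r - 1 only; the moment of order 0, a constant, is the exception
    behind the maximum. *)
Lemma up_moment_span r : spanY (maxn r 1) (up_moment r).
Proof.
case: r => [|r]; first by apply: eq_span (spanY_cst 1).
rewrite (maxn_idPl _) //; apply: eq_span (newton_span 1 r) => lam _.
by rewrite up_momentE.
Qed.

Lemma down_moment_top r : spanY r.+1 (fun lam => down_moment r lam - diag_psum r.+1 lam).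
Proof.
apply: eq_span (spanN (newton_top (-1) r.+1)) => lam _; rewrite down_momentE; ring.
Qed.

(** Down weights add up to |lam| = p_1, so here averaging raises the degree by one. *)
Lemma down_moment_span r : spanY r.+2 (down_moment r).
Proof.
by apply: eq_span (spanN (newton_span (-1) r.+1)) => lam _; rewrite down_momentE.
Qed.

(* Polynomials in a variable c with coefficients in the filtered algebra, of
   total degree < K when c has degree 1. *)
Inductive spanC (K : nat) (G : seq nat -> R -> R) : Prop :=
| spanC_nil of (forall lam c, is_partition lam -> G lam c = 0)
| spanC_cons d a C G' of spanY d.+1 C & (d + a < K)%N & spanC K G' &
    (forall lam c, is_partition lam -> G lam c = C lam * c ^+ a + G' lam c).

Lemma eq_spanC K G G' : (forall lam c, is_partition lam -> G lam c = G' lam c) ->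
  spanC K G -> spanC K G'.
Proof.
move=> E [H|d a C H sC ltK sH HG].
  by apply: spanC_nil => lam c plam; rewrite -E ?H.
by apply: (spanC_cons sC ltK sH) => lam c plam; rewrite -E ?HG.
Qed.

Lemma spanCD K G H : spanC K G -> spanC K H -> spanC K (fun lam c => G lam c + H lam c).
Proof.
move=> + sH; elim=> {G} [G HG|G d a C G' sC ltK _ IH HG].
  by apply: eq_spanC sH => lam c plam; rewrite HG ?add0r.
by apply: (spanC_cons sC ltK IH) => lam c plam; rewrite HG // addrA.
Qed.

Lemma spanC_term K d a C : spanY d.+1 C -> (d + a < K)%N ->
  spanC K (fun lam c => C lam * c ^+ a).
Proof.
move=> sC lt; apply: (spanC_cons (G' := fun _ _ => 0) sC lt); first exact: spanC_nil.
by move=> lam c _; rewrite addr0.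
Qed.

Lemma spanCM K1 K2 K G H : (K1 + K2 <= K.+1)%N -> spanC K1 G -> spanC K2 H ->
  spanC K (fun lam c => G lam c * H lam c).
Proof.
move=> le + sH; elim=> {G} [G HG|G d a C G' sC ltK _ IH HG].
  by apply: spanC_nil => lam c plam; rewrite HG ?mul0r.
suff S : spanC K (fun lam c => C lam * c ^+ a * H lam c).
  by apply: eq_spanC (spanCD S IH) => lam c plam; rewrite HG // mulrDl.
move=> {IH HG G G'}; elim: sH => {H} [H HH|H d' a' C' H' sC' ltK' _ IH HH].
  by apply: spanC_nil => lam c plam; rewrite HH ?mulr0.
have sCC : spanY (d + d').+1 (fun lam => C lam * C' lam).
  by apply: spanYM sC sC'; rewrite addSn addnS.
have lt : (d + d' + (a + a') < K)%N by move: ltK ltK' le; clear; lia.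
apply: (spanC_cons sCC lt IH) => lam c plam.
by rewrite HH // exprD; ring.
Qed.

Lemma spanC_low K f : low_poly K f -> spanC K (fun _ c => f c).
Proof.
move=> [a Ha].
have S : spanC K (fun _ c => \sum_(j <- index_enum 'I_K) a j * c ^+ j).
  elim: (index_enum _) => [|j r IH].
    by apply: spanC_nil => lam c _; rewrite big_nil.
  have S := @spanC_term K 0 j (fun _ => a j) (spanY_cst _) (ltn_ord j).
  by apply: eq_spanC (spanCD S IH) => lam c _; rewrite big_cons.
by apply: eq_spanC S => lam c _; rewrite Ha.
Qed.

Lemma spanC_of_span d C : spanY d C -> spanC d (fun lam _ => C lam).
Proof.
case: d => [|d] sC.
  by apply: spanC_nil => lam c plam; rewrite (span_lt0 sC).
apply: eq_spanC (@spanC_term d.+1 d 0 C sC _) => //; last by rewrite addn0.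
by move=> lam c _; rewrite expr0 mulr1.
Qed.

(** The number of boxes bounds the number of rows, so the range covers every relevant row and
    depends on n alone. *)
Definition up_avg (G : seq nat -> R -> R) lam : R :=
  \sum_(i < (sumn lam).+1) up_weight R (sumn lam).+1 lam i * G lam (content R lam i).

Definition down_avg (G : seq nat -> R -> R) lam : R :=
  \sum_(i < sumn lam) down_weight R (sumn lam) lam i * G lam (content R lam i - 1).

Lemma up_avg_term C a lam : is_partition lam ->
  up_avg (fun lam c => C lam * c ^+ a) lam = C lam * up_moment a lam.
Proof.
move=> plam; rewrite /up_moment -(up_weight_moment R a plam (size_partition plam)).
by rewrite mulr_sumr; apply: eq_bigr => i _; ring.
Qed.

Lemma down_avg_term C a lam : is_partition lam ->
  down_avg (fun lam c => C lam * c ^+ a) lam = C lam * down_moment a lam.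
Proof.
move=> plam; rewrite /down_moment -(down_weight_moment R a plam (size_partition plam)).
by rewrite mulr_sumr; apply: eq_bigr => i _; ring.
Qed.

Lemma up_avgD G H lam :
  up_avg (fun lam c => G lam c + H lam c) lam = up_avg G lam + up_avg H lam.
Proof. by rewrite /up_avg -big_split; apply: eq_bigr => i _; rewrite mulrDr. Qed.

Lemma down_avgD G H lam :
  down_avg (fun lam c => G lam c + H lam c) lam = down_avg G lam + down_avg H lam.
Proof. by rewrite /down_avg -big_split; apply: eq_bigr => i _; rewrite mulrDr. Qed.

Lemma eq_up_avg G H lam : (forall c, G lam c = H lam c) -> up_avg G lam = up_avg H lam.
Proof. by move=> E; apply: eq_bigr => i _; rewrite E. Qed.

Lemma eq_down_avg G H lam : (forall c, G lam c = H lam c) -> down_avg G lam = down_avg H lam.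
Proof. by move=> E; apply: eq_bigr => i _; rewrite E. Qed.

Lemma up_avg0 G lam : (forall c, G lam c = 0) -> up_avg G lam = 0.
Proof. by move=> E; apply: big1 => i _; rewrite E mulr0. Qed.

Lemma down_avg0 G lam : (forall c, G lam c = 0) -> down_avg G lam = 0.
Proof. by move=> E; apply: big1 => i _; rewrite E mulr0. Qed.

(** The factor c^2 raises the degree by two and averaging lowers it by one. In [up_avg_span1] gain
    and loss cancel. *)
Lemma up_avg_span K G j : (j <= 2)%N -> spanC K G ->
  spanY K.+1 (up_avg (fun lam c => c ^+ j * G lam c)).
Proof.
move=> j2; elim=> {G} [G H|G d a C G' sC ltK _ IH H].
  by apply: span_nil => lam plam; rewrite up_avg0 // => c; rewrite H ?mulr0.
have S : spanY K.+1 (fun lam => C lam * up_moment (a + j) lam).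
  by apply: spanYM sC (up_moment_span _); move: ltK j2; clear; lia.
apply: eq_span (spanD S IH) => lam plam; rewrite -up_avg_term // -up_avgD.
by apply: eq_up_avg => c; rewrite H // exprD; ring.
Qed.

Lemma up_avg_span1 K G j : (j <= 1)%N -> spanC K G ->
  spanY K (up_avg (fun lam c => c ^+ j * G lam c)).
Proof.
move=> j1; elim=> {G} [G H|G d a C G' sC ltK _ IH H].
  by apply: span_nil => lam plam; rewrite up_avg0 // => c; rewrite H ?mulr0.
have S : spanY K (fun lam => C lam * up_moment (a + j) lam).
  by apply: spanYM sC (up_moment_span _); move: ltK j1; clear; lia.
apply: eq_span (spanD S IH) => lam plam; rewrite -up_avg_term // -up_avgD.
by apply: eq_up_avg => c; rewrite H // exprD; ring.
Qed.

Lemma down_avg_span K G : spanC K G -> spanY K.+1 (down_avg G).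
Proof.
elim=> {G} [G H|G d a C G' sC ltK _ IH H].
  by apply: span_nil => lam plam; rewrite down_avg0 // => c; rewrite H.
have S : spanY K.+1 (fun lam => C lam * down_moment a lam).
  by apply: spanYM sC (down_moment_span _); move: ltK; clear; lia.
apply: eq_span (spanD S IH) => lam plam; rewrite -down_avg_term // -down_avgD.
by apply: eq_down_avg => c; rewrite H.
Qed.

End Filtration.

(** * The action of T_n on products of power sums *)

Section Increments.
Variable R : realType.
Implicit Types (lam mu nu rho : seq nat).

Notation spanY := (span (is_partition : seq nat -> Prop) (@diag_psum_prod R)).

(** The sign e is 1 when a box of content c is added and -1 when it is removed. *)
Definition prod_incr (e : R) rho lam (c : R) : R :=
  \prod_(k <- rho) (diag_psum R k lam + e * box_incr k c) - diag_psum_prod R rho lam.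

(* The part of [prod_incr] that is linear in the box increments, with the
   leading term k c^(k-1) of each increment. *)
Fixpoint prod_incr_top (e : R) rho lam (c : R) : R :=
  if rho is k :: rho' then
    e * k%:R * c ^+ k.-1 * diag_psum_prod R rho' lam +
    diag_psum R k lam * prod_incr_top e rho' lam c
  else 0.

Lemma diag_psum_prod_cons k rho lam :
  diag_psum_prod R (k :: rho) lam = diag_psum R k lam * diag_psum_prod R rho lam.
Proof. exact: big_cons. Qed.

Lemma diag_psum_prod_span rho : all (fun x => 0 < x)%N rho ->
  spanY (sumn rho).+1 (diag_psum_prod R rho).
Proof.
move=> pos; have psort := sort_partition pos.
have := @span_gen R _ is_partition (diag_psum_prod R) (sumn rho).+1 (sort geq rho) psort.
rewrite sumn_sort => /(_ (ltnSn _)); apply: eq_span => lam _.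
by apply: perm_big; rewrite perm_sort; apply: perm_refl.
Qed.

Lemma box_incr_span k : spanC k (fun _ c => box_incr k c : R).
Proof.
apply: spanC_low; case: k => [|k].
  by exists (fun _ => 0) => x; rewrite big_ord0 /box_incr !expr0 subrr.
have [a Ha] : low_poly k.+1 (fun c : R => (box_incr k.+1 c - k.+1%:R * c ^+ k) + k.+1%:R * c ^+ k).
  apply: low_polyD; first exact: (low_poly_le (leqnSn k) (box_incr_top R k.+1)).
  by apply: low_polyZ; apply: low_polyXn.
by exists a => x; rewrite -Ha subrK.
Qed.

Lemma prod_incr_cons e k rho lam c : prod_incr e (k :: rho) lam c =
  diag_psum R k lam * prod_incr e rho lam c +
  e * box_incr k c * diag_psum_prod R rho lam + e * box_incr k c * prod_incr e rho lam c.
Proof. by rewrite /prod_incr diag_psum_prod_cons big_cons; ring. Qed.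

(** The increment of p_k has degree k - 1, so terms linear in increments have degree at most |rho| -
    1 and all others at most |rho| - 2. K stands for |rho| - 1 and is left free because subtraction
    on [nat] truncates. *)
Lemma prod_incr_span e rho K : all (fun x => 0 < x)%N rho -> (sumn rho <= K.+1)%N ->
  spanC (sumn rho) (prod_incr e rho) /\
  spanC K (fun lam c => prod_incr e rho lam c - prod_incr_top e rho lam c).
Proof.
elim: rho K => [|k rho IH] K /=.
  by move=> _ _; split; apply: spanC_nil => lam c _;
     rewrite /prod_incr /diag_psum_prod !big_nil; ring.
case/andP=> k0 pos leK.
have [SI _] := IH (sumn rho) pos (leqnSn _).
have sB : spanC k (fun _ c => e * box_incr k c).
  have /spanC_of_span : spanY 1 (fun _ => e) by apply: spanY_cst.
  by move/spanCM => /(_ _ k _ _ (box_incr_span k)); apply; rewrite add1n.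
have sP := spanC_of_span (diag_psum_prod_span pos).
split.
  apply: (@eq_spanC _ _ _ _ (fun lam c _ => esym (prod_incr_cons e k rho lam c))).
  apply: spanCD; first apply: spanCD.
  - by apply: spanCM (spanC_of_span (spanY_psum R k)) SI; rewrite addSn.
  - by apply: spanCM sB sP; rewrite addnS.
  - by apply: spanCM sB SI.
have S1 : spanC K (fun lam c => diag_psum R k lam *
                    (prod_incr e rho lam c - prod_incr_top e rho lam c)).
  (* An empty rest has no error term; a non-empty one guarantees k <= K, so that K - k is a true
     difference. *)
  case: rho pos leK IH SI sP => [|l rho] pos leK IH SI sP.
    apply: spanC_nil => lam c _.
    by rewrite /prod_incr /diag_psum_prod !big_nil /=; ring.
  have l0 : (0 < sumn (l :: rho))%N by move: pos => /= /andP[l0 _]; rewrite addn_gt0 l0.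
  have [_ SD] := IH (K - k)%N pos ltac:(move: leK l0; clear; lia).
  apply: spanCM (spanC_of_span (spanY_psum R k)) SD.
  by move: leK l0; clear; lia.
have S2 : spanC K (fun lam c => (e * (box_incr k c - k%:R * c ^+ k.-1)) *
                                 diag_psum_prod R rho lam).
  have H : spanC k.-1 (fun (_ : seq nat) c => e * (box_incr k c - k%:R * c ^+ k.-1)).
    by apply: (@spanC_low _ _ (fun c => e * (box_incr k c - k%:R * c ^+ k.-1)));
       apply: low_polyZ; apply: box_incr_top.
  by apply: spanCM H sP; move: leK k0; clear; lia.
have S3 : spanC K (fun lam c => e * box_incr k c * prod_incr e rho lam c).
  by apply: spanCM sB SI; move: leK; clear; lia.
apply: eq_spanC (spanCD (spanCD S1 S2) S3) => lam c _.
by rewrite prod_incr_cons /=; ring.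
Qed.

(** k c^(k-1) times c^2 averages to k times the moment of order k + 1, with top part k p_k; the
    Leibniz rule over the factors adds the k up to |rho|. In [down_avg_top] the moment of order k -
    1 plays this part. *)
Lemma up_avg_top rho : all (fun x => 0 < x)%N rho ->
  spanY (sumn rho) (fun lam => up_avg (fun lam c => c ^+ 2 * prod_incr_top 1 rho lam c) lam -
                               (sumn rho)%:R * diag_psum_prod R rho lam).
Proof.
elim: rho => [|k rho IH] /=.
  by move=> _; apply: span_nil => lam _; rewrite up_avg0 => [|c]; rewrite ?mulr0 ?mul0r ?subrr.
case/andP=> k0 pos.
have S1 : spanY (k + sumn rho) (fun lam => (k%:R * diag_psum_prod R rho lam) *
                           (up_moment R k.+1 lam - diag_psum R k lam)).
  by apply: spanYM (spanZ _ (diag_psum_prod_span pos)) (up_moment_top R k); rewrite addnC addnS.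
have S2 : spanY (k + sumn rho) (fun lam => diag_psum R k lam *
   (up_avg (fun lam c => c ^+ 2 * prod_incr_top 1 rho lam c) lam -
                               (sumn rho)%:R * diag_psum_prod R rho lam)).
  by apply: spanYM (spanY_psum R k) (IH pos); rewrite addSn.
apply: eq_span (spanD S1 S2) => lam plam.
rewrite diag_psum_prod_cons natrD.
have -> : up_avg (fun lam c => c ^+ 2 *
    (1 * k%:R * c ^+ k.-1 * diag_psum_prod R rho lam +
       diag_psum R k lam * prod_incr_top 1 rho lam c)) lam =
    (k%:R * diag_psum_prod R rho lam) * up_moment R k.+1 lam +
    diag_psum R k lam * up_avg (fun lam c => c ^+ 2 * prod_incr_top 1 rho lam c) lam.
  rewrite -(@up_avg_term _ (fun lam => k%:R * diag_psum_prod R rho lam)) //.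
  rewrite [X in _ = _ + X]mulr_sumr -big_split; apply: eq_bigr => i _ /=.
  have -> : k.+1 = (2 + k.-1)%N by move: k0; clear; lia.
  by rewrite exprD; ring.
by ring.
Qed.

Lemma down_avg_top rho : all (fun x => 0 < x)%N rho ->
  spanY (sumn rho) (fun lam => down_avg (prod_incr_top (-1) rho) lam +
                               (sumn rho)%:R * diag_psum_prod R rho lam).
Proof.
elim: rho => [|k rho IH] /=.
  by move=> _; apply: span_nil => lam _; rewrite down_avg0 ?mul0r ?addr0.
case/andP=> k0 pos.
have S1 : spanY (k + sumn rho) (fun lam => (- k%:R * diag_psum_prod R rho lam) *
                           (down_moment R k.-1 lam - diag_psum R k lam)).
  have := down_moment_top R k.-1; rewrite prednK // => H.
  by apply: spanYM (spanZ _ (diag_psum_prod_span pos)) H; rewrite addnC addnS.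
have S2 : spanY (k + sumn rho) (fun lam => diag_psum R k lam *
   (down_avg (prod_incr_top (-1) rho) lam + (sumn rho)%:R * diag_psum_prod R rho lam)).
  by apply: spanYM (spanY_psum R k) (IH pos); rewrite addSn.
apply: eq_span (spanD S1 S2) => lam plam.
rewrite diag_psum_prod_cons natrD.
have -> : down_avg (fun lam c => 
    (-1 * k%:R * c ^+ k.-1 * diag_psum_prod R rho lam +
       diag_psum R k lam * prod_incr_top (-1) rho lam c)) lam =
    (- k%:R * diag_psum_prod R rho lam) * down_moment R k.-1 lam +
    diag_psum R k lam * down_avg (prod_incr_top (-1) rho) lam.
  rewrite -(@down_avg_term _ (fun lam => - k%:R * diag_psum_prod R rho lam)) //.
  rewrite [X in _ = _ + X]mulr_sumr -big_split; apply: eq_bigr => i _ /=.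
  by ring.
by ring.
Qed.

End Increments.

(** * One up step, one down step and their composition *)

Section Steps.
Variables (R : realType) (z z' : R[i]).
Hypothesis Hzz : admissible z z'.
Implicit Types (lam mu nu rho : seq nat).

Notation spanY := (span (is_partition : seq nat -> Prop) (@diag_psum_prod R)).

Definition zz_prod : R := complex.Re (z * z').
Definition zz_sum : R := complex.Re (z + z').

(** (z + m)(z' + m) is |z + m|^2 in the principal series; in the complementary series both factors
    lie between the same consecutive integers, hence have the same sign. *)
Lemma admissibleP : [/\ z * z' = (zz_prod)%:C%C, z + z' = (zz_sum)%:C%C, 0 < zz_prod &
  forall m : int, 0 <= zz_prod + zz_sum * m%:~R + m%:~R ^+ 2].
Proof.
rewrite /zz_prod /zz_sum; case: Hzz => [[+ ->]|[N]].
  case: z => a b /= b0; split.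
  - by apply/eqP; rewrite eq_complex /=; apply/andP; split; apply/eqP; ring.
  - by apply/eqP; rewrite eq_complex /=; apply/andP; split; apply/eqP; ring.
  - have : 0 < b ^+ 2 by rewrite exprn_even_gt0.
    by have := sqr_ge0 a; nra.
  move=> m; have := sqr_ge0 (a + m%:~R); have := sqr_ge0 b; nra.
case: z z' => a b [a' b'] /= [-> [-> [/andP[aN aN1] /andP[a'N a'N1]]]].
have main (m : int) : 0 < (a + m%:~R) * (a' + m%:~R).
  have [le|lt] := lerP 0 (N + m).
    have H : 0 <= N%:~R + m%:~R :> R by rewrite -intrD ler0z.
    by apply: mulr_gt0; lra.
  have H : N%:~R + m%:~R + 1 <= 0 :> R by rewrite -intrD -[1]/(1%:~R) -intrD lerz0; lia.
  by rewrite nmulr_rgt0; lra.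
split.
- by apply/eqP; rewrite eq_complex /=; apply/andP; split; apply/eqP; ring.
- by apply/eqP; rewrite eq_complex /=; apply/andP; split; apply/eqP; ring.
- by have := main 0; rewrite !addr0 !mulr0 subr0.
by move=> m; have := ltW (main m); rewrite mul0r subr0; nra.
Qed.

Lemma zz_prod_gt0 : 0 < zz_prod. Proof. by case: admissibleP. Qed.

Lemma zz_den_gt0 n : 0 < zz_prod + n%:R.
Proof. by rewrite ltr_wpDr ?zz_prod_gt0. Qed.

Definition box_weight (c : R) : R := zz_prod + zz_sum * c + c ^+ 2.

Lemma box_weight_ge0 lam i : 0 <= box_weight (content R lam i).
Proof.
case: admissibleP => _ _ _ /(_ ((nth 0%N lam i)%:Z - i%:Z)).
by rewrite /box_weight /content intrB.
Qed.

Lemma poch_incr (w : R[i]) lam i : is_partition (incr_nth lam i) ->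
  poch w (incr_nth lam i) lam = w + (content R lam i)%:C%C.
Proof.
move=> pinc; have il : (i < size (incr_nth lam i))%N.
  by rewrite -(nth_partition_gt0 _ pinc) nth_incr_nth eqxx.
rewrite /poch (bigD1 (Ordinal il)) //= nth_incr_nth eqxx add1n big_nat1.
rewrite big1 ?mulr1; last first.
  move=> j; rewrite -val_eqE /= => ne; rewrite nth_incr_nth eq_sym (negPf ne).
  by rewrite big_geq.
by rewrite /content rmorphB /= !rmorph_nat addrA.
Qed.

Lemma p_up_incr n lam i L : lam \in Yn n -> is_partition (incr_nth lam i) ->
  (i < L)%N -> (size lam < L)%N ->
  p_up z z' n lam (incr_nth lam i) =
  box_weight (content R lam i) / (zz_prod + n%:R) * up_weight R L lam i.
Proof.
move=> lamY pinc iL sL; have plam := Yn_partition lamY.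
rewrite /p_up (introT (coversP _ _)); last by exists i.
rewrite (dimD_up R lamY pinc iL sL) !poch_incr //; congr (_ * _).
have [E1 E2 _ _] := admissibleP.
have -> : (z + (content R lam i)%:C%C) * (z' + (content R lam i)%:C%C) =
          (box_weight (content R lam i))%:C%C.
  rewrite /box_weight; move: (content R lam i) => c.
  by rewrite expr2 !rmorphD !rmorphM /= -E1 -E2; ring.
by rewrite E1 -(rmorph_nat (real_complex R)) -rmorphD -fmorphV -rmorphM.
Qed.

Lemma up_weight_ge0 lam i : is_partition lam -> is_partition (incr_nth lam i) ->
  0 <= up_weight R (sumn lam).+1 lam i.
Proof.
move=> plam pinc; have lamY : lam \in Yn (sumn lam) by rewrite mem_Yn plam eqxx.
have iL : (i < (sumn lam).+1)%N.
  by rewrite ltnS (leq_trans (incr_nth_size_le pinc)) ?size_partition.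
by rewrite -(dimD_up R lamY pinc iL) ?ltnS ?size_partition // divr_ge0.
Qed.

Lemma p_up_ge0 n lam nu : lam \in Yn n -> 0 <= p_up z z' n lam nu.
Proof.
move=> lamY; case: (boolP (covers nu lam)) => [/coversP[i [pnu plam E]]|]; last first.
  by rewrite /p_up => /negPf ->.
rewrite E in pnu *; have /eqP sE : sumn lam == n by move: lamY; rewrite mem_Yn plam.
have iL : (i < (sumn lam).+1)%N.
  by rewrite ltnS (leq_trans (incr_nth_size_le pnu)) ?size_partition.
rewrite (p_up_incr lamY pnu iL) ?ltnS ?size_partition //.
rewrite mulr_ge0 ?up_weight_ge0 // divr_ge0 ?box_weight_ge0 //.
exact/ltW/zz_den_gt0.
Qed.

Lemma p_down_ge0 nu mu : 0 <= p_down R nu mu.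
Proof. by rewrite /p_down; case: ifP => // _; rewrite divr_ge0. Qed.

(** Rows that admit no box have weight 0, so the sum can run over all rows, as the moment formulas
    require. *)
Lemma sum_p_up n lam (H : seq nat -> R) : lam \in Yn n ->
  \sum_(nu <- Yn n.+1) p_up z z' n lam nu * H nu =
  (\sum_(i < n.+1) up_weight R n.+1 lam i *
      (box_weight (content R lam i) * H (incr_nth lam i))) / (zz_prod + n%:R).
Proof.
move=> lamY; have [plam sE] := YnP lamY.
have sL : (size lam < n.+1)%N by rewrite ltnS -sE size_partition.
rewrite (bigID (fun nu => covers nu lam)) /= [X in _ + X]big1 ?addr0; last first.
  by move=> nu /negPf nc; rewrite /p_up nc mul0r.
rewrite (big_covers_up _ (fun nu => p_up z z' n lam nu * H nu) lamY sL) mulr_suml.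
rewrite [RHS](bigID (fun i : 'I_n.+1 => is_partition (incr_nth lam i))) /=.
rewrite [X in _ = _ + X]big1 ?addr0; last first.
  by move=> i np; rewrite (up_weight_eq0 R plam) ?mul0r.
by apply: eq_bigr => i pinc; rewrite (p_up_incr lamY pinc (ltn_ord i)) //; ring.
Qed.

Lemma sum_p_down n nu (H : seq nat -> R) : nu \in Yn n.+1 ->
  \sum_(mu <- Yn n) p_down R nu mu * H mu =
  (\sum_(i < n.+1) down_weight R n.+1 nu i * H (decr_nth nu i)) / n.+1%:R.
Proof.
move=> nuY; have [pnu sE] := YnP nuY.
have sL : (size nu <= n.+1)%N by rewrite -sE size_partition.
rewrite (bigID (fun mu => covers nu mu)) /= [X in _ + X]big1 ?addr0; last first.
  by move=> mu /negPf nc; rewrite /p_down nc mul0r.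
rewrite (big_covers_down _ (fun mu => p_down R nu mu * H mu) nuY sL) mulr_suml.
rewrite [RHS](bigID (fun i : 'I_n.+1 => removable nu i)) /=.
rewrite [X in _ = _ + X]big1 ?addr0; last first.
  by move=> i np; rewrite (down_weight_eq0 R pnu sL) ?mul0r.
apply: eq_bigr => i rm; have [pd E] := decr_nthP pnu rm.
rewrite /p_down (introT (coversP _ _)); last by exists i; rewrite E.
by rewrite (dimD_down R nuY rm (ltn_ord i) sL); ring.
Qed.

Lemma diag_psum_prod_incr rho lam i :
  diag_psum_prod R rho (incr_nth lam i) =
  diag_psum_prod R rho lam + prod_incr 1 rho lam (content R lam i).
Proof.
rewrite /prod_incr addrC subrK; apply: eq_bigr => k _.
by rewrite diag_psum_incr mul1r.
Qed.

Lemma diag_psum_prod_decr rho nu i : is_partition nu -> removable nu i ->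
  diag_psum_prod R rho (decr_nth nu i) =
  diag_psum_prod R rho nu + prod_incr (-1) rho nu (content R nu i - 1).
Proof.
move=> pnu rm; have [_ E] := decr_nthP pnu rm.
rewrite /prod_incr addrC subrK; apply: eq_bigr => k _.
rewrite -{2 3}E diag_psum_incr content_incr eqxx mulN1r.
by have -> : content R (decr_nth nu i) i + 1%:R - 1 = content R (decr_nth nu i) i; ring.
Qed.

Lemma up_step_prod rho : is_partition rho ->
  exists2 F, spanY (sumn rho) F &
  forall n lam, lam \in Yn n ->
    \sum_(nu <- Yn n.+1) p_up z z' n lam nu * diag_psum_prod R rho nu =
    diag_psum_prod R rho lam +
    ((sumn rho)%:R * diag_psum_prod R rho lam + F lam) / (zz_prod + n%:R).
Proof.
move=> /andP[_ pos]; set M := sumn rho; set P := diag_psum_prod R rho.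
have [SI _] := prod_incr_span (1 : R) pos (leqnSn M).
have [_ SM] := prod_incr_span (1 : R) pos (leqSpred M).
have SU : spanY M (up_avg (fun lam c =>
   c ^+ 2 * (prod_incr 1 rho lam c - prod_incr_top 1 rho lam c))).
  (* For M = 0 the predecessor is truncated; then rho is empty and the integrand is 0. *)
  have [M0|M0] := posnP M; last by rewrite -{1}(prednK M0); apply: up_avg_span SM.
  apply: span_nil => lam plam; apply: up_avg0 => c.
  case: rho @M @P pos SI SM M0 => [|k rho] M P /= pos SI SM M0.
    by rewrite /prod_incr /diag_psum_prod !big_nil; ring.
  by move: pos M0; rewrite /M /=; case: (k).
exists (fun lam => (up_avg (fun lam c => c ^+ 2 * prod_incr_top 1 rho lam c) lam - M%:R * P lam)
   + up_avg (fun lam c => c ^+ 2 * (prod_incr 1 rho lam c - prod_incr_top 1 rho lam c)) lam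
   + zz_sum * up_avg (fun lam c => c ^+ 1 * prod_incr 1 rho lam c) lam
   + zz_prod * up_avg (fun lam c => c ^+ 0 * prod_incr 1 rho lam c) lam).
  apply: spanD; first apply: spanD; first apply: spanD => //.
  - exact: up_avg_top.
  - by apply: spanZ; apply: up_avg_span1 SI.
  - by apply: spanZ; apply: up_avg_span1 SI.
move=> n lam lamY; have [plam sE] := YnP lamY.
rewrite sum_p_up //.
(* The moments of order 0, 1, 2 are 1, 0, n, so the box weight averages to zz' + n: exactly the
   denominator, and p_rho survives with coefficient 1. *)
have -> : \sum_(i < n.+1) up_weight R n.+1 lam i *
   (box_weight (content R lam i) * diag_psum_prod R rho (incr_nth lam i)) =
  P lam * (zz_prod * up_moment R 0 lam + zz_sum * up_moment R 1 lam + up_moment R 2 lam) +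
  (up_avg (fun lam c => c ^+ 2 * prod_incr_top 1 rho lam c) lam
   + up_avg (fun lam c => c ^+ 2 * (prod_incr 1 rho lam c - prod_incr_top 1 rho lam c)) lam
   + zz_sum * up_avg (fun lam c => c ^+ 1 * prod_incr 1 rho lam c) lam
   + zz_prod * up_avg (fun lam c => c ^+ 0 * prod_incr 1 rho lam c) lam).
  rewrite /up_moment -!(up_weight_moment R _ plam (size_partition plam)) sE.
  rewrite /up_avg sE mulrDr mulrDr !mulr_sumr -!big_split /=.
  apply: eq_bigr => i _; rewrite diag_psum_prod_incr -/P /box_weight.
  by ring.
rewrite up_moment0 up_moment1 up_moment2 sE.
have nz := lt0r_neq0 (zz_den_gt0 n).
by field; rewrite nz.
Qed.

Lemma up_step d H : spanY d H -> exists2 F, spanY d F &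
  forall n lam, lam \in Yn n ->
    \sum_(nu <- Yn n.+1) p_up z z' n lam nu * H nu = H lam + F lam / (zz_prod + n%:R).
Proof.
elim=> {H} [H H0|H c rho H' prho ltd _ [F' sF' EF'] EH].
  exists (fun _ => 0); first exact: span0.
  move=> n lam; rewrite mem_Yn => /andP[plam _].
  rewrite H0 // mul0r addr0 big_seq big1 // => nu.
  by rewrite mem_Yn => /andP[pnu _]; rewrite H0 ?mulr0.
have [F sF EF] := up_step_prod prho.
exists (fun lam => c * ((sumn rho)%:R * diag_psum_prod R rho lam + F lam) + F' lam).
  apply: spanD => //; apply: spanZ; apply: spanD.
    by apply: spanZ; apply: span_gen.
  exact: span_le (ltnW ltd) sF.
move=> n lam lamY; have plam := Yn_partition lamY.
have -> : \sum_(nu <- Yn n.+1) p_up z z' n lam nu * H nu =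
   c * \sum_(nu <- Yn n.+1) p_up z z' n lam nu * diag_psum_prod R rho nu +
   \sum_(nu <- Yn n.+1) p_up z z' n lam nu * H' nu.
  rewrite mulr_sumr -big_split /= big_seq [RHS]big_seq; apply: eq_bigr => nu.
  by rewrite mem_Yn => /andP[pnu _]; rewrite EH //; ring.
by rewrite EF // EF' // EH //; ring.
Qed.

Lemma down_step_prod rho : is_partition rho ->
  exists2 F, spanY (sumn rho) F &
  forall n nu, nu \in Yn n.+1 ->
    \sum_(mu <- Yn n) p_down R nu mu * diag_psum_prod R rho mu =
    diag_psum_prod R rho nu +
    (F nu - (sumn rho)%:R * diag_psum_prod R rho nu) / n.+1%:R.
Proof.
move=> /andP[_ pos]; set M := sumn rho; set P := diag_psum_prod R rho.
have [_ SM] := prod_incr_span (-1 : R) pos (leqSpred M).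
have SU : spanY M (down_avg (fun lam c =>
    prod_incr (-1) rho lam c - prod_incr_top (-1) rho lam c)).
  have [M0|M0] := posnP M; last by rewrite -{1}(prednK M0); apply: down_avg_span SM.
  apply: span_nil => lam plam; apply: down_avg0 => c.
  case: rho @M @P pos SM M0 => [|k rho] M P /= pos SM M0.
    by rewrite /prod_incr /diag_psum_prod !big_nil; ring.
  by move: pos M0; rewrite /M /=; case: (k).
exists (fun lam => (down_avg (prod_incr_top (-1) rho) lam + M%:R * P lam)
   + down_avg (fun lam c => prod_incr (-1) rho lam c - prod_incr_top (-1) rho lam c) lam).
  by apply: spanD => //; apply: down_avg_top.
move=> n nu nuY; have [pnu sE] := YnP nuY.
have sL : (size nu <= n.+1)%N by rewrite -sE size_partition.
rewrite sum_p_down //.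
have -> : \sum_(i < n.+1) down_weight R n.+1 nu i * diag_psum_prod R rho (decr_nth nu i) =
  P nu * (\sum_(i < n.+1) down_weight R n.+1 nu i) +
  (down_avg (prod_incr_top (-1) rho) nu +
   down_avg (fun lam c => prod_incr (-1) rho lam c - prod_incr_top (-1) rho lam c) nu).
  rewrite /down_avg sE mulr_sumr -!big_split /=; apply: eq_bigr => i _.
  have [rm|nrm] := boolP (removable nu i).
    by rewrite diag_psum_prod_decr // -/P; ring.
  by rewrite (down_weight_eq0 R pnu sL (ltn_ord i) nrm); ring.
rewrite (down_weight_sum R pnu sL) sE.
have nz : n.+1%:R != 0 :> R by rewrite pnatr_eq0.
move: (n.+1%:R) nz => a nz.
by field; rewrite nz.
Qed.

(** The down step for the empty product: the remainder lies in the span of degree below 0, hence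
    vanishes. *)
Lemma down_sum1 n nu : nu \in Yn n.+1 -> \sum_(mu <- Yn n) p_down R nu mu = 1.
Proof.
move=> nuY; have [F sF EF] := @down_step_prod [::] isT.
have := EF n nu nuY; rewrite (span_lt0 sF); last by move: nuY; rewrite mem_Yn => /andP[].
rewrite /diag_psum_prod big_nil mul0r subrr mul0r addr0 => <-.
by apply: eq_bigr => mu _; rewrite big_nil mulr1.
Qed.

Lemma up_sum1 n lam : lam \in Yn n -> \sum_(nu <- Yn n.+1) p_up z z' n lam nu = 1.
Proof.
move=> lamY; have [F sF EF] := @up_step_prod [::] isT.
have := EF n lam lamY; rewrite (span_lt0 sF); last by move: lamY; rewrite mem_Yn => /andP[].
rewrite /diag_psum_prod big_nil mul0r addr0 mul0r addr0 => <-.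
by apply: eq_bigr => mu _; rewrite big_nil mulr1.
Qed.

(** The coefficient of p_rho is (1 - M/(n+1)) (1 + M/(zz'+n)) - 1: the terms of order 1/n cancel and
    leave - M (M - 1 + zz') over both denominators. *)
Lemma Tn_prod rho : is_partition rho -> let M := sumn rho in
  exists F1 F2 F3, [/\ spanY M F1, spanY M F2, spanY M F3 &
  forall n lam, lam \in Yn n ->
    Tn z z' n (diag_psum_prod R rho) lam - diag_psum_prod R rho lam =
    - (M%:R * (M%:R - 1 + zz_prod)) / ((zz_prod + n%:R) * n.+1%:R) * diag_psum_prod R rho lam
    + F1 lam / (zz_prod + n%:R) + F2 lam / n.+1%:R
    + F3 lam / ((zz_prod + n%:R) * n.+1%:R)].
Proof.
move=> prho M; have [F sF EF] := up_step_prod prho.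
have [G sG EG] := down_step_prod prho; have [H sH EH] := up_step sG.
exists F, G, (fun lam => H lam - M%:R * F lam); split=> //.
  by apply: spanB => //; apply: spanZ.
move=> n lam lamY; rewrite /Tn.
have -> : \sum_(nu <- Yn n.+1) p_up z z' n lam nu *
   \sum_(lt <- Yn n) p_down R nu lt * diag_psum_prod R rho lt =
  (1 - M%:R / n.+1%:R) * \sum_(nu <- Yn n.+1) p_up z z' n lam nu * diag_psum_prod R rho nu +
  n.+1%:R^-1 * \sum_(nu <- Yn n.+1) p_up z z' n lam nu * G nu.
  rewrite !mulr_sumr -big_split /= big_seq [RHS]big_seq; apply: eq_bigr => nu nuY.
  by rewrite EG // -/M; ring.
rewrite EF // EH // -/M.
have nz : n.+1%:R != 0 :> R by rewrite pnatr_eq0.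
have nz' := lt0r_neq0 (zz_den_gt0 n).
rewrite -natr1 in nz *.
by field; rewrite nz nz'.
Qed.

End Steps.

(** * Frobenius coordinates *)

Section Frobenius.
Implicit Types (lam : seq nat).

(** A predicate closed downwards holds on an initial segment, whose length is the count. The
    diagonal, the conjugate rows and the length of a constructed diagram are all read off this
    way. *)
Lemma ltn_count_iota (P : pred nat) n i :
  (forall j k, (j <= k)%N -> P k -> P j) -> (forall j, (n <= j)%N -> ~~ P j) ->
  (i < count P (iota 0 n))%N = P i.
Proof.
move=> down out.
have H m : (forall j, (j < m)%N -> (j < count P (iota 0 m))%N = P j) /\
           (count P (iota 0 m) <= m)%N.
  elim: m => [|m [IH IHm]]; first by split.
  rewrite -addn1 iotaD count_cat /= add0n addn0; split; last first.
    by case: (P m); rewrite ?addn0 ?addn1 //= leqW.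
  move=> j; rewrite addn1 ltnS => jm; have [Pm|nPm] := boolP (P m).
    have cm : count P (iota 0 m) = m.
      apply/eqP; rewrite -[X in _ == X](size_iota 0) -all_count; apply/allP => k.
      by rewrite mem_iota => /andP[_ km]; apply: down Pm; apply: ltnW.
    by rewrite cm addn1 ltnS jm; apply/esym/(down _ _ jm).
  rewrite addn0; move: jm; rewrite leq_eqVlt => /predU1P[->|/IH //].
  by rewrite (negPf nPm); apply/negbTE; rewrite -leqNgt.
have [lt|ge] := ltnP i n; first by have [-> //] := H n.
rewrite (negPf (out _ ge)); apply/negbTE; rewrite -leqNgt.
by apply: leq_trans ge; case: (H n).
Qed.

Lemma ltn_frob_d lam i : is_partition lam -> (i < frob_d lam)%N = (i < nth 0%N lam i)%N.
Proof.
move=> plam; apply: ltn_count_iota => [j k jk lt|j sj].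
  by apply: leq_ltn_trans jk (leq_trans lt (nth_partition plam jk)).
by rewrite nth_default.
Qed.

Lemma ltn_conj_row lam i j : is_partition lam ->
  (i < conj_row lam j)%N = (j < nth 0%N lam i)%N.
Proof.
move=> plam; have -> : conj_row lam j = count (fun r => j < nth 0%N lam r)%N (iota 0 (size lam)).
  by rewrite -{1}(mkseq_nth 0%N lam) /conj_row /mkseq count_map.
apply: (ltn_count_iota (P := fun r => j < nth 0%N lam r)%N) => [k l kl lt|k sk].
  exact: leq_trans lt (nth_partition plam kl).
by rewrite nth_default.
Qed.

Lemma frob_d_size lam : is_partition lam -> (frob_d lam <= size lam)%N.
Proof.
move=> plam; rewrite leqNgt; apply/negP.
by rewrite ltn_frob_d // nth_default.
Qed.

Lemma conj_row_size lam j : (conj_row lam j <= size lam)%N.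
Proof. exact: count_size. Qed.

Lemma conj_row_gt lam i : is_partition lam -> (i < frob_d lam)%N -> (i < conj_row lam i)%N.
Proof. by move=> plam; rewrite ltn_frob_d // ltn_conj_row. Qed.

Lemma conj_row_le lam i j : is_partition lam -> (i <= j)%N ->
  (conj_row lam j <= conj_row lam i)%N.
Proof.
by move=> plam ij; apply: sub_count => x /=; apply: leq_ltn_trans.
Qed.

(** The numbers b_i - 1/2 of the diagonal boxes and the deficits i - lam_i of the rows below the
    diagonal fill 0, ..., L - 1 exactly once. It suffices that they are distinct, in range and L in
    number; disjointness is the duality between rows and columns. *)
Lemma perm_frobenius lam L : is_partition lam -> (size lam <= L)%N ->
  perm_eq (iota 0 L) ([seq i - nth 0%N lam i | i <- iota (frob_d lam) (L - frob_d lam)] ++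
                     [seq conj_row lam i - i.+1 | i <- iota 0 (frob_d lam)])%N.
Proof.
move=> plam sL; set d := frob_d lam; set s := _ ++ _.
have dL : (d <= L)%N := leq_trans (frob_d_size plam) sL.
have low i : (d <= i)%N -> (nth 0%N lam i <= i)%N.
  by rewrite leqNgt ltn_frob_d // -leqNgt.
have us : uniq s.
  rewrite cat_uniq; apply/and3P; split.
  - rewrite map_inj_in_uniq ?iota_uniq // => i j; rewrite !mem_iota.
    move=> /andP[/low li _] /andP[/low lj _].
    case: (ltngtP i j) => // [ij|ji].
      by have := nth_partition plam (ltnW ij); move: ij li lj; clear; lia.
    by have := nth_partition plam (ltnW ji); move: ji li lj; clear; lia.
  - apply/hasPn => x /mapP[j]; rewrite mem_iota add0n => /andP[_ jd] ->.
    apply/negP => /mapP[k0]; rewrite mem_iota => /andP[/low li _].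
    have := conj_row_gt plam jd; have := ltn_conj_row k0 j plam.
    have [lt /esym|ge /esym/negbT] := ltnP k0 (conj_row lam j); rewrite -?leqNgt.
      by move: lt li; clear; lia.
    by move: ge li; clear; lia.
  rewrite map_inj_in_uniq ?iota_uniq // => i j; rewrite !mem_iota !add0n.
  move=> /andP[_ /(conj_row_gt plam) ci] /andP[_ /(conj_row_gt plam) cj].
  case: (ltngtP i j) => // [ij|ji].
    by have := conj_row_le plam (ltnW ij); move: ij ci cj; clear; lia.
  by have := conj_row_le plam (ltnW ji); move: ji ci cj; clear; lia.
have ss : {subset s <= iota 0 L}.
  move=> x; rewrite mem_cat mem_iota /= add0n => /orP[] /mapP[k0]; rewrite mem_iota.
    by rewrite subnKC // => /andP[_ kL] ->; apply: leq_ltn_trans (leq_subr _ _) kL.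
  move=> /andP[_ kd] ->; have := conj_row_gt plam kd; have := conj_row_size lam k0.
  by move: sL; clear; lia.
have sz : (size (iota 0 L) <= size s)%N.
  by rewrite size_cat !size_map !size_iota subnK.
have [_ E] := uniq_min_size us ss sz.
by apply: uniq_perm; rewrite ?iota_uniq // => x; rewrite E.
Qed.

Variable R : realType.

Definition frob_a lam i : R := (nth 0%N lam i)%:R - i%:R - 2^-1.
Definition frob_b lam i : R := (conj_row lam i)%:R - i%:R - 2^-1.

(** Rows below the diagonal cancel part of the empty-row terms, and by [perm_frobenius] the
    surviving ones are the powers of -b_i. *)
Lemma diag_psum_frobenius k lam : is_partition lam ->
  diag_psum R k lam = \sum_(i < frob_d lam) (frob_a lam i ^+ k - (- frob_b lam i) ^+ k).
Proof.
move=> plam; rewrite /diag_psum sumrB; set d := frob_d lam; set L := size lam.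
have dL : (d <= L)%N := frob_d_size plam.
pose F (j : nat) : R := (- j%:R - 2^-1) ^+ k.
have -> : \sum_(i < L) (- i%:R - 2^-1) ^+ k = \sum_(j <- iota 0 L) F j.
  by rewrite -(big_mkord xpredT F) /index_iota subn0.
rewrite (perm_big _ (perm_frobenius plam (leqnn L))) big_cat /= !big_map.
have -> : \sum_(j <- iota d (L - d)) F (j - nth 0 lam j)%N =
   \sum_(d <= i < L) (content R lam i - 2^-1) ^+ k.
  rewrite big_seq [RHS]big_seq; apply: eq_bigr => i; rewrite mem_iota => /andP[di _].
  have li : (nth 0%N lam i <= i)%N by rewrite leqNgt -ltn_frob_d // -leqNgt.
  by rewrite /F /content natrB // opprB.
rewrite -(big_mkord xpredT (fun i => (content R lam i - 2^-1) ^+ k)).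
rewrite (big_cat_nat _ dL) //= [X in X + _ - _]big_mkord.
have -> : \sum_(j <- iota 0 d) F (conj_row lam j - j.+1)%N =
   \sum_(i < d) (- frob_b lam i) ^+ k.
  rewrite -{1}(subn0 d) -/(index_iota 0 d) big_mkord; apply: eq_bigr => i _.
  rewrite /F /frob_b natrB ?conj_row_gt // -natr1; congr (_ ^+ _).
  by field.
by rewrite sumrB /frob_a /content; ring.
Qed.

Lemma frob_a_gt0 lam i : is_partition lam -> (i < frob_d lam)%N -> 0 < frob_a lam i.
Proof.
move=> plam; rewrite ltn_frob_d // => lt; rewrite /frob_a.
have : i%:R + 1 <= (nth 0%N lam i)%:R :> R by rewrite natr1 ler_nat.
by lra.
Qed.

Lemma frob_b_gt0 lam i : is_partition lam -> (i < frob_d lam)%N -> 0 < frob_b lam i.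
Proof.
move=> plam id; have lt := conj_row_gt plam id; rewrite /frob_b.
have : i%:R + 1 <= (conj_row lam i)%:R :> R by rewrite natr1 ler_nat.
by lra.
Qed.

Lemma frob_a_le lam i : is_partition lam -> frob_a lam i.+1 <= frob_a lam i.
Proof.
move=> plam; rewrite /frob_a -natr1.
have : (nth 0%N lam i.+1)%:R <= (nth 0%N lam i)%:R :> R by rewrite ler_nat nth_partition.
by lra.
Qed.

Lemma frob_b_le lam i : is_partition lam -> frob_b lam i.+1 <= frob_b lam i.
Proof.
move=> plam; rewrite /frob_b -natr1.
have : (conj_row lam i.+1)%:R <= (conj_row lam i)%:R :> R by rewrite ler_nat conj_row_le.
by lra.
Qed.

Lemma sum_frobenius lam : is_partition lam ->
  \sum_(i < frob_d lam) (frob_a lam i + frob_b lam i) = (sumn lam)%:R.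
Proof.
move=> plam; rewrite -diag_psum1 diag_psum_frobenius //.
by apply: eq_bigr => i _; rewrite !expr1 opprK.
Qed.

Lemma iotaY1 n lam i : (iotaY R n lam).1 i = if (i < frob_d lam)%N then frob_a lam i / n%:R else 0.
Proof. by []. Qed.

Lemma iotaY2 n lam i : (iotaY R n lam).2 i = if (i < frob_d lam)%N then frob_b lam i / n%:R else 0.
Proof. by []. Qed.

Lemma iotaY_Omega n lam : lam \in Yn n -> Omega R (iotaY R n lam).
Proof.
move=> /YnP[plam sE]; split; [|split].
- move=> i; rewrite iotaY1 iotaY2; case: ifP => // id.
  by split; rewrite divr_ge0 // ltW ?frob_a_gt0 ?frob_b_gt0.
- move=> i; rewrite !iotaY1 !iotaY2; case: (ltnP i.+1) => [id|_].
    by rewrite (ltnW id) !ler_wpM2r ?invr_ge0 ?frob_a_le ?frob_b_le.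
  by case: ifP => // id; split; rewrite divr_ge0 // ltW ?frob_a_gt0 ?frob_b_gt0.
move=> k; apply: (@le_trans _ _ (\sum_(i < frob_d lam) (frob_a lam i + frob_b lam i) / n%:R)).
  set d := frob_d lam.
  have pos i : 0 <= (iotaY R n lam).1 i + (iotaY R n lam).2 i.
    rewrite iotaY1 iotaY2; case: ifP => [id|_]; last by rewrite addr0.
    by rewrite addr_ge0 // divr_ge0 // ltW ?frob_a_gt0 ?frob_b_gt0.
  apply: (@le_trans _ _ (\sum_(i < maxn k d) ((iotaY R n lam).1 i + (iotaY R n lam).2 i))).
    rewrite (big_ord_widen _ (fun i => (iotaY R n lam).1 i + (iotaY R n lam).2 i) (leq_maxl k d)).
    rewrite [leRHS](bigID (fun i : 'I_(maxn k d) => (i < k)%N)) /= lerDl.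
    by apply: sumr_ge0 => i _; apply: pos.
  rewrite [leRHS](big_ord_widen _ (fun i => (frob_a lam i + frob_b lam i) / n%:R) (leq_maxr k d)).
  rewrite [leRHS]big_mkcond; apply: ler_sum => i _.
  by rewrite iotaY1 iotaY2 -/d; case: (i < d)%N; rewrite ?addr0 -?mulrDl.
rewrite -mulr_suml sum_frobenius // sE.
have [->|n0] := eqVneq (n%:R : R) 0; first by rewrite mul0r.
by rewrite mulfV.
Qed.

Lemma limn_sum_fin (u : nat -> R) d : (forall i, (d <= i)%N -> u i = 0) ->
  limn (fun N => \sum_(i < N) u i) = \sum_(i < d) u i.
Proof.
move=> u0; apply: (@lim_near_cst _ _ _ _ _ (\sum_(i < d) u i)) => //.
exists d => // N /= dN; rewrite -!(big_mkord xpredT u) (big_cat_nat _ dN) //=.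
rewrite [X in _ + X]big_nat [X in _ + X]big1 ?addr0 // => i /andP[di _].
exact: u0.
Qed.

(** The convention p_1 = 1 fits because the a_i and b_i of a diagram add up to n. *)
Lemma pO_iotaY n k lam : (0 < k)%N -> (0 < n)%N -> lam \in Yn n ->
  pO k (iotaY R n lam) = diag_psum R k lam / n%:R ^+ k.
Proof.
move=> k0 n0; move=> /YnP[plam sE]; rewrite /pO; case: eqP => [->|k1].
  by rewrite diag_psum1 sE expr1 mulfV // pnatr_eq0 -lt0n.
have z1 i : (frob_d lam <= i)%N -> ((iotaY R n lam).1 i) ^+ k = 0.
  by rewrite iotaY1 leqNgt => /negPf ->; rewrite expr0n gtn_eqF.
have z2 i : (frob_d lam <= i)%N -> ((iotaY R n lam).2 i) ^+ k = 0.
  by rewrite iotaY2 leqNgt => /negPf ->; rewrite expr0n gtn_eqF.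
rewrite (limn_sum_fin z1) (limn_sum_fin z2) diag_psum_frobenius //.
rewrite mulr_suml mulr_sumr -big_split; apply: eq_bigr => i _ /=.
have E : (-1) ^+ k = - (-1) ^+ k.-1 :> R by rewrite -{1}(prednK k0) exprS mulN1r.
rewrite ltn_ord !expr_div_n -/(frob_a lam i) -/(frob_b lam i) (exprNn (frob_b lam i)) E.
by ring.
Qed.

Lemma pOrho_iotaY n rho lam : is_partition rho -> (0 < n)%N -> lam \in Yn n ->
  pOrho rho (iotaY R n lam) = diag_psum_prod R rho lam / n%:R ^+ sumn rho.
Proof.
move=> /andP[_ pos] n0 lamY; rewrite /pOrho /diag_psum_prod.
elim: rho pos => [|k rho IH] /=; first by rewrite !big_nil expr0 divr1.
case/andP=> k0 pos; rewrite !big_cons IH // pO_iotaY // exprD invfM.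
by ring.
Qed.

End Frobenius.

(** * Compactness of the Thoma simplex *)

Section OmegaCompact.
Variable R : realType.

Definition nearO (k : nat) (d : R) (w w' : Th R) : Prop :=
  forall i, (i < k)%N -> `|w.1 i - w'.1 i| < d /\ `|w.2 i - w'.2 i| < d.

Lemma closed_Omega (T : topologicalType) (a b : nat -> T -> R) :
  (forall i, continuous (a i)) -> (forall i, continuous (b i)) ->
  closed [set x | Omega R (fun i => a i x, fun i => b i x)].
Proof.
move=> ca cb.
have cl (f : T -> R) : continuous f -> closed [set x | 0 <= f x].
  move=> cf; apply: (@preimage_closed _ _ f [set y | 0 <= y]); last exact: closed_ge.
  by move=> x _; apply: cf.
have cS k : continuous (fun x : T => \sum_(j < k) (a j x + b j x)).
  elim: k => [|k IH].
    have -> : (fun x : T => \sum_(j < 0) (a j x + b j x)) = (fun _ => 0).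
      by apply/funext => x; rewrite big_ord0.
    by move=> x; exact: cvg_cst.
  have -> : (fun x : T => \sum_(j < k.+1) (a j x + b j x)) =
     (fun x : T => \sum_(j < k) (a j x + b j x) + (a k x + b k x)).
    by apply/funext => x; rewrite big_ord_recr.
  by move=> x; exact: (cvgD (IH x) (cvgD (ca k x) (cb k x))).
have -> : [set x : T | Omega R (fun i => a i x, fun i => b i x)] =
   \bigcap_(i in setT) [set x : T | 0 <= a i x] `&`
   \bigcap_(i in setT) [set x : T | 0 <= b i x] `&`
   \bigcap_(i in setT) [set x : T | 0 <= a i x - a i.+1 x] `&`
   \bigcap_(i in setT) [set x : T | 0 <= b i x - b i.+1 x] `&`
   \bigcap_(k in setT) [set x : T | 0 <= 1 - \sum_(i < k) (a i x + b i x)].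
  apply/seteqP; split=> x.
    move=> [pos [dec sum1]]; split; first split; first split; first split.
    - by move=> i _; have [] := pos i.
    - by move=> i _; have [] := pos i.
    - by move=> i _ /=; rewrite subr_ge0; have [] := dec i.
    - by move=> i _ /=; rewrite subr_ge0; have [] := dec i.
    - by move=> k _ /=; rewrite subr_ge0; apply: sum1.
  move=> [[[[p1 p2] d1] d2] s]; split; [|split].
  - by move=> i; split; [apply: p1 | apply: p2].
  - move=> i; split; rewrite -subr_ge0; [exact: d1 | exact: d2].
  - by move=> k; rewrite -subr_ge0; apply: s.
repeat apply: closedI; apply: closed_bigI => i _; apply: cl.
- exact: ca.
- exact: cb.
- by move=> x; exact: (cvgB (ca i x) (ca i.+1 x)).
- by move=> x; exact: (cvgB (cb i x) (cb i.+1 x)).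
by move=> x; apply: cvgB; [exact: cvg_cst | exact: (cS i x)].
Qed.

Lemma nbhs_nearO (T : topologicalType) (a b : nat -> T -> R) k d (x : T) :
  (forall i, continuous (a i)) -> (forall i, continuous (b i)) -> 0 < d ->
  nbhs x [set y | nearO k d (fun i => a i x, fun i => b i x)
                            (fun i => a i y, fun i => b i y)].
Proof.
move=> ca cb d0; elim: k => [|k IHk]; first by apply: filterE => y i.
have Na : nbhs x [set y | `|a k x - a k y| < d].
  by have /cvgrPdist_lt := ca k x; apply.
have Nb : nbhs x [set y | `|b k x - b k y| < d].
  by have /cvgrPdist_lt := cb k x; apply.
apply: filterS (filterI (filterI Na Nb) IHk) => y [[na nb] IH] i.
by rewrite ltnS leq_eqVlt => /predU1P[->|/IH].
Qed.

(** One product over [bool * nat] holds both sequences, so a single use of Tychonoff's theorem gives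
    compactness; [Omega_ind] carries it over to [Th R]. *)
Local Notation coords := (prod_topology (fun _ : bool * nat => R : topologicalType)).

Definition th_of (x : coords) : Th R := (fun i => x (true, i), fun i => x (false, i)).

Lemma coord_continuous (j : bool * nat) : continuous (fun x : coords => x j : R).
Proof. exact: (@proj_continuous _ (fun _ : bool * nat => R : topologicalType) j). Qed.

Lemma th_of_Omega_compact : compact [set x : coords | Omega R (th_of x)].
Proof.
have box : compact [set x : coords | forall j, `[0, 1]%classic (x j)].
  have := @tychonoff _ (fun _ : bool * nat => R : topologicalType)
    (fun _ => [set` `[(0 : R), 1]]) (fun _ => @segment_compact R 0 1).
  by [].
apply: (subclosed_compact _ box); last first.
  move=> x [pos [_ sum1]] [b i] /=; rewrite in_itv /=.
  have H : \sum_(j < i.+1) (x (true, j : nat) + x (false, j : nat)) <= 1 by apply: sum1.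
  have P j : 0 <= x (true, j) + x (false, j) by have [? ?] := pos j; rewrite addr_ge0.
  have {}H : x (true, i) + x (false, i) <= 1.
    apply: le_trans H; rewrite big_ord_recr /= lerDr.
    by apply: sumr_ge0 => j _; apply: P.
  by have [/= ? ?] := pos i; case: b; apply/andP; split=> //; lra.
apply: (closed_Omega (a := fun i (x : coords) => x (true, i)) (b := fun i (x : coords) => x (false, i))).
  by move=> i; apply: coord_continuous.
by move=> i; apply: coord_continuous.
Qed.

(* Compactness of Omega, in the form of an induction principle. *)
Lemma Omega_ind (Q : set (Th R) -> Prop) :
  Q set0 -> (forall A B, Q A -> Q B -> Q (A `|` B)) ->
  (forall A B, A `<=` B -> Q B -> Q A) ->
  (forall w, Omega R w -> exists k, exists2 d : R, 0 < d &
     Q [set w' | Omega R w' /\ nearO k d w w']) ->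
  Q (Omega R).
Proof.
move=> Q0 QU Qsub Qloc.
(* F expresses that U is a large enough member of the ideal Q. Compactness as near covering then
   yields one member of Q that contains Omega. *)
pose F : set_system (set (Th R)) := filter_from Q (fun U0 => [set U | Q U /\ U0 `<=` U]).
have FF : Filter F.
  apply: filter_from_filter; first by exists set0.
  move=> A B QA QB; exists (A `|` B); first exact: QU.
  by move=> U [QUU sub]; split; split=> // x Hx; apply: sub; [left|right].
have ncw : near_covering_within [set x : coords | Omega R (th_of x)].
  exact/near_covering_withinP/compact_near_coveringP/th_of_Omega_compact.
have G (x : coords) : Omega R (th_of x) -> \forall x' \near x & U \near F,
    Omega R (th_of x') -> U (th_of x').
  move=> /Qloc [k [d d0 Qn]].
  exists ([set x' | nearO k d (th_of x) (th_of x')],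
          [set U | Q U /\ [set w' | Omega R w' /\ nearO k d (th_of x) w'] `<=` U]).
    split; last by exists [set w' | Omega R w' /\ nearO k d (th_of x) w'].
    apply: (nbhs_nearO (a := fun i (x : coords) => x (true, i))
                       (b := fun i (x : coords) => x (false, i))) => // i.
      exact: coord_continuous.
    exact: coord_continuous.
  by move=> [x' U] /= [nx [QU' sub]] Ox'; apply: sub; split.
have [U0 QU0 /(_ U0) H] := ncw _ F (fun U x => U (th_of x)) FF G.
apply: (Qsub _ _ _ QU0) => -[a b] Oab.
by have := H (conj QU0 (@subset_refl _ U0)) (fun j => if j.1 then a j.2 else b j.2) Oab.
Qed.

End OmegaCompact.

(** * Continuous functions on the Thoma simplex *)

Section ContinuousFunctions.
Variable R : realType.
Implicit Types (f g h : Th R -> R) (w : Th R).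

Lemma cvgn_leP (u : nat -> R) (l : R) : u @ \oo --> l <->
  (forall e, 0 < e -> exists N, forall n, (N <= n)%N -> `|u n - l| <= e).
Proof.
split=> [/cvgrPdist_le H e e0|H].
  have [N _ HN] := H e e0; exists N => n Nn; rewrite distrC; exact: HN.
apply/cvgrPdist_le => e e0; have [N HN] := H e e0.
by exists N => // n /= Nn; rewrite distrC; apply: HN.
Qed.

Lemma lin_eps (a b x y e : R) : 0 < e -> `|x| <= e / (`|a| + `|b| + 1) ->
  `|y| <= e / (`|a| + `|b| + 1) -> `|a * x + b * y| <= e.
Proof.
move=> e0 hx hy; set C := _ + 1 in hx hy.
have C0 : 0 < C by rewrite ltr_wpDl // addr_ge0.
apply: le_trans (ler_normD _ _) _; rewrite !normrM.
have : `|a| * `|x| <= `|a| * (e / C) by rewrite ler_wpM2l.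
have : `|b| * `|y| <= `|b| * (e / C) by rewrite ler_wpM2l.
have : C * (e / C) = e by rewrite mulrC divfK // gt_eqF.
have : 0 < e / C by rewrite divr_gt0.
by rewrite {2}/C !mulrDl mul1r; clear; lra.
Qed.

Lemma lin_eps_gt0 (a b e : R) : 0 < e -> 0 < e / (`|a| + `|b| + 1).
Proof. by move=> e0; rewrite divr_gt0 // ltr_wpDl // addr_ge0. Qed.

Lemma Omega_ge0 w : Omega R w -> forall i, 0 <= w.1 i /\ 0 <= w.2 i.
Proof. by case. Qed.

Lemma Omega_zero : Omega R (fun _ => 0, fun _ => 0).
Proof. by split; [|split] => //= k; rewrite big1 // => i _; rewrite addr0. Qed.

(** Conjugation of diagrams in the limit; results are proved for alpha and carried over to beta. *)
Definition swapO w : Th R := (w.2, w.1).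

Lemma Omega_swap w : Omega R w -> Omega R (swapO w).
Proof.
move=> [pos [dec s]]; split; [|split].
- by move=> i; have [] := pos i.
- by move=> i; have [] := dec i.
by move=> k; under eq_bigr do rewrite addrC.
Qed.

Lemma Omega_sum1 w k : Omega R w -> \sum_(i < k) w.1 i <= 1.
Proof.
move=> [pos [_ s]]; apply: le_trans (s k); apply: ler_sum => i _.
by rewrite lerDl; have [] := pos i.
Qed.

Lemma Omega_dec w i j : Omega R w -> (i <= j)%N -> w.1 j <= w.1 i.
Proof.
move=> [_ [dec _]]; elim: j => [|j IHj]; first by rewrite leqn0 => /eqP ->.
rewrite leq_eqVlt => /predU1P[->//|/ltnSE /IHj]; apply: le_trans.
by have [] := dec j.
Qed.

Lemma Omega_coord_le w i : Omega R w -> i.+1%:R * w.1 i <= 1.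
Proof.
move=> Ow; apply: le_trans (Omega_sum1 i.+1 Ow).
rewrite mulr_natl -[X in _ *+ X](card_ord i.+1) -sumr_const.
by apply: ler_sum => j _; apply: Omega_dec => //; rewrite -ltnS.
Qed.

Lemma Omega_le1 w i : Omega R w -> w.1 i <= 1.
Proof.
move=> Ow; apply: le_trans (Omega_coord_le i Ow).
have [w0 _] := Omega_ge0 Ow i.
by rewrite ler_peMl // ler1n.
Qed.

Definition coord_psum k (a : nat -> R) : R := limn (fun N => \sum_(i < N) a i ^+ k).

Lemma pOE k w : (1 < k)%N ->
  pO k w = coord_psum k w.1 + (-1) ^+ k.-1 * coord_psum k w.2.
Proof. by move=> k1; rewrite /pO gtn_eqF. Qed.

(** For i >= N and k >= 2, w_i^k <= w_N w_i, and w_N <= 1/(N+1) by monotonicity. The bound is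
    uniform over Omega, which makes p_k continuous. *)
Lemma psum_le w k N M : Omega R w -> (1 < k)%N -> (N <= M)%N ->
  0 <= \sum_(i < M) w.1 i ^+ k - \sum_(i < N) w.1 i ^+ k <= N.+1%:R^-1.
Proof.
move=> Ow k1 NM.
have wpos i : 0 <= w.1 i by have [] := Omega_ge0 Ow i.
rewrite -!(big_mkord xpredT (fun i => w.1 i ^+ k)) (big_cat_nat _ NM) //= [X in X - _]addrC addrK.
apply/andP; split; first by apply: sumr_ge0 => i _; apply: exprn_ge0.
apply: (@le_trans _ _ (\sum_(N <= i < M) w.1 N * w.1 i)).
  rewrite big_nat [leRHS]big_nat; apply: ler_sum => i /andP[Ni _].
  rewrite -(prednK (ltnW k1)) exprSr ler_wpM2r //.
  apply: le_trans (Omega_dec Ow Ni); rewrite -(prednK (_ : 0 < k.-1)%N); last first.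
    by case: (k) k1 => [|[]].
  by rewrite exprS ler_piMr // exprn_ile1 // Omega_le1.
rewrite -mulr_sumr; apply: (@le_trans _ _ (w.1 N * 1)).
  rewrite ler_wpM2l //; apply: le_trans (Omega_sum1 M Ow).
  rewrite -(big_mkord xpredT (fun i => w.1 i)) [leRHS](big_cat_nat _ NM) //= lerDr.
  by apply: sumr_ge0 => i _.
rewrite mulr1 -[leRHS]mul1r ler_pdivlMr ?ltr0n // mulrC.
exact: Omega_coord_le.
Qed.

Lemma coord_psum_cvg w k : Omega R w -> (1 < k)%N ->
  (fun N => \sum_(i < N) w.1 i ^+ k) @ \oo --> coord_psum k w.1.
Proof.
move=> Ow k1; apply: nondecreasing_is_cvgn.
  by move=> N M NM; have /andP[+ _] := psum_le Ow k1 NM; rewrite subr_ge0.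
exists 1 => _ [N _ <-]; have /andP[_] := psum_le Ow k1 (leq0n N).
by rewrite big_ord0 subr0 invr1.
Qed.

Lemma coord_psum_tail w k N : Omega R w -> (1 < k)%N ->
  `|coord_psum k w.1 - \sum_(i < N) w.1 i ^+ k| <= N.+1%:R^-1.
Proof.
move=> Ow k1; have C := coord_psum_cvg Ow k1.
have C1 : (fun M => `|\sum_(i < M) w.1 i ^+ k - \sum_(i < N) w.1 i ^+ k|) @ \oo -->
    `|coord_psum k w.1 - \sum_(i < N) w.1 i ^+ k|.
  by apply: cvg_norm; apply: cvgB => //; apply: cvg_cst.
rewrite -(cvg_lim (@Rhausdorff R) C1); apply: limr_le.
  by apply/cvg_ex; exists `|coord_psum k w.1 - \sum_(i < N) w.1 i ^+ k|.
exists N => // M /= NM; have /andP[? ?] := psum_le Ow k1 NM.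
by rewrite ger0_norm.
Qed.

Lemma eq_contO f g : (forall w, Omega R w -> f w = g w) -> contO f -> contO g.
Proof.
move=> E cf w Ow e e0; have [k [d d0 H]] := cf w Ow e e0.
by exists k, d => // w' Ow' n; rewrite -!E //; apply: H.
Qed.

Lemma nearO_le k k' d d' w w' : (k <= k')%N -> d' <= d ->
  nearO k' d' w w' -> nearO k d w w'.
Proof.
move=> kk' dd' H i ik; have [] := H i (leq_trans ik kk') => h1 h2.
by split; apply: lt_le_trans dd'.
Qed.

Lemma contO_cst (c : R) : contO (fun _ : Th R => c).
Proof. by move=> w Ow e e0; exists 0%N, 1 => // w' _ _; rewrite subrr normr0. Qed.

Lemma contO2 f g w e1 e2 : contO f -> contO g -> Omega R w -> 0 < e1 -> 0 < e2 ->
  exists k, exists2 d : R, 0 < d & forall w', Omega R w' -> nearO k d w w' ->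
    `|f w - f w'| < e1 /\ `|g w - g w'| < e2.
Proof.
move=> cf cg Ow e10 e20; have [k1 [d1 d10 H1]] := cf w Ow _ e10.
have [k2 [d2 d20 H2]] := cg w Ow _ e20.
exists (maxn k1 k2), (Num.min d1 d2); first by rewrite lt_min d10.
move=> w' Ow' n; split.
  by apply: H1 => //; apply: nearO_le n; rewrite ?leq_maxl // ge_min lexx.
by apply: H2 => //; apply: nearO_le n; rewrite ?leq_maxr // ge_min lexx orbT.
Qed.

Lemma contOD f g : contO f -> contO g -> contO (fun w => f w + g w).
Proof.
move=> cf cg w Ow e e0; have e20 : 0 < e / 2 by rewrite divr_gt0.
have [k [d d0 H]] := contO2 cf cg Ow e20 e20.
exists k, d => // w' Ow' n; have [h1 h2] := H w' Ow' n.
have -> : f w + g w - (f w' + g w') = (f w - f w') + (g w - g w') by ring.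
by apply: le_lt_trans (ler_normD _ _) _; rewrite (splitr e) ltrD.
Qed.

Lemma contOM f g : contO f -> contO g -> contO (fun w => f w * g w).
Proof.
move=> cf cg w Ow e e0.
pose C := `|f w| + `|g w| + 1.
have C0 : 0 < C by rewrite ltr_wpDl // addr_ge0.
pose e1 := Num.min 1 (e / (2 * C)).
have e10 : 0 < e1 by rewrite lt_min ltr01 divr_gt0 // mulr_gt0.
have [k [d d0 H]] := contO2 cf cg Ow e10 e10.
exists k, d => // w' Ow' n; have [h1 h2] := H w' Ow' n.
have -> : f w * g w - f w' * g w' = f w * (g w - g w') + (f w - f w') * g w' by ring.
have gw' : `|g w'| <= C.
  have : `|g w'| <= `|g w| + `|g w - g w'|.
    by rewrite -[X in `|X|](subKr (g w)) (le_trans (ler_normB _ _)).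
  have : `|g w - g w'| <= 1 by rewrite ltW // (lt_le_trans h2) // ge_min lexx.
  by rewrite /C; have := normr_ge0 (f w); lra.
have e1C : e1 * C <= e / 2.
  have : e1 <= e / (2 * C) by rewrite ge_min lexx orbT.
  rewrite -(ler_pM2r C0) => /le_trans; apply.
  by rewrite invfM mulrA divfK // gt_eqF.
apply: le_lt_trans (ler_normD _ _) _; rewrite !normrM (splitr e).
have fC : `|f w| < C by rewrite /C; have := normr_ge0 (g w); lra.
apply: ler_ltD.
  apply: le_trans e1C; rewrite mulrC; apply: ler_pM => //; exact: ltW.
apply: lt_le_trans e1C; have [g0|g0] := eqVneq `|g w'| 0.
  by rewrite g0 mulr0 mulr_gt0.
apply: (@lt_le_trans _ _ (e1 * `|g w'|)); first by rewrite ltr_pM2r // lt_neqAle eq_sym g0 /=.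
by rewrite ler_wpM2l // ltW.
Qed.

Lemma contOZ c f : contO f -> contO (fun w => c * f w).
Proof. by apply: contOM; apply: contO_cst. Qed.

Lemma contOB f g : contO f -> contO g -> contO (fun w => f w - g w).
Proof.
move=> cf /(contOZ (-1)) cg; apply: eq_contO (contOD cf cg) => w _.
by rewrite mulN1r.
Qed.

Lemma contO_sum (I : Type) (r : seq I) (P : pred I) (F : I -> Th R -> R) :
  (forall i, P i -> contO (F i)) -> contO (fun w => \sum_(i <- r | P i) F i w).
Proof.
move=> H; elim: r => [|i r IH].
  by apply: eq_contO (contO_cst 0) => w _; rewrite big_nil.
have [Pi|nPi] := boolP (P i); last first.
  by apply: eq_contO IH => w _; rewrite big_cons (negPf nPi).
by apply: (eq_contO _ (contOD (H i Pi) IH)) => w _; rewrite big_cons Pi.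
Qed.

Lemma contO_exp f k : contO f -> contO (fun w => f w ^+ k).
Proof.
move=> cf; elim: k => [|k IH].
  by apply: eq_contO (contO_cst 1) => w _; rewrite expr0.
by apply: eq_contO (contOM cf IH) => w _; rewrite exprS.
Qed.

Lemma contO_coord1 i : contO (fun w => w.1 i).
Proof. by move=> w Ow e e0; exists i.+1, e => // w' _ /(_ i (ltnSn i)) []. Qed.

Lemma contO_swap f : contO f -> contO (fun w => f (swapO w)).
Proof.
move=> cf w Ow e e0; have [k [d d0 H]] := cf _ (Omega_swap Ow) e e0.
exists k, d => // w' Ow' n; apply: H; first exact: Omega_swap.
by move=> i /n [].
Qed.

Lemma contO_unif f : (forall e, 0 < e -> exists2 g, contO g &
   forall w, Omega R w -> `|f w - g w| <= e) -> contO f.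
Proof.
move=> H w Ow e e0; have e30 : 0 < e / 3 by rewrite divr_gt0.
have [g cg Hg] := H _ e30; have [k [d d0 Hd]] := cg w Ow _ e30.
exists k, d => // w' Ow' n.
have h1 := Hg w Ow; have h2 := Hg w' Ow'; have h3 := Hd w' Ow' n.
have -> : f w - f w' = (f w - g w) + (g w - g w') + (g w' - f w') by ring.
apply: le_lt_trans (ler_normD _ _) _.
have := ler_normD (f w - g w) (g w - g w').
by rewrite (distrC (g w')); lra.
Qed.

Lemma inv_small (e : R) : 0 < e -> exists N, forall n, (N <= n)%N -> n.+1%:R^-1 <= e.
Proof.
move=> e0; have [N HN] := (cvgn_leP _ 0).1 (@cvg_harmonic R) e e0.
by exists N => n /HN; rewrite subr0; apply: le_trans; apply: ler_norm.
Qed.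

Lemma contO_coord_psum k : (1 < k)%N -> contO (fun w => coord_psum k w.1).
Proof.
move=> k1; apply: contO_unif => e e0; have [N HN] := inv_small e0.
exists (fun w => \sum_(i < N) w.1 i ^+ k).
  by apply: contO_sum => i _; apply: contO_exp; apply: contO_coord1.
by move=> w Ow; apply: le_trans (HN N (leqnn N)); apply: coord_psum_tail.
Qed.

Lemma contO_pO k : (0 < k)%N -> contO (@pO R k).
Proof.
case: k => [|[|k]] // _; first by apply: eq_contO (contO_cst 1).
apply: (@eq_contO (fun w => coord_psum k.+2 w.1 + (-1) ^+ k.+1 * coord_psum k.+2 (swapO w).1)).
  by move=> w _; rewrite pOE.
apply: contOD; first exact: contO_coord_psum.
by apply: contOZ; apply: (contO_swap (contO_coord_psum _)).
Qed.

Lemma contO_pOrho rho : is_partition rho -> contO (@pOrho R rho).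
Proof.
case/andP=> _; elim: rho => [|k rho IH] /=.
  by move=> _; apply: eq_contO (contO_cst 1) => w _; rewrite /pOrho big_nil.
case/andP=> k0 /IH c; apply: eq_contO (contOM (contO_pO k0) c) => w _.
by rewrite /pOrho big_cons.
Qed.

Notation spanO := (span (Omega R) (@pOrho R)).

Lemma contO_span d f : spanO d f -> contO f.
Proof.
elim=> {f} [f H|f c rho h prho _ _ IH H].
  by apply: eq_contO (contO_cst 0) => w /H ->.
apply: eq_contO (contOD (contOZ c (contO_pOrho prho)) IH) => w Ow.
by rewrite H.
Qed.

Lemma pOrhoM rho sigma : is_partition rho -> is_partition sigma ->
  exists tau, [/\ is_partition tau, sumn tau = (sumn rho + sumn sigma)%N &
    forall w, Omega R w -> pOrho tau w = pOrho rho w * pOrho sigma w].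
Proof.
move=> prho psig; exists (sort geq (rho ++ sigma)).
split; rewrite ?partition_cat ?sumn_sort ?sumn_cat // => w _.
rewrite /pOrho -big_cat; apply: perm_big; rewrite perm_sort; exact: perm_refl.
Qed.

Lemma LamO_leP m f : LamO_le m f <-> spanO m.+1 f.
Proof.
split=> [[c Hc]|].
  have S : spanO m.+1 (fun w => \sum_(k < m.+1) \sum_(rho <- Yn k | rho \in Yn k) c rho * pOrho rho w).
    apply: span_sum => k _; apply: span_sum => rho; move=> /YnP[prho sE].
    by apply: spanZ; apply: span_gen => //; rewrite sE.
  apply: eq_span S => w Ow; rewrite Hc //; apply: eq_bigr => k _.
  by rewrite -big_seq.
elim=> {f} [f H|f c rho h prho ltm _ [b Hb] H].
  exists (fun _ => 0) => w Ow; rewrite H // big1 // => k _.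
  by rewrite big1 // => rho _; rewrite mul0r.
exists (fun sigma => (sigma == rho)%:R * c + b sigma) => w Ow.
rewrite H // Hb //.
under [RHS]eq_bigr do under eq_bigr do rewrite mulrDl.
under [RHS]eq_bigr do rewrite big_split.
rewrite big_split /=; congr (_ + _).
have rhoY : rho \in Yn (sumn rho) by rewrite mem_Yn prho eqxx.
rewrite (bigD1 (Ordinal ltm)) //= [X in _ = _ + X]big1 ?addr0; last first.
  move=> k; rewrite -val_eqE /= => ne; rewrite big_seq big1 // => sigma.
  move=> /YnP[_ sE]; case: eqP => [E|]; last by rewrite !mul0r.
  by move: ne; rewrite -sE E eqxx.
rewrite (bigD1_seq rho) ?uniq_Yn //= eqxx mul1r big1 ?addr0 // => sigma /negPf ->.
by rewrite !mul0r.
Qed.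

Lemma LamOP f : LamO f <-> exists d, spanO d f.
Proof.
split=> [[m /LamO_leP S]|[d S]]; first by exists m.+1.
by exists d; apply/LamO_leP; apply: span_le S.
Qed.

Lemma contO_LamO f : LamO f -> contO f.
Proof. by move=> /LamOP[d /contO_span]. Qed.

Lemma LamOM f g : LamO f -> LamO g -> LamO (fun w => f w * g w).
Proof.
move=> /LamOP[d sf] /LamOP[e sg]; apply/LamOP; exists (d + e)%N.
exact: (spanM pOrhoM (leqnSn _) sf sg).
Qed.

Lemma LamOD f g : LamO f -> LamO g -> LamO (fun w => f w + g w).
Proof.
move=> /LamOP[d sf] /LamOP[e sg]; apply/LamOP; exists (maxn d e).
by apply: spanD; [apply: span_le sf; apply: leq_maxl | apply: span_le sg; apply: leq_maxr].
Qed.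

Lemma LamOZ c f : LamO f -> LamO (fun w => c * f w).
Proof. by move=> /LamOP[d sf]; apply/LamOP; exists d; apply: spanZ. Qed.

Lemma LamO_cst c : LamO (fun _ : Th R => c).
Proof.
apply/LamOP; exists 1%N; apply: (span_cons c [::] (fun _ => 0)) => //; first exact: span0.
by move=> w _; rewrite /pOrho big_nil mulr1 addr0.
Qed.

Lemma LamO_pO k : (0 < k)%N -> LamO (@pO R k).
Proof.
move=> k0; apply/LamOP; exists k.+1.
have := @span_gen R _ (Omega R) (@pOrho R) k.+1 [:: k].
rewrite /is_partition /= k0 addn0 => /(_ isT (ltnSn _)).
by apply: eq_span => w _; rewrite /pOrho big_seq1.
Qed.

Lemma eq_LamO f g : (forall w, Omega R w -> f w = g w) -> LamO f -> LamO g.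
Proof. by move=> E /LamOP[d sf]; apply/LamOP; exists d; apply: eq_span sf. Qed.

Lemma contO_bounded f : contO f -> exists2 C, 0 < C & forall w, Omega R w -> `|f w| <= C.
Proof.
move=> cf.
(* The hypothesis is doubled so that its first copy can be generalised to the set A of
   [Omega_ind]. *)
suff [C HC] : exists C, forall w, Omega R w -> Omega R w -> `|f w| <= C.
  exists (`|C| + 1); first by rewrite ltr_wpDl.
  by move=> w Ow; apply: le_trans (HC w Ow Ow) _; rewrite ler_wpDr // ler_norm.
apply: (Omega_ind (Q := fun A => exists C, forall w, A w -> Omega R w -> `|f w| <= C)).
- by exists 0.
- move=> A B [C1 H1] [C2 H2]; exists (Num.max C1 C2) => w [Aw|Bw] Ow.
    by rewrite le_max H1.
  by rewrite le_max H2 // orbT.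
- by move=> A B AB [C HC]; exists C => w /AB; apply: HC.
move=> w Ow; have [k [d d0 H]] := cf w Ow 1 ltr01.
exists k, d => //; exists (`|f w| + 1) => w' [Ow' n] _.
have -> : f w' = f w - (f w - f w') by ring.
by apply: le_trans (ler_normB _ _) _; rewrite lerD2l ltW // H.
Qed.

Lemma nrmO_ub f w : contO f -> Omega R w -> `|f w| <= nrmO f.
Proof.
move=> /contO_bounded[C _ HC] Ow; apply: ub_le_sup; last by exists w.
by exists C => _ [w' Ow' <-]; apply: HC.
Qed.

Lemma nrmO_le f C : (forall w, Omega R w -> `|f w| <= C) -> nrmO f <= C.
Proof.
move=> H; apply: ge_sup; first by exists `|f (fun _ => 0, fun _ => 0)|, (fun _ => 0, fun _ => 0) => //; exact: Omega_zero.
by move=> _ [w Ow <-]; apply: H.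
Qed.

Lemma nrmO_ge0 f : 0 <= nrmO f.
Proof.
rewrite /nrmO; have [B|nB] := pselect (has_ubound [set `|f w| | w in Omega R]).
  apply: le_trans (ub_le_sup B _); last by exists (fun _ => 0, fun _ => 0); first exact: Omega_zero.
  exact: normr_ge0.
(* Without an upper bound [sup] takes the default value 0. *)
by rewrite sup_out // => -[].
Qed.

End ContinuousFunctions.

(** * Separation of points and density *)

Section StoneWeierstrass.
Variable R : realType.
Implicit Types (f g h : Th R -> R) (w x y : Th R).

Lemma psum_horner_cvg w (p : {poly R}) : Omega R w ->
  (fun N => \sum_(i < N) w.1 i ^+ 2 * p.[w.1 i]) @ \oo -->
  \sum_(j < size p) p`_j * coord_psum j.+2 w.1.
Proof.
move=> Ow.
have -> : (fun N => \sum_(i < N) w.1 i ^+ 2 * p.[w.1 i]) =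
          (fun N => \sum_(j < size p) p`_j * \sum_(i < N) w.1 i ^+ j.+2).
  apply/funext => N; under [RHS]eq_bigr do rewrite mulr_sumr.
  rewrite exchange_big /=; apply: eq_bigr => i _.
  rewrite horner_coef mulr_sumr; apply: eq_bigr => j _.
  by rewrite !exprS expr0; ring.
elim: (size p) => [|n IH].
  have -> : (fun N => \sum_(j < 0) p`_j * \sum_(i < N) w.1 i ^+ j.+2) = (fun _ => 0).
    by apply/funext => N; rewrite big_ord0.
  by rewrite big_ord0; apply: cvg_cst.
have -> : (fun N => \sum_(j < n.+1) p`_j * \sum_(i < N) w.1 i ^+ j.+2) =
   (fun N => \sum_(j < n) p`_j * \sum_(i < N) w.1 i ^+ j.+2 + p`_n * \sum_(i < N) w.1 i ^+ n.+2).
  by apply/funext => N; rewrite big_ord_recr.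
rewrite big_ord_recr /=; apply: cvgD => //.
by apply: cvgMr; apply: coord_psum_cvg.
Qed.

(** p_(j+2) is the j-th moment of the signed measure with mass alpha_i^2 at alpha_i and -beta_i^2 at
    -beta_i; its total variation is finite since all squares sum up. *)
Lemma moment_cvg w (p : {poly R}) : Omega R w ->
  (fun N => \sum_(i < N) (w.1 i ^+ 2 * p.[w.1 i] - w.2 i ^+ 2 * p.[- w.2 i])) @ \oo -->
  \sum_(j < size p) p`_j * pO j.+2 w.
Proof.
move=> Ow; have -> : (fun N => \sum_(i < N) (w.1 i ^+ 2 * p.[w.1 i] - w.2 i ^+ 2 * p.[- w.2 i])) =
  (fun N => \sum_(i < N) w.1 i ^+ 2 * p.[w.1 i] -
            \sum_(i < N) (swapO w).1 i ^+ 2 * (p \Po (- 'X)).[(swapO w).1 i]).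
  apply/funext => N; rewrite sumrB; congr (_ - _); apply: eq_bigr => i _.
  by rewrite horner_comp !hornerE.
have -> : \sum_(j < size p) p`_j * pO j.+2 w =
   \sum_(j < size p) p`_j * coord_psum j.+2 w.1 -
   \sum_(j < size (p \Po (- 'X))) (p \Po (- 'X))`_j * coord_psum j.+2 (swapO w).1.
  have -> : size (p \Po - 'X) = size p.
    by rewrite size_comp_poly2 // size_polyN size_polyX.
  rewrite -sumrB; apply: eq_bigr => j _; rewrite pOE //=.
  have -> : (p \Po - 'X)`_j = p`_j * (-1) ^+ j.
    rewrite -[- 'X]scaleN1r -[(-1) *: 'X]mulr1 -scalerAl mulr1.
    rewrite comp_polyE coef_sum (bigD1 j) //= big1 ?addr0.
      by rewrite coefZ exprZn coefZ coefXn eqxx mulr1.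
    move=> k; rewrite -val_eqE /= => ne.
    by rewrite coefZ exprZn coefZ coefXn eq_sym (negPf ne) !mulr0.
  by rewrite exprS /swapO /=; ring.
by apply: cvgB; apply: psum_horner_cvg => //; apply: Omega_swap.
Qed.

Lemma expr_small (q : R) e : 0 <= q < 1 -> 0 < e -> exists m, q ^+ m <= e.
Proof.
move=> /andP[q0 q1] e0; have ql : `|q| < 1 by rewrite ger0_norm.
have [N HN] := (cvgn_leP _ 0).1 (cvg_expr ql) e e0.
exists N; apply: le_trans (HN N (leqnn N)); rewrite subr0; exact: ler_norm.
Qed.

Lemma Omega_sqsum1 w N : Omega R w -> \sum_(i < N) w.1 i ^+ 2 <= 1.
Proof.
move=> Ow; apply: le_trans (Omega_sum1 N Ow); apply: ler_sum => i _.
have [w0 _] := Omega_ge0 Ow i.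
by rewrite expr2 ler_piMr // Omega_le1.
Qed.

(* A polynomial peaked at the largest coordinate where x and y differ separates
   their moments. *)
Lemma separation_aux x y i : Omega R x -> Omega R y ->
  (forall k, (1 < k)%N -> pO k x = pO k y) ->
  (forall j, (j < i)%N -> x.1 j = y.1 j) -> ~ (y.1 i < x.1 i).
Proof.
move=> Ox Oy E eqi lti; set x0 := x.1 i; set t := y.1 i.
have t0 : 0 <= t by have [] := Omega_ge0 Oy i.
have x01 : x0 <= 1 by apply: Omega_le1.
have tx : t < x0 by [].
pose q := 1 - (x0 - t) ^+ 2 / 4.
have q01 : 0 <= q < 1.
  have : 0 < (x0 - t) ^+ 2 by rewrite exprn_gt0 // subr_gt0.
  have : (x0 - t) ^+ 2 <= 1 by apply: exprn_ile1; move: tx t0 x01; clear; lra.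
  by rewrite /q => ? ?; apply/andP; split; lra.
have x00 : 0 < x0 by apply: le_lt_trans lti.
have x04 : 0 < x0 ^+ 2 / 4 by rewrite divr_gt0 // exprn_gt0.
have [m qm] := expr_small q01 x04.
(* The factor 1/4 keeps the base in [0, 1] on [-1, 1]. The value is 1 at x0 and at most q^m <= x0^2
   / 4 to the left of t. *)
pose p : {poly R} := (1%:P - 4^-1 *: ('X - x0%:P) ^+ 2) ^+ m.
have pE u : p.[u] = (1 - (u - x0) ^+ 2 / 4) ^+ m.
  by rewrite /p horner_exp hornerD hornerN hornerC hornerZ horner_exp hornerXsubC mulrC.
have p0 u : -1 <= u <= 1 -> 0 <= p.[u].
  move=> /andP[u1 u2]; rewrite pE exprn_ge0 // subr_ge0 ler_pdivrMr // mul1r.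
  have : 0 <= (2 - (u - x0)) * (2 + (u - x0)).
    by apply: mulr_ge0; move: u1 u2 x00 x01; clear; lra.
  by nra.
have pq u : -1 <= u <= t -> p.[u] <= q ^+ m.
  move=> /andP[u1 u2]; rewrite pE; have ut : t <= 1 by apply: ltW (lt_le_trans lti x01).
  have H : (x0 - t) ^+ 2 <= (u - x0) ^+ 2.
    by rewrite -[leRHS]sqrrN opprB lerXn2r ?nnegrE; move: tx u2; clear; lra.
  apply: lerXn2r; rewrite ?nnegrE; [|by case/andP: q01|by rewrite /q; lra].
  rewrite subr_ge0 ler_pdivrMr // mul1r.
  have : 0 <= (2 - (u - x0)) * (2 + (u - x0)).
    by apply: mulr_ge0; move: u1 u2 x00 x01 ut; clear; lra.
  by nra.
have p1 : p.[x0] = 1 by rewrite pE subrr expr0n mul0r subr0 expr1n.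
have L : \sum_(j < size p) p`_j * pO j.+2 x - \sum_(j < size p) p`_j * pO j.+2 y = 0.
  by rewrite -sumrB big1 // => j _; rewrite E // subrr.
have C : (fun N => \sum_(i < N) (x.1 i ^+ 2 * p.[x.1 i] - x.2 i ^+ 2 * p.[- x.2 i]) -
    \sum_(i < N) (y.1 i ^+ 2 * p.[y.1 i] - y.2 i ^+ 2 * p.[- y.2 i])) @ \oo -->
    \sum_(j < size p) p`_j * pO j.+2 x - \sum_(j < size p) p`_j * pO j.+2 y.
  by apply: cvgB; apply: moment_cvg.
rewrite L in C.
(* Coordinates before i cancel and coordinate i of x gives x0^2. Against this stand two amounts of
   at most x0^2 / 4: the beta part of x, and the alpha part of y from i on. *)
have lb : x0 ^+ 2 / 2 <= 0.
  have Cc : (fun _ : nat => x0 ^+ 2 / 2) @ \oo --> x0 ^+ 2 / 2 by exact: cvg_cst.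
  apply: (ler_cvg_to Cc C).
  exists i.+1 => // N /= iN.
  rewrite !sumrB.
  have Sx : x0 ^+ 2 + \sum_(j < i) x.1 j ^+ 2 * p.[x.1 j] <= \sum_(j < N) x.1 j ^+ 2 * p.[x.1 j].
    rewrite -!(big_mkord xpredT (fun j => x.1 j ^+ 2 * p.[x.1 j])).
    rewrite [leRHS](big_cat_nat _ iN) //= big_nat_recr //= -/x0 p1 mulr1 [leLHS]addrC lerDl.
    apply: sumr_ge0 => j _; rewrite mulr_ge0 ?sqr_ge0 // p0 // Omega_le1 // andbT.
    by have [? _] := Omega_ge0 Ox j; apply: le_trans (_ : 0 <= _) => //; rewrite lerN10.
  have Sx2 : \sum_(j < N) x.2 j ^+ 2 * p.[- x.2 j] <= q ^+ m.
    apply: (@le_trans _ _ (\sum_(j < N) (swapO x).1 j ^+ 2 * q ^+ m)).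
      apply: ler_sum => j _; rewrite ler_wpM2l ?sqr_ge0 // pq //.
      have : x.2 j <= 1 by apply: (Omega_le1 j (Omega_swap Ox)).
      have [_ ?] := Omega_ge0 Ox j; move=> ?; apply/andP; split; lra.
    rewrite -mulr_suml -[leRHS]mul1r ler_wpM2r ?exprn_ge0 //; first by case/andP: q01.
    exact: Omega_sqsum1 (Omega_swap Ox).
  have Sy2 : 0 <= \sum_(j < N) y.2 j ^+ 2 * p.[- y.2 j].
    apply: sumr_ge0 => j _; rewrite mulr_ge0 ?sqr_ge0 // p0 //.
    have : y.2 j <= 1 by apply: (Omega_le1 j (Omega_swap Oy)).
    by have [_ ?] := Omega_ge0 Oy j; move=> ?; apply/andP; split; lra.
  have Sy : \sum_(j < N) y.1 j ^+ 2 * p.[y.1 j] <= \sum_(j < i) x.1 j ^+ 2 * p.[x.1 j] + q ^+ m.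
    have iN' : (i <= N)%N := ltnW iN.
    rewrite -!(big_mkord xpredT (fun j => x.1 j ^+ 2 * p.[x.1 j])).
    rewrite -!(big_mkord xpredT (fun j => y.1 j ^+ 2 * p.[y.1 j])).
    rewrite (big_cat_nat _ iN') //=; apply: lerD.
      by rewrite le_eqVlt; apply/orP; left; apply/eqP; apply: eq_big_nat => j /andP[_ ji]; rewrite eqi.
    apply: (@le_trans _ _ (\sum_(i <= j < N) y.1 j ^+ 2 * q ^+ m)).
      rewrite big_nat [leRHS]big_nat; apply: ler_sum => j /andP[ij _].
      rewrite ler_wpM2l ?sqr_ge0 // pq // (Omega_dec Oy ij) andbT.
      by have [? _] := Omega_ge0 Oy j; apply: le_trans (_ : 0 <= _) => //; rewrite lerN10.
    rewrite -mulr_suml -[leRHS]mul1r ler_wpM2r ?exprn_ge0 //; first by case/andP: q01.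
    apply: le_trans (Omega_sqsum1 N Oy).
    rewrite -(big_mkord xpredT (fun j => y.1 j ^+ 2)) [leRHS](big_cat_nat _ iN') //= lerDr.
    by apply: sumr_ge0 => j _; apply: sqr_ge0.
  by lra.
have : 0 < x0 ^+ 2 / 2 by rewrite divr_gt0 // exprn_gt0.
by rewrite ltNge lb.
Qed.

Lemma separation1 x y : Omega R x -> Omega R y ->
  (forall k, (1 < k)%N -> pO k x = pO k y) -> forall i, x.1 i = y.1 i.
Proof.
move=> Ox Oy E i; have [m] := ubnP i; elim: m i => // m IH i /ltnSE im.
have eqi j : (j < i)%N -> x.1 j = y.1 j by move=> ji; apply: IH; apply: leq_trans im.
apply/eqP; rewrite eq_le !leNgt; apply/andP; split; apply/negP.
  exact: separation_aux.
by apply: separation_aux => // [k k1|j ji]; rewrite ?E // eqi.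
Qed.

Lemma pO_swap k w : (1 < k)%N -> pO k (swapO w) = (-1) ^+ k.-1 * pO k w.
Proof.
by move=> k1; rewrite !pOE // mulrDr mulrA -expr2 sqrr_sign mul1r addrC.
Qed.

Lemma separation x y : Omega R x -> Omega R y ->
  (forall k, (1 < k)%N -> pO k x = pO k y) ->
  forall i, x.1 i = y.1 i /\ x.2 i = y.2 i.
Proof.
move=> Ox Oy E i; split; first exact: separation1.
apply: (separation1 (Omega_swap Ox) (Omega_swap Oy)) => k k1.
by rewrite !pO_swap // E.
Qed.

Definition approx (f : Th R -> R) : Prop :=
  forall e, 0 < e -> exists2 g, LamO g & forall w, Omega R w -> `|f w - g w| <= e.

Lemma approx_contO f : approx f -> contO f.
Proof.
by move=> af; apply: contO_unif => e /af[g /contO_LamO cg H]; exists g.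
Qed.

Lemma approx_LamO f : LamO f -> approx f.
Proof. by move=> lf e e0; exists f => // w _; rewrite subrr normr0 ltW. Qed.

Lemma eq_approx f g : (forall w, Omega R w -> f w = g w) -> approx f -> approx g.
Proof. by move=> E af e /af[h lh H]; exists h => // w Ow; rewrite -E //; apply: H. Qed.

Lemma approxD f g : approx f -> approx g -> approx (fun w => f w + g w).
Proof.
move=> af ag e e0; have e20 : 0 < e / 2 by rewrite divr_gt0.
have [f' lf Hf] := af _ e20; have [g' lg Hg] := ag _ e20.
exists (fun w => f' w + g' w); first exact: LamOD.
move=> w Ow; have -> : f w + g w - (f' w + g' w) = (f w - f' w) + (g w - g' w) by ring.
by apply: le_trans (ler_normD _ _) _; rewrite (splitr e) lerD ?Hf ?Hg.
Qed.

Lemma approxM f g : approx f -> approx g -> approx (fun w => f w * g w).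
Proof.
move=> af ag e e0.
have [Cf Cf0 HCf] := contO_bounded (approx_contO af).
have [Cg Cg0 HCg] := contO_bounded (approx_contO ag).
pose d := Num.min 1 (e / (2 * (Cf + Cg + 1))).
have C0 : 0 < Cf + Cg + 1 by rewrite !addr_gt0.
have d0 : 0 < d by rewrite lt_min ltr01 divr_gt0 // mulr_gt0.
have dC : d * (Cf + Cg + 1) <= e / 2.
  have : d <= e / (2 * (Cf + Cg + 1)) by rewrite ge_min lexx orbT.
  rewrite -(ler_pM2r C0) => /le_trans; apply.
  by rewrite invfM mulrA divfK // gt_eqF.
have d1 : d <= 1 by rewrite ge_min lexx.
have [f' lf Hf] := af _ d0; have [g' lg Hg] := ag _ d0.
exists (fun w => f' w * g' w); first exact: LamOM.
move=> w Ow; have h1 := Hf w Ow; have h2 := Hg w Ow.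
have -> : f w * g w - f' w * g' w = (f w - f' w) * g w + f' w * (g w - g' w) by ring.
have f'C : `|f' w| <= Cf + 1.
  have -> : f' w = f w - (f w - f' w) by ring.
  by apply: le_trans (ler_normB _ _) _; rewrite lerD ?HCf // (le_trans h1).
apply: le_trans (ler_normD _ _) _; rewrite !normrM.
have n1 : `|f w - f' w| * `|g w| <= d * Cg by apply: ler_pM => //; apply: HCg.
have n2 : `|f' w| * `|g w - g' w| <= (Cf + 1) * d by apply: ler_pM.
by move: n1 n2 dC; nra.
Qed.

Lemma approx_cst c : approx (fun _ => c).
Proof. by apply: approx_LamO; apply: LamO_cst. Qed.

Lemma approxZ c f : approx f -> approx (fun w => c * f w).
Proof. by apply: approxM; apply: approx_cst. Qed.

Lemma approx_unif f : (forall e, 0 < e -> exists2 g, approx g &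
   forall w, Omega R w -> `|f w - g w| <= e) -> approx f.
Proof.
move=> H e e0; have e20 : 0 < e / 2 by rewrite divr_gt0.
have [g ag Hg] := H _ e20; have [h lh Hh] := ag _ e20.
exists h => // w Ow; have -> : f w - h w = (f w - g w) + (g w - h w) by ring.
by apply: le_trans (ler_normD _ _) _; rewrite (splitr e) lerD ?Hg ?Hh.
Qed.

(* Polynomial approximation of the absolute value on [-1, 1]. *)
Fixpoint abs_iter (n : nat) (x : R) : R :=
  if n is n'.+1 then abs_iter n' x + (x ^+ 2 - abs_iter n' x ^+ 2) / 2 else 0.

(** The last bound gives an error of at most 2 / n, uniformly in x. It propagates since each step
    multiplies the error by 1 - (|x| + a_n) / 2. *)
Lemma abs_iterP (n : nat) (x : R) : `|x| <= 1 ->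
  [/\ 0 <= abs_iter n x, abs_iter n x <= `|x| &
      (`|x| - abs_iter n x) * (2 + n%:R * `|x|) <= 2 * `|x|].
Proof.
move=> x1; have x0 := normr_ge0 x.
elim: n => [|n [IH1 IH2 IH3]].
  by split=> //=; rewrite subr0 mul0r addr0 mulrC.
have -> : abs_iter n.+1 x = abs_iter n x + (`|x| ^+ 2 - abs_iter n x ^+ 2) / 2.
  by rewrite /= real_normK ?num_real.
move: IH1 IH2 IH3; set a := abs_iter n x; set y := `|x| in x0 x1 * => a0 ay IH.
have n0 : 0 <= n%:R :> R by [].
split; [by nra|by nra|].
have E : y - (a + (y ^+ 2 - a ^+ 2) / 2) = (y - a) * (1 - (y + a) / 2) by field.
rewrite E -[n.+1%:R]natr1.
apply: le_trans IH; rewrite -mulrA ler_wpM2l ?subr_ge0 //.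
have : 0 <= n%:R * y by rewrite mulr_ge0.
have : 0 <= n%:R * y * y by rewrite !mulr_ge0.
have : 0 <= n%:R * y * a by rewrite !mulr_ge0.
have : 0 <= y * y by rewrite mulr_ge0.
have : 0 <= y * a by rewrite mulr_ge0.
by move: a0 x0; clear; nra.
Qed.

Lemma abs_iter_approx n f : approx f -> approx (fun w => abs_iter n (f w)).
Proof.
move=> af; elim: n => [|n IH] /=; first exact: approx_cst.
apply: approxD => //.
have H := approxD (approxM af af) (approxZ (-1) (approxM IH IH)).
apply: eq_approx (approxZ 2^-1 H) => w _.
by rewrite !expr2; ring.
Qed.

Lemma approx_abs f : approx f -> approx (fun w => `|f w|).
Proof.
move=> af; have [C C0 HC] := contO_bounded (approx_contO af).
suff H : approx (fun w => `|C^-1 * f w|).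
  apply: eq_approx (approxZ C H) => w _.
  by rewrite normrM normfV (gtr0_norm C0) mulrA mulfV ?mul1r ?gt_eqF.
have ag := approxZ C^-1 af; set g := fun w => C^-1 * f w.
apply: approx_unif => e e0; have e20 : 0 < e / 2 by rewrite divr_gt0.
have [N HN] := inv_small e20.
exists (fun w => abs_iter N.+1 (g w)); first exact: abs_iter_approx.
move=> w Ow; have g1 : `|g w| <= 1.
  rewrite /g normrM normfV (gtr0_norm C0) mulrC ler_pdivrMr // mul1r.
  exact: HC.
have [a0 ag' H] := abs_iterP N.+1 g1.
rewrite -/(g w) ger0_norm ?subr_ge0 //.
have n0 : 0 < N.+1%:R :> R by rewrite ltr0n.
have := HN N (leqnn N); rewrite -[_^-1]mul1r ler_pdivrMr // => H2.
have [g0|gn] := ltrP 0 `|g w|; last by move: a0 ag' gn; lra.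
move: H H2 a0 ag' g0; set u := `|g w|; set v := abs_iter _ _; set k := N.+1%:R => H H2 a0 ag' g0.
have H3 : (u - v) * k <= 2.
  rewrite -(ler_pM2r g0); apply: le_trans H.
  by rewrite mulrDr -mulrA lerDr mulr_ge0 ?subr_ge0.
rewrite -(ler_pM2r n0) -/k; apply: le_trans H3 _.
by move: H2; lra.
Qed.

Lemma approx_max f g : approx f -> approx g -> approx (fun w => Num.max (f w) (g w)).
Proof.
move=> af ag.
have H := approxD (approxD af ag) (approx_abs (approxD af (approxZ (-1) ag))).
apply: eq_approx (approxZ 2^-1 H) => w _; rewrite maxr_absE mulN1r; by field.
Qed.

Lemma approx_min f g : approx f -> approx g -> approx (fun w => Num.min (f w) (g w)).
Proof.
move=> af ag.
have H := approxD (approxD af ag) (approxZ (-1) (approx_abs (approxD af (approxZ (-1) ag)))).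
apply: eq_approx (approxZ 2^-1 H) => w _; rewrite minr_absE !mulN1r; by field.
Qed.

(** If some p_k separates x and y, an affine function of p_k does it. Otherwise x and y have equal
    coordinates by [separation], continuity forces f x = f y, and a constant works. *)
Lemma approx_interp f x y : contO f -> Omega R x -> Omega R y ->
  exists h, [/\ approx h, h x = f x & h y = f y].
Proof.
move=> cf Ox Oy.
have [E|nE] := pselect (forall k, (1 < k)%N -> pO k x = pO k y).
  have S := separation Ox Oy E; exists (fun _ => f x); split => //; first exact: approx_cst.
  apply/eqP/contraT => ne; have d0 : 0 < `|f x - f y| by rewrite normr_gt0 subr_eq0.
  have [k [d dd0 H]] := cf x Ox _ d0.
  have /H : forall i, (i < k)%N -> `|x.1 i - y.1 i| < d /\ `|x.2 i - y.2 i| < d.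
    by move=> i _; have [-> ->] := S i; rewrite !subrr normr0.
  by rewrite ltxx => /(_ Oy).
have [k [k1 ne]] : exists k, (1 < k)%N /\ pO k x <> pO k y.
  apply: contrapT => /forallNP H; apply: nE => k k1.
  by apply: contrapT => ne; apply: (H k).
have ne' : pO k y - pO k x != 0 by rewrite subr_eq0; apply/eqP => /esym.
exists (fun w => f x + (f y - f x) / (pO k y - pO k x) * (pO k w + (- pO k x))); split.
- apply: approxD; first exact: approx_cst.
  apply: approxZ; apply: approxD; last exact: approx_cst.
  by apply: approx_LamO; apply: LamO_pO; apply: ltnW.
- by rewrite subrr mulr0 addr0.
- by rewrite divfK // addrC subrK.
Qed.

(** First half of the lattice argument: interpolants at x and y are glued by maxima over y, and
    [stone_weierstrass] then glues by minima over x. *)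
Lemma approx_above f x e : contO f -> Omega R x -> 0 < e ->
  exists h, [/\ approx h, h x = f x & forall y, Omega R y -> f y - e <= h y].
Proof.
move=> cf Ox e0.
suff [h [ah hx H]] : exists h, [/\ approx h, h x = f x &
    forall y, Omega R y -> Omega R y -> f y - e <= h y].
  by exists h; split=> // y Oy; apply: H.
apply: (Omega_ind (Q := fun A => exists h, [/\ approx h, h x = f x &
    forall y, A y -> Omega R y -> f y - e <= h y])).
- by exists (fun _ => f x); split=> //; apply: approx_cst.
- move=> A B [h1 [a1 x1 H1]] [h2 [a2 x2 H2]].
  exists (fun w => Num.max (h1 w) (h2 w)); split; first exact: approx_max.
    by rewrite x1 x2 maxxx.
  by move=> y [Ay|By] Oy; rewrite le_max; apply/orP; [left; apply: H1 | right; apply: H2].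
- by move=> A B AB [h [a hx H]]; exists h; split=> // y /AB; apply: H.
move=> y Oy; have [h [ah hx hy]] := approx_interp cf Ox Oy.
have [k [d d0 H]] := contOB cf (approx_contO ah) Oy e0.
exists k, d => //; exists h; split=> // y' [Oy' n] _.
have := H y' Oy' n; rewrite hy subrr sub0r normrN => /(le_lt_trans (ler_norm _)).
by lra.
Qed.

Lemma stone_weierstrass f : contO f -> approx f.
Proof.
move=> cf; apply: approx_unif => e e0.
have [C C0 HC] := contO_bounded cf.
suff [h [ah H1 H2]] : exists h, [/\ approx h, forall y, Omega R y -> f y - e <= h y &
    forall y, Omega R y -> Omega R y -> h y <= f y + e].
  exists h => // w Ow; have := H1 w Ow; have := H2 w Ow Ow.
  by rewrite ler_norml => ? ?; apply/andP; split; lra.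
apply: (Omega_ind (Q := fun A => exists h, [/\ approx h, forall y, Omega R y -> f y - e <= h y &
    forall y, A y -> Omega R y -> h y <= f y + e])).
- exists (fun _ => C); split=> //; first exact: approx_cst.
  by move=> y Oy; have := HC y Oy; rewrite ler_norml => /andP[_]; lra.
- move=> A B [h1 [a1 x1 H1]] [h2 [a2 x2 H2]].
  exists (fun w => Num.min (h1 w) (h2 w)); split; first exact: approx_min.
    by move=> y Oy; rewrite le_min x1 ?x2.
  by move=> y [Ay|By] Oy; rewrite ge_min; apply/orP; [left; apply: H1 | right; apply: H2].
- by move=> A B AB [h [a hx H]]; exists h; split=> // y /AB; apply: H.
move=> x Ox; have [h [ah hx hy]] := approx_above cf Ox e0.
have [k [d d0 H]] := contOB cf (approx_contO ah) Ox e0.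
exists k, d => //; exists h; split=> // y' [Oy' n] _.
have := H y' Oy' n; rewrite hx subrr sub0r normrN ltr_norml => /andP[+ _].
by lra.
Qed.

End StoneWeierstrass.

(** * The diagrams fill the Thoma simplex *)

Section Density.

Definition part_of (r : nat -> nat) L : seq nat :=
  mkseq r (count (fun i => 0 < r i)%N (iota 0 L)).

Lemma nonincr_le (r : nat -> nat) i j : (forall i, r i.+1 <= r i)%N -> (i <= j)%N ->
  (r j <= r i)%N.
Proof.
move=> dec; elim: j => [|j IH]; first by rewrite leqn0 => /eqP ->.
by rewrite leq_eqVlt => /predU1P[->|/ltnSE /IH]; last apply: leq_trans.
Qed.

Lemma part_ofP (r : nat -> nat) L : (forall i, r i.+1 <= r i)%N ->
  (forall i, (L <= i)%N -> r i = 0%N) ->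
  [/\ forall i, nth 0%N (part_of r L) i = r i, is_partition (part_of r L) &
      sumn (part_of r L) = (\sum_(i < L) r i)%N].
Proof.
move=> dec out; set D := count (fun i => 0 < r i)%N (iota 0 L).
have DE i : (i < D)%N = (0 < r i)%N.
  apply: ltn_count_iota => [j k jk lt|j Lj]; last by rewrite out.
  exact: leq_trans lt (nonincr_le dec jk).
have N i : nth 0%N (part_of r L) i = r i.
  rewrite /part_of -/D; have [iD|Di] := ltnP i D; first by rewrite nth_mkseq.
  rewrite nth_default ?size_mkseq //; apply/esym/eqP.
  by rewrite -leqn0 leqNgt -DE -leqNgt.
split=> //.
  apply/is_partitionP; split => [i|i]; rewrite !N // /part_of -/D size_mkseq.
  by rewrite DE.
have DL : (D <= L)%N by rewrite -[leqRHS](size_iota 0 L) count_size.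
rewrite (@sumn_nth _ L) ?size_mkseq //.
by apply: eq_bigr => i _; rewrite N.
Qed.

Variables (k s T : nat) (A B : nat -> nat).
Hypotheses (decA : forall j, (A j.+1 <= A j)%N) (decB : forall j, (B j.+1 <= B j)%N).

(* k long rows, k long columns, and T boxes spread over an s x s square. *)
Definition shape_row (i : nat) : nat :=
  if (i < k)%N then (k + s + A i)%N
  else if (i < k + s)%N then (k + minn s (T - (i - k) * s))%N
  else count (fun j => i - (k + s) < B j)%N (iota 0 k).

Lemma shape_row_dec i : (shape_row i.+1 <= shape_row i)%N.
Proof.
rewrite /shape_row; have [ik|ik] := ltnP i.+1 k.
  by rewrite (ltnW ik) leq_add2l.
have cnt t : (count (fun j => t < B j)%N (iota 0 k) <= k)%N.
  by rewrite -[leqRHS](size_iota 0 k) count_size.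
have [ik'|ik'] := ltnP i k.
  case: ifP => _; first by have := geq_minl s (T - (i.+1 - k) * s); lia.
  by apply: leq_trans (cnt _) _; rewrite -addnA leq_addr.
have [is1|is1] := ltnP i.+1 (k + s).
  rewrite (ltnW is1) leq_add2l leq_min geq_minl /=.
  apply: leq_trans (geq_minr _ _) _; apply: leq_sub2l.
  by rewrite leq_mul2r leq_sub2r ?orbT.
case: ifP => _; first by apply: leq_trans (cnt _) _; rewrite leq_addr.
apply: sub_count => j /=; apply: leq_ltn_trans.
by apply: leq_sub2r.
Qed.

Lemma sum_fill s' : (\sum_(j < s') minn s (T - j * s) = minn T (s' * s))%N.
Proof.
elim: s' => [|s' IH]; first by rewrite big_ord0 mul0n minn0.
rewrite big_ord_recr /= IH mulSn.
by move: (s' * s)%N => x; lia.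
Qed.

Lemma sum_lt b M : (b <= M)%N -> (\sum_(t < M) (t < b) = b)%N.
Proof.
move=> bM; rewrite -[RHS]card_ord -sum1_card (big_ord_widen M (fun _ => 1%N) bM).
by rewrite [RHS]big_mkcond; apply: eq_bigr => t _; case: (t < b)%N.
Qed.

Lemma sum_count_lt M : (forall j, (j < k)%N -> (B j <= M)%N) ->
  (\sum_(t < M) count (fun j => t < B j) (iota 0 k) = \sum_(j < k) B j)%N.
Proof.
move=> BM; under eq_bigr do rewrite -sum1_count big_mkcond /=.
rewrite exchange_big /= -{1}(subn0 k) -/(index_iota 0 k) big_mkord.
apply: eq_bigr => j _; rewrite -[RHS](sum_lt (BM _ (ltn_ord j))).
by apply: eq_bigr => t _; case: (t < B j)%N.
Qed.

Lemma sum_shape_row M : (T <= s * s)%N -> (forall j, (j < k)%N -> (B j <= M)%N) ->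
  (\sum_(i < k + s + M) shape_row i =
   k * k + 2 * (k * s) + \sum_(j < k) A j + \sum_(j < k) B j + T)%N.
Proof.
move=> Ts BM; rewrite big_split_ord /= big_split_ord /=.
have -> : (\sum_(i < k) shape_row i = k * (k + s) + \sum_(j < k) A j)%N.
  rewrite -[X in (X * _)%N](card_ord k) -sum_nat_const -big_split /=.
  by apply: eq_bigr => i _; rewrite /shape_row ltn_ord.
have -> : (\sum_(i < s) shape_row (k + i) = s * k + T)%N.
  rewrite -[X in (X * _)%N](card_ord s) -sum_nat_const -[T in RHS](minn_idPl Ts) -sum_fill -big_split /=.
  apply: eq_bigr => i _; rewrite /shape_row ltnNge leq_addr /= ltn_add2l ltn_ord.
  by rewrite addKn.
have -> : (\sum_(i < M) shape_row (k + s + i) = \sum_(j < k) B j)%N.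
  rewrite -(sum_count_lt BM); apply: eq_bigr => t _.
  rewrite /shape_row ltnNge -addnA leq_addr /= ltnNge addnA leq_addr /=.
  by rewrite addKn.
by rewrite mulnDr (mulnC s k); move: (bigop.body _ _ _) (bigop.body _ _ _) (k * k)%N (k * s)%N; lia.
Qed.

Lemma shape_row_conj i j : (j < k)%N -> (j < shape_row i)%N = (i < k + s + B j)%N.
Proof.
move=> jk; rewrite /shape_row; have [ik|ik] := ltnP i k; first by lia.
have [is1|is1] := ltnP i (k + s); first by lia.
have -> : count (fun j => i - (k + s) < B j)%N (iota 0 k) =
          count (fun j => (j < k) && (i - (k + s) < B j))%N (iota 0 k).
  by apply: eq_in_count => l; rewrite mem_iota add0n => /andP[_ ->].
rewrite (ltn_count_iota (P := fun j => (j < k) && (i - (k + s) < B j))%N).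
- by rewrite jk /=; lia.
- move=> l l' ll' /andP[lk lt]; rewrite (leq_ltn_trans ll' lk).
  exact: leq_trans lt (nonincr_le decB ll').
by move=> l kl; rewrite ltnNge kl.
Qed.

(** The surplus T, the mass that w does not give to its first k coordinates, sits in the inner
    square, where it leaves the first k Frobenius coordinates unchanged. *)
Lemma shape_exists n : (T <= s * s)%N ->
  (k * k + 2 * (k * s) + \sum_(j < k) A j + \sum_(j < k) B j + T = n)%N ->
  exists2 lam, lam \in Yn n &
    forall j, (j < k)%N -> [/\ (j < frob_d lam)%N, nth 0%N lam j = (k + s + A j)%N &
                              conj_row lam j = (k + s + B j)%N].
Proof.
move=> Ts sumE; pose M := B 0%N.
have BM j : (j < k)%N -> (B j <= M)%N by move=> _; apply: nonincr_le.
have out i : (k + s + M <= i)%N -> shape_row i = 0%N.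
  move=> le; rewrite /shape_row ifF; last by lia.
  rewrite ifF; last by lia.
  apply/eqP; rewrite -leqn0 leqNgt -has_count -all_predC; apply/allP => j _ /=.
  by rewrite -leqNgt; have := nonincr_le decB (leq0n j); rewrite -/M; lia.
have [N P S] := part_ofP shape_row_dec out.
exists (part_of shape_row (k + s + M)).
  by rewrite mem_Yn P S sum_shape_row // sumE eqxx.
move=> j jk; split.
- by rewrite ltn_frob_d // N /shape_row jk; lia.
- by rewrite N /shape_row jk.
have H i : (i < conj_row (part_of shape_row (k + s + M)) j)%N = (i < k + s + B j)%N.
  by rewrite ltn_conj_row // N shape_row_conj.
case: (ltngtP (conj_row (part_of shape_row (k + s + M)) j) (k + s + B j)) => // lt.
  by have := H (conj_row (part_of shape_row (k + s + M)) j); rewrite ltnn lt.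
by have := H (k + s + B j)%N; rewrite ltnn lt.
Qed.

End Density.

Section DensityOmega.
Variable R : realType.

Lemma nat_sqrt n : exists t, (t * t <= n < t.+1 * t.+1)%N.
Proof.
elim: n => [|n [t /andP[t1 t2]]]; first by exists 0%N.
have [lt|ge] := ltnP n.+1 (t.+1 * t.+1); first by exists t; rewrite lt leqW.
exists t.+1; rewrite ge /=; apply: leq_ltn_trans t2 _.
by rewrite ltn_mul.
Qed.

(** s is about the square root of n: an s x s square holds any surplus of at most n boxes, while C s
    is negligible against n. *)
Lemma sqrt_scale (C d : R) : 0 < C -> 0 < d -> exists N, forall n, (N <= n)%N ->
  exists s, [/\ (0 < s)%N, (n <= s * s)%N & C * s%:R < d * n%:R].
Proof.
move=> C0 d0; pose q := (Num.truncn (d^-1 * (2 * C))).+1.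
have qP : 2 * C < d * q%:R.
  by rewrite -ltr_pdivrMl //; exact: truncnS_gt.
exists (q.+1 * q.+1)%N => n Nn; have [t /andP[t1 t2]] := nat_sqrt n.
have qt : (q < t)%N.
  rewrite ltnNge; apply/negP => tq.
  have : (t.+1 * t.+1 <= q.+1 * q.+1)%N by rewrite leq_mul.
  by rewrite leqNgt (leq_ltn_trans Nn t2).
exists t.+1; split=> //; first exact: ltnW.
have t0 : 1 <= t%:R :> R by rewrite ler1n (leq_ltn_trans _ qt).
have qt' : q%:R <= t%:R :> R by rewrite ler_nat ltnW.
have tn : t%:R * t%:R <= n%:R :> R by rewrite -natrM ler_nat.
rewrite -[t.+1%:R]natr1.
apply: (@le_lt_trans _ _ (2 * C * t%:R)); first by nra.
apply: (@lt_le_trans _ _ (d * t%:R * t%:R)).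
  rewrite ltr_pM2r; last by lra.
  by apply: lt_le_trans qP _; rewrite ler_pM2l.
by rewrite -mulrA ler_pM2l.
Qed.

Lemma iotaY_dense w k (d : R) : Omega R w -> 0 < d ->
  exists N, forall n, (N <= n)%N -> exists2 lam, lam \in Yn n & nearO k d w (iotaY R n lam).
Proof.
(* C s dominates K + k + s + 1, the total error counted in boxes: K for the frame, k + s for the
   shift of the rows, 1 for rounding. *)
move=> Ow d0; pose C : R := (k * k + 3 * k + 2)%:R.
have C0 : 0 < C by rewrite ltr0n addn2.
have d10 : 0 < Num.min d 1 by rewrite lt_min d0 ltr01.
have [N HN] := sqrt_scale C0 d10; exists N => n /HN[s [s0 ns Cs]].
have CsE : C * s%:R = ((k * k + 3 * k + 2) * s)%:R by rewrite natrM.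
have Cn : ((k * k + 3 * k + 2) * s <= n)%N.
  rewrite -(ler_nat R) -CsE; apply: ltW; apply: lt_le_trans Cs _.
  by rewrite ler_piMl // ge_min lexx orbT.
have {}Cs : ((k * k + 3 * k + 2) * s)%:R < d * n%:R :> R.
  by rewrite -CsE; apply: lt_le_trans Cs _; rewrite ler_wpM2r // ge_min lexx.
pose K := (k * k + 2 * (k * s))%N.
have KC : (K + k + s + 1 <= (k * k + 3 * k + 2) * s)%N.
  have : (k * k <= k * k * s)%N by rewrite leq_pmulr.
  have : (k <= k * s)%N by rewrite leq_pmulr.
  by rewrite /K !mulnDl -mulnA; move: (k * k * s)%N (k * s)%N (k * k)%N; lia.
have Kn : (K <= n)%N by lia.
(* K boxes go into the k x k square and its two strips of size k x s; the other m are distributed in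
   proportion to w. *)
pose m := (n - K)%N.
have mE : n%:R = m%:R + K%:R :> R by rewrite -natrD subnK.
pose A j := Num.truncn (w.1 j * m%:R); pose B j := Num.truncn (w.2 j * m%:R).
have wpos := Omega_ge0 Ow.
have posA j : 0 <= w.1 j * m%:R by rewrite mulr_ge0 //; case: (wpos j).
have posB j : 0 <= w.2 j * m%:R by rewrite mulr_ge0 //; case: (wpos j).
have decA j : (A j.+1 <= A j)%N.
  by apply: le_truncn; rewrite ler_wpM2r //; case: Ow => _ [dec _]; case: (dec j).
have decB j : (B j.+1 <= B j)%N.
  by apply: le_truncn; rewrite ler_wpM2r //; case: Ow => _ [dec _]; case: (dec j).
have ABm : (\sum_(j < k) A j + \sum_(j < k) B j <= m)%N.
  rewrite -(ler_nat R) natrD !natr_sum -big_split /=.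
  apply: (@le_trans _ _ (\sum_(j < k) (w.1 j + w.2 j) * m%:R)).
    by apply: ler_sum => j _; rewrite mulrDl lerD // truncn_le.
  by rewrite -mulr_suml ler_piMl //; case: Ow => _ [_ ->].
pose T := (m - (\sum_(j < k) A j + \sum_(j < k) B j))%N.
have Ts : (T <= s * s)%N by apply: leq_trans ns; rewrite /T /m; lia.
have [lam lamY lamP] := @shape_exists k s T A B decA decB n Ts ltac:(rewrite /T /m -/K; lia).
exists lam => // i ik; have [id ai bi] := lamP i ik.
have n0 : 0 < n%:R :> R.
  by rewrite ltr0n; move: Cn s0; rewrite mulnDl; lia.
have key (a : R) (x : nat) : 0 <= a <= 1 -> x = Num.truncn (a * m%:R) ->
   `|a - ((k + s + x)%:R - i%:R - 2^-1) / n%:R| < d.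
  move=> /andP[a0 a1] xE; have am : 0 <= a * m%:R by rewrite mulr_ge0.
  have x1 : x%:R <= a * m%:R by rewrite xE truncn_le.
  have x2 : a * m%:R < x%:R + 1 by rewrite natr1 xE truncnS_gt.
  have -> : a - ((k + s + x)%:R - i%:R - 2^-1) / n%:R =
      (a * n%:R - ((k + s + x)%:R - i%:R - 2^-1)) / n%:R.
    by rewrite [RHS]mulrBl mulfK // gt_eqF.
  rewrite normrM normfV (gtr0_norm n0) ltr_pdivrMr //.
  apply: lt_trans Cs; apply: (@lt_le_trans _ _ (K + k + s + 1)%:R); last by rewrite ler_nat.
  have i0 : 0 <= i%:R :> R by [].
  have ik' : i%:R + 1 <= k%:R :> R by rewrite natr1 ler_nat.
  have s0' : 0 <= s%:R :> R by [].
  have aK : 0 <= a * K%:R <= K%:R by rewrite mulr_ge0 //= ler_piMl.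
  have -> : (K + k + s + 1)%:R = K%:R + k%:R + s%:R + 1 :> R by rewrite !(natrD _ (_ + _)) natrD.
  have -> : (k + s + x)%:R = k%:R + s%:R + x%:R :> R by rewrite !natrD.
  rewrite mE mulrDr ltr_norml; case/andP: aK => aK1 aK2.
  by apply/andP; split; move: x1 x2 i0 ik' s0' aK1 aK2; move: (a * K%:R) (a * m%:R) (K%:R : R) => aK am' K'; clear; lra.
split.
  rewrite iotaY1 id /frob_a ai; apply: key => //.
  by have [-> _] := wpos i; rewrite Omega_le1.
rewrite iotaY2 id /frob_b bi; apply: key => //.
by have [_ ->] := wpos i; apply: (Omega_le1 i (Omega_swap Ow)).
Qed.

End DensityOmega.

(** * The limit operator and its eigenfunctions *)

Section Generator.
Variables (R : realType) (z z' : R[i]).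
Hypothesis Hzz : admissible z z'.
Implicit Types (lam mu nu rho : seq nat) (f g h : Th R -> R) (w : Th R).

Notation spanY := (span (is_partition : seq nat -> Prop) (@diag_psum_prod R)).
Notation spanO := (span (Omega R) (@pOrho R)).
Notation T := (Tn z z').
Notation theta := (zz_prod z z').

Lemma eq_Tn n (u v : seq nat -> R) lam : (forall mu, mu \in Yn n -> u mu = v mu) ->
  T n u lam = T n v lam.
Proof.
move=> E; apply: eq_bigr => nu _; congr (_ * _).
by rewrite big_seq [RHS]big_seq; apply: eq_bigr => mu /E ->.
Qed.

Lemma Tn_linear n a b (u v : seq nat -> R) lam :
  T n (fun mu => a * u mu + b * v mu) lam = a * T n u lam + b * T n v lam.
Proof.
rewrite /Tn !mulr_sumr -big_split; apply: eq_bigr => nu _ /=.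
have -> : \sum_(lt <- Yn n) p_down R nu lt * (a * u lt + b * v lt) =
  a * \sum_(lt <- Yn n) p_down R nu lt * u lt + b * \sum_(lt <- Yn n) p_down R nu lt * v lt.
  by rewrite !mulr_sumr -big_split; apply: eq_bigr => mu _ /=; ring.
by ring.
Qed.

Lemma Tn_ge0 n (u : seq nat -> R) lam : (forall mu, mu \in Yn n -> 0 <= u mu) ->
  lam \in Yn n -> 0 <= T n u lam.
Proof.
move=> u0 lamY; apply: sumr_ge0 => nu _; apply: mulr_ge0; first exact: p_up_ge0.
by rewrite big_seq; apply: sumr_ge0 => mu muY; rewrite mulr_ge0 ?p_down_ge0 ?u0.
Qed.

Lemma Tn_cst n c lam : lam \in Yn n -> T n (fun _ => c) lam = c.
Proof.
move=> lamY; rewrite /Tn -[RHS]mul1r -[in RHS](up_sum1 Hzz lamY) mulr_suml.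
rewrite big_seq [RHS]big_seq; apply: eq_bigr => nu nuY; congr (_ * _).
by rewrite -mulr_suml down_sum1 // mul1r.
Qed.

Lemma Tn_bound n (u : seq nat -> R) C lam : (forall mu, mu \in Yn n -> `|u mu| <= C) ->
  lam \in Yn n -> `|T n u lam| <= C.
Proof.
move=> uC lamY; rewrite ler_norml; apply/andP; split; rewrite -subr_ge0.
  have <- : T n (fun mu => 1 * u mu + 1 * C) lam = T n u lam - - C.
    by rewrite Tn_linear Tn_cst // !mul1r opprK.
  apply: Tn_ge0 => // mu /uC; rewrite ler_norml => /andP[? _].
  by rewrite !mul1r; lra.
have <- : T n (fun mu => 1 * C + (-1) * u mu) lam = C - T n u lam.
  by rewrite (Tn_linear _ _ _ (fun _ => C)) Tn_cst // !mul1r mulN1r.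
apply: Tn_ge0 => // mu /uC; rewrite ler_norml => /andP[_ ?].
by rewrite mul1r; lra.
Qed.

Lemma eq_iter_Tn n k (u v : seq nat -> R) : (forall mu, mu \in Yn n -> u mu = v mu) ->
  forall mu, mu \in Yn n -> iter k (T n) u mu = iter k (T n) v mu.
Proof. by move=> E; elim: k => //= k IH mu muY; apply: eq_Tn. Qed.

Lemma iter_Tn_linear n k a b (u v : seq nat -> R) lam : lam \in Yn n ->
  iter k (T n) (fun mu => a * u mu + b * v mu) lam =
  a * iter k (T n) u lam + b * iter k (T n) v lam.
Proof.
elim: k lam => //= k IH lam lamY; rewrite -Tn_linear.
by apply: eq_Tn => mu muY; rewrite IH.
Qed.

Lemma iter_Tn_bound n k (u : seq nat -> R) C : (forall mu, mu \in Yn n -> `|u mu| <= C) ->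
  forall mu, mu \in Yn n -> `|iter k (T n) u mu| <= C.
Proof. by move=> uC; elim: k => //= k IH mu; apply: Tn_bound. Qed.

Lemma iter_Tn_ge0 n k (u : seq nat -> R) : (forall mu, mu \in Yn n -> 0 <= u mu) ->
  forall mu, mu \in Yn n -> 0 <= iter k (T n) u mu.
Proof. by move=> uC; elim: k => //= k IH mu; apply: Tn_ge0. Qed.

Lemma iter_Tn_cst n k c : forall mu, mu \in Yn n -> iter k (T n) (fun _ => c) mu = c.
Proof.
elim: k => //= k IH mu muY; rewrite (eq_Tn (v := fun _ => c)) //.
exact: Tn_cst.
Qed.

Definition ucvg (hn : nat -> Th R -> R) h : Prop := forall e, 0 < e ->
  exists N, forall n, (N <= n)%N -> forall w, Omega R w -> `|hn n w - h w| <= e.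

(** Trotter's convergence along the varying spaces C(Y_n). *)
Definition ulim (G : nat -> seq nat -> R) g : Prop := forall e, 0 < e ->
  exists N, forall n, (N <= n)%N -> forall lam, lam \in Yn n -> `|G n lam - piY n g lam| <= e.

(* The points of iota_n(Y_n) eventually fill Omega. *)
Lemma dense_le g C : contO g ->
  (forall e, 0 < e -> exists N, forall n, (N <= n)%N ->
     forall lam, lam \in Yn n -> piY n g lam <= C + e) ->
  forall w, Omega R w -> g w <= C.
Proof.
move=> cg H w Ow; apply/ler_addgt0Pr => e e0; have e20 : 0 < e / 2 by rewrite divr_gt0.
have [k [d d0 Hd]] := cg w Ow _ e20; have [N1 H1] := iotaY_dense k Ow d0.
have [N2 H2] := H _ e20.
have [lam lamY nl] := H1 (maxn N1 N2) (leq_maxl _ _).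
have := H2 _ (leq_maxr N1 N2) lam lamY; rewrite /piY.
have := Hd _ (iotaY_Omega R lamY) nl.
by rewrite ltr_norml => /andP[_ +]; lra.
Qed.

Lemma ulim_le G g C : contO g -> ulim G g ->
  (forall e, 0 < e -> exists N, forall n, (N <= n)%N ->
     forall lam, lam \in Yn n -> G n lam <= C + e) ->
  forall w, Omega R w -> g w <= C.
Proof.
move=> cg lg H; apply: dense_le => // e e0; have e20 : 0 < e / 2 by rewrite divr_gt0.
have [N1 H1] := lg _ e20; have [N2 H2] := H _ e20.
exists (maxn N1 N2) => n; rewrite geq_max => /andP[n1 n2] lam lamY.
have := H1 n n1 lam lamY; have := H2 n n2 lam lamY.
by rewrite ler_norml => ? /andP[? ?]; lra.
Qed.

Lemma ulim_linear G G' g g' a b : ulim G g -> ulim G' g' ->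
  ulim (fun n lam => a * G n lam + b * G' n lam) (fun w => a * g w + b * g' w).
Proof.
move=> lg lg' e e0; have eC0 := lin_eps_gt0 a b e0.
have [N1 H1] := lg _ eC0; have [N2 H2] := lg' _ eC0.
exists (maxn N1 N2) => n; rewrite geq_max => /andP[n1 n2] lam lamY.
have h1 := H1 n n1 lam lamY; have h2 := H2 n n2 lam lamY; rewrite /piY in h1 h2 *.
have -> : a * G n lam + b * G' n lam - (a * g (iotaY R n lam) + b * g' (iotaY R n lam)) =
  a * (G n lam - g (iotaY R n lam)) + b * (G' n lam - g' (iotaY R n lam)) by ring.
exact: lin_eps.
Qed.

Lemma eq_ulim G G' g g' :
  (forall n lam, lam \in Yn n -> G n lam = G' n lam) ->
  (forall w, Omega R w -> g w = g' w) -> ulim G g -> ulim G' g'.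
Proof.
move=> EG Eg lg e /lg[N H]; exists N => n Nn lam lamY.
rewrite -EG // /piY -Eg; first exact: H.
exact: iotaY_Omega.
Qed.

Lemma ulim_uniq G g g' : contO g -> contO g' -> ulim G g -> ulim G g' ->
  forall w, Omega R w -> g w = g' w.
Proof.
move=> cg cg' lg lg' w Ow; apply/eqP; rewrite eq_le -subr_le0 -[X in _ && X]subr_le0.
have K h h' : contO h -> contO h' -> ulim G h -> ulim G h' -> h w - h' w <= 0.
  move=> ch ch' lh lh'; apply: (ulim_le (contOB ch ch') (G := fun _ _ => 0)) => //.
    apply: eq_ulim (ulim_linear 1 (-1) lh lh').
      by move=> n lam _; rewrite mulN1r mul1r subrr.
    by move=> w' _; rewrite mulN1r mul1r.
  by move=> e e0; exists 0%N => n _ lam _; rewrite add0r ltW.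
by rewrite !K.
Qed.

Lemma ucvg_linear hn h hn' h' (a b : nat -> R) (a0 b0 : R) : contO h -> contO h' ->
  ucvg hn h -> ucvg hn' h' -> a @ \oo --> a0 -> b @ \oo --> b0 ->
  ucvg (fun n w => a n * hn n w + b n * hn' n w) (fun w => a0 * h w + b0 * h' w).
Proof.
suff S hn1 h1 (c : nat -> R) (c0 : R) : contO h1 -> ucvg hn1 h1 -> c @ \oo --> c0 ->
    ucvg (fun n w => c n * hn1 n w) (fun w => c0 * h1 w).
  move=> ch ch' uh uh' ca cb e e0; have e20 : 0 < e / 2 by rewrite divr_gt0.
  have [N1 H1] := S _ _ _ _ ch uh ca _ e20; have [N2 H2] := S _ _ _ _ ch' uh' cb _ e20.
  exists (maxn N1 N2) => n; rewrite geq_max => /andP[n1 n2] w Ow.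
  have -> : a n * hn n w + b n * hn' n w - (a0 * h w + b0 * h' w) =
    (a n * hn n w - a0 * h w) + (b n * hn' n w - b0 * h' w) by ring.
  apply: le_trans (ler_normD _ _) _; rewrite (splitr e).
  by apply: lerD; [apply: H1 | apply: H2].
move=> ch uh /cvgn_leP cc e e0; have [C C0 HC] := contO_bounded ch.
pose D := C + `|c0| + 1.
have D0 : 0 < D by rewrite /D; have := normr_ge0 c0; lra.
pose d := Num.min 1 (e / D).
have d0 : 0 < d by rewrite lt_min ltr01 divr_gt0.
have [N1 H1] := uh _ d0; have [N2 H2] := cc _ d0.
exists (maxn N1 N2) => n; rewrite geq_max => /andP[n1 n2] w Ow.
have h2 := H2 n n2; have h1' := H1 n n1 w Ow.
have -> : c n * hn1 n w - c0 * h1 w = (c n - c0) * (hn1 n w - h1 w) +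
   (c n - c0) * h1 w + c0 * (hn1 n w - h1 w) by ring.
apply: le_trans (ler_normD _ _) _; apply: le_trans (lerD (ler_normD _ _) (lexx _)) _.
rewrite !normrM.
have d1 : d <= 1 by rewrite ge_min lexx.
have dD : d * D <= e by rewrite -ler_pdivlMr // ge_min lexx orbT.
have p1 : `|c n - c0| * `|hn1 n w - h1 w| <= 1 * d.
  by apply: ler_pM => //; apply: le_trans h2 _.
have p2 : `|c n - c0| * `|h1 w| <= d * C by apply: ler_pM => //; apply: HC.
have p3 : `|c0| * `|hn1 n w - h1 w| <= `|c0| * d by rewrite ler_wpM2l.
by move: p1 p2 p3 dD; rewrite /D; nra.
Qed.

Lemma ucvg_cst h : ucvg (fun _ => h) h.
Proof. by move=> e e0; exists 0%N => n _ w _; rewrite subrr normr0 ltW. Qed.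

Lemma ratio_cvg (c : R) : 0 <= c -> (fun n : nat => n%:R / (c + n%:R)) @ \oo --> (1 : R).
Proof.
move=> c0; apply/cvgn_leP => e e0.
pose N := (Num.truncn (c / e)).+1.
have NP : c / e < N%:R by exact: truncnS_gt.
exists N => n Nn; have Nn' : N%:R <= n%:R :> R by rewrite ler_nat.
have n0 : 0 < n%:R :> R by apply: lt_le_trans Nn'; rewrite ltr0n.
have cn : 0 < c + n%:R by rewrite ltr_wpDl.
have -> : n%:R / (c + n%:R) - 1 = - (c / (c + n%:R)) by field; rewrite gt_eqF.
rewrite normrN ger0_norm; last by rewrite divr_ge0 // ltW.
rewrite ler_pdivrMr //.
by move: NP; rewrite ltr_pdivrMr // => NP; nra.
Qed.

Lemma ratio_cvg1 : (fun n : nat => n%:R / n.+1%:R) @ \oo --> (1 : R).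
Proof.
have -> : (fun n : nat => n%:R / n.+1%:R) = (fun n : nat => n%:R / (1 + n%:R)) :> (nat -> R).
  by apply/funext => n; rewrite -natr1 addrC.
exact: ratio_cvg.
Qed.

Lemma ratio_cvg0 (c : R) : 0 <= c ->
  (fun n : nat => (n%:R / (c + n%:R)) * n.+1%:R^-1) @ \oo --> (0 : R).
Proof.
move=> c0; rewrite -[X in _ --> X](mulr0 1); apply: cvgM; first exact: ratio_cvg.
exact: cvg_harmonic.
Qed.

(** A term of weight M < d gets the coefficient n^(M+1-d), which tends to 1 for M = d - 1 and to 0
    otherwise. The extra n is the half of n^2 left after one denominator is absorbed. *)
Lemma scaled_span d G : spanY d G -> exists hn h,
  [/\ forall n, spanO d (hn n), spanO d h, ucvg hn h &
   forall n lam, (0 < n)%N -> lam \in Yn n ->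
     G lam * n%:R / n%:R ^+ d = hn n (iotaY R n lam)].
Proof.
elim=> {G} [G H|G c rho G' prho ltd _ [hn [h [sn s u E]]] H].
  exists (fun _ _ => 0), (fun _ => 0); split.
  - by move=> n; exact: span0.
  - exact: span0.
  - exact: ucvg_cst.
  by move=> n lam _; rewrite mem_Yn => /andP[plam _]; rewrite H // !mul0r.
pose M := sumn rho; pose a n : R := n%:R ^+ M.+1 / n%:R ^+ d.
have [a0 ca] : exists a0 : R, a @ \oo --> a0.
  move: ltd; rewrite -/M leq_eqVlt => /predU1P[E'|lt].
    exists 1; apply/cvgn_leP => e e0; exists 1%N => n n0.
    by rewrite /a E' mulfV ?subrr ?normr0 ?ltW // expf_neq0 // pnatr_eq0 -lt0n.
  exists 0; apply/cvgn_leP => e e0; have [N HN] := inv_small e0.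
  exists N.+1 => -[//|n] /ltnSE /HN; apply: le_trans; rewrite subr0.
  have n0 : 0 < n.+1%:R :> R by rewrite ltr0n.
  rewrite /a ger0_norm ?divr_ge0 ?exprn_ge0 // ler_pdivrMr ?exprn_gt0 //.
  rewrite -(subnKC lt) exprD [X in _ * (X * _)]exprS mulrA mulrA mulVf ?gt_eqF // mul1r.
  by rewrite ler_peMr ?exprn_ge0 // exprn_ege1 // ler1n.
exists (fun n w => (a n * c) * pOrho rho w + 1 * hn n w), (fun w => (a0 * c) * pOrho rho w + 1 * h w).
have sP : spanO d (@pOrho R rho) by apply: span_gen.
split.
- by move=> n; apply: spanD; apply: spanZ.
- by apply: spanD; apply: spanZ.
- apply: (ucvg_linear (contO_pOrho prho) (contO_span s) (ucvg_cst _) u).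
    by apply: cvgM => //; apply: cvg_cst.
  exact: cvg_cst.
move=> n lam n0 lamY; have plam := Yn_partition lamY.
have n0' : n%:R != 0 :> R by rewrite pnatr_eq0 -lt0n.
rewrite mul1r -E // H // pOrho_iotaY // -/M /a exprS.
by field; rewrite !expf_neq0.
Qed.

Definition eig (d : nat) : R := d%:R * (d%:R - 1 + theta).

(** The difference of neighbours is 2 d + zz', and zz' > 0. Distinctness is what allows the division
    in [eigen_decomposition]. *)
Lemma eig_lt i j : (i < j)%N -> eig i < eig j.
Proof.
move=> ij; have th := zz_prod_gt0 Hzz; rewrite /eig.
case: j ij => // j; rewrite ltnS => ij; have ij' : i%:R <= j%:R :> R by rewrite ler_nat.
rewrite -[j.+1%:R]natr1; have i0 : 0 <= i%:R :> R by [].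
have [->|i1] := posnP i; first by rewrite mul0r mulr_gt0 //; have : 0 <= j%:R :> R by []; lra.
have : 1 <= i%:R :> R by rewrite ler1n.
by nra.
Qed.

Lemma eig_ge0 j : 0 <= eig j.
Proof.
case: j => [|j]; first by rewrite /eig mul0r.
by apply: le_trans (ltW (eig_lt (ltn0Sn j))); rewrite /eig mul0r.
Qed.

Definition scaled_gen n f lam : R := n%:R ^+ 2 * (T n (piY n f) lam - piY n f lam).

Lemma scaled_gen_linear n a b f g lam :
  scaled_gen n (fun w => a * f w + b * g w) lam = a * scaled_gen n f lam + b * scaled_gen n g lam.
Proof.
rewrite /scaled_gen (_ : T n _ _ = T n (fun mu => a * piY n f mu + b * piY n g mu) lam) //.
by rewrite Tn_linear /piY; ring.
Qed.

Lemma eq_scaled_gen n f g lam : (forall w, Omega R w -> f w = g w) -> lam \in Yn n ->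
  scaled_gen n f lam = scaled_gen n g lam.
Proof.
move=> E lamY; rewrite /scaled_gen (eq_Tn (v := piY n g)).
  by rewrite /piY E //; apply: iotaY_Omega.
by move=> mu muY; rewrite /piY E //; apply: iotaY_Omega.
Qed.

(** In the notation of [Tn_prod], F1 and F2 have one denominator each and survive in the limit
    through coefficients tending to 1, while F3 has two and disappears. *)
Lemma gen_prod rho : is_partition rho -> let M := sumn rho in
  exists hn g, [/\ forall n, spanO M.+1 (hn n), spanO M g,
    ucvg hn (fun w => - eig M * pOrho rho w + g w) &
    forall n lam, (0 < n)%N -> lam \in Yn n ->
      scaled_gen n (@pOrho R rho) lam = hn n (iotaY R n lam)].
Proof.
move=> prho M; have th := zz_prod_gt0 Hzz.
have [F1 [F2 [F3 [s1 s2 s3 E]]]] := Tn_prod Hzz prho.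
have [h1n [h1 [s1n s1' u1 E1]]] := scaled_span s1.
have [h2n [h2 [s2n s2' u2 E2]]] := scaled_span s2.
have [h3n [h3 [s3n s3' u3 E3]]] := scaled_span s3.
pose a (n : nat) : R := n%:R / (theta + n%:R).
pose b (n : nat) : R := n%:R / n.+1%:R.
pose c (n : nat) : R := a n * n.+1%:R^-1.
have ca : a @ \oo --> (1 : R) by apply: ratio_cvg; apply: ltW.
have cb : b @ \oo --> (1 : R) by apply: ratio_cvg1.
have cc : c @ \oo --> (0 : R) by apply: ratio_cvg0; apply: ltW.
exists (fun n w => 1 * ((- eig M * (a n * b n)) * pOrho rho w + a n * h1n n w) +
                   1 * (b n * h2n n w + c n * h3n n w)).
exists (fun w => h1 w + h2 w).
have sP : spanO M.+1 (@pOrho R rho) by apply: span_gen.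
have up f : spanO M f -> spanO M.+1 f by apply: span_le.
split.
- move=> n; apply: spanD; apply: spanZ; apply: spanD; apply: spanZ => //; exact: up.
- exact: spanD.
- have c1 := contO_span s1'; have c2 := contO_span s2'; have c3 := contO_span s3'.
  have cP := contO_pOrho prho : contO (@pOrho R rho).
  have cE : (fun n => - eig M * (a n * b n)) @ \oo --> - eig M * (1 * 1).
    by apply: cvgM; [apply: cvg_cst | apply: cvgM].
  have U1 := ucvg_linear cP c1 (@ucvg_cst _) u1 cE ca.
  have U2 := ucvg_linear c2 c3 u2 u3 cb cc.
  have cst1 : (fun _ : nat => 1 : R) @ \oo --> (1 : R) by exact: cvg_cst.
  have U := ucvg_linear (contOD (contOZ _ cP) (contOZ _ c1)) (contOD (contOZ _ c2) (contOZ _ c3)) U1 U2 cst1 cst1.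
  move=> e /U[N HN]; exists N => n Nn w Ow; have := HN n Nn w Ow.
  by congr (`| _ - _ | <= e); ring.
move=> n lam n0 lamY; have n0' : n%:R != 0 :> R by rewrite pnatr_eq0 -lt0n.
have d1 : theta + n%:R != 0 by rewrite gt_eqF // zz_den_gt0.
have d2 : n.+1%:R != 0 :> R by rewrite pnatr_eq0.
have dM : n%:R ^+ M != 0 :> R by rewrite expf_neq0.
have -> : scaled_gen n (@pOrho R rho) lam =
   n%:R ^+ 2 * ((T n (diag_psum_prod R rho) lam - diag_psum_prod R rho lam) / n%:R ^+ M).
  rewrite /scaled_gen; congr (_ * _).
  rewrite (eq_Tn (v := fun mu => (n%:R ^+ M)^-1 * diag_psum_prod R rho mu + 0 * 0)).
    rewrite Tn_linear /piY pOrho_iotaY // -/M; ring.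
  by move=> mu muY; rewrite /piY pOrho_iotaY // mul0r addr0 mulrC.
rewrite E // pOrho_iotaY // -E1 // -E2 // -E3 // -/M /eig /c /a /b.
move: d2; move: (n.+1%:R) => n1 d2.
by field; rewrite ?d1 ?d2 ?dM ?n0'.
Qed.

Lemma gen_span d f : spanO d f -> exists hn h,
  [/\ forall n, spanO d (hn n), spanO d h, ucvg hn h &
   forall n lam, (0 < n)%N -> lam \in Yn n -> scaled_gen n f lam = hn n (iotaY R n lam)].
Proof.
elim=> {f} [f H|f c rho f' prho ltd _ [hn [h [sn s u E]]] H].
  exists (fun _ _ => 0), (fun _ => 0); split.
  - by move=> n; exact: span0.
  - exact: span0.
  - exact: ucvg_cst.
  move=> n lam _ lamY; rewrite (@eq_scaled_gen _ _ (fun w => 0 * f w + 0 * f w)) //.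
    by rewrite scaled_gen_linear !mul0r addr0.
  by move=> w Ow; rewrite H // !mulr0 addr0.
have [kn [g [skn sg ug Eg]]] := gen_prod prho.
have sP : spanO d (@pOrho R rho) by apply: span_gen.
have sg' := span_le (ltnW ltd) sg.
have cst (x : R) : (fun _ : nat => x) @ \oo --> x by exact: cvg_cst.
exists (fun n w => c * kn n w + 1 * hn n w),
  (fun w => c * (- eig (sumn rho) * pOrho rho w + g w) + 1 * h w); split.
- by move=> n; apply: spanD; apply: spanZ => //; apply: span_le (skn n).
- by apply: spanD; apply: spanZ => //; apply: spanD => //; apply: spanZ.
- apply: (ucvg_linear _ (contO_span s) ug u (cst c) (cst 1)).
  apply: contOD; last exact: contO_span sg.
  by apply: contOZ; apply: contO_pOrho.
move=> n lam n0 lamY; rewrite (@eq_scaled_gen _ _ (fun w => c * pOrho rho w + 1 * f' w)) //.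
  by rewrite scaled_gen_linear Eg // E.
by move=> w Ow; rewrite H // mul1r.
Qed.

Definition is_gen f g : Prop := ulim (fun n => scaled_gen n f) g.

Lemma ulim_ucvg G hn h :
  (forall n lam, (0 < n)%N -> lam \in Yn n -> G n lam = hn n (iotaY R n lam)) ->
  ucvg hn h -> ulim G h.
Proof.
move=> E u e /u[N HN]; exists (maxn N 1) => n; rewrite geq_max => /andP[Nn n0] lam lamY.
by rewrite E // /piY; apply: HN => //; apply: iotaY_Omega.
Qed.

Lemma is_gen_linear f f' g g' a b : is_gen f g -> is_gen f' g' ->
  is_gen (fun w => a * f w + b * f' w) (fun w => a * g w + b * g' w).
Proof.
move=> G G'; apply: eq_ulim (ulim_linear a b G G') => // n lam _.
by rewrite scaled_gen_linear.
Qed.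

Lemma eq_is_gen f f' g g' : (forall w, Omega R w -> f w = f' w) ->
  (forall w, Omega R w -> g w = g' w) -> is_gen f g -> is_gen f' g'.
Proof. by move=> E E'; apply: eq_ulim => // n lam; apply: eq_scaled_gen. Qed.

Lemma is_gen0 : is_gen (fun _ => 0) (fun _ => 0).
Proof.
apply: (@eq_is_gen (fun w => 0 * 1 + 0 * 1) _ (fun _ => 0)) => // [w _|].
  by rewrite !mul0r addr0.
move=> e e0; exists 0%N => n _ lam _; rewrite (scaled_gen_linear _ _ _ (fun _ => 1) (fun _ => 1)) /piY.
by rewrite !mul0r addr0 subr0 normr0 ltW.
Qed.

(** Zero counts as an eigenfunction, so one slot per degree j is enough. *)
Definition eigen_sum d f (fs : nat -> Th R -> R) : Prop :=
  (forall j, LamO (fs j) /\ is_gen (fs j) (fun w => - eig j * fs j w)) /\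
  (forall w, Omega R w -> f w = \sum_(j < d) fs j w).

Lemma eigen_sum_linear d f f' fs fs' a b : eigen_sum d f fs -> eigen_sum d f' fs' ->
  eigen_sum d (fun w => a * f w + b * f' w) (fun j w => a * fs j w + b * fs' j w).
Proof.
move=> [H1 E1] [H2 E2]; split.
  move=> j; have [L1 G1] := H1 j; have [L2 G2] := H2 j; split.
    by apply: LamOD; apply: LamOZ.
  by apply: eq_is_gen (is_gen_linear a b G1 G2) => // w _; ring.
by move=> w Ow; rewrite E1 // E2 // !mulr_sumr -big_split.
Qed.

Lemma eigen_sum0 d : eigen_sum d (fun _ => 0) (fun _ _ => 0).
Proof.
split; last by move=> w _; rewrite big1.
move=> j; split; first exact: LamO_cst.
by apply: eq_is_gen is_gen0 => // w _; rewrite mulr0.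
Qed.

Lemma eigen_sum_widen d e f fs : (d <= e)%N -> eigen_sum d f fs ->
  eigen_sum e f (fun j => if (j < d)%N then fs j else (fun _ => 0)).
Proof.
move=> de [H E]; split.
  move=> j; case: ifP => _; first exact: H.
  by have [+ _] := eigen_sum0 d; move=> /(_ j).
move=> w Ow; rewrite E // (big_ord_widen e (fun j => fs j w) de) big_mkcond.
by apply: eq_bigr => j _; case: ifP.
Qed.

Lemma eigen_decomposition d f : spanO d f -> exists fs, eigen_sum d f fs.
Proof.
elim: d f => [|d IHd] f.
  move=> /span_lt0 H; exists (fun _ _ => 0); have [H1 _] := eigen_sum0 0; split=> //.
  by move=> w Ow; rewrite big_ord0 H.
elim=> {f} [f H|f c rho f' prho ltd _ [fs' D'] H].
  exists (fun _ _ => 0); have [H1 H2] := eigen_sum0 d.+1; split=> // w Ow.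
  by rewrite H //; exact: (H2 w Ow).
suff [fs D] : exists fs, eigen_sum d.+1 (@pOrho R rho) fs.
  exists (fun j w => c * fs j w + 1 * fs' j w).
  have [H1 H2] := eigen_sum_linear c 1 D D'; split=> // w Ow.
  by rewrite H // -H2 // mul1r.
move: ltd; rewrite ltnS leq_eqVlt => /predU1P[sE|lt]; last first.
  have [fs D] := IHd _ (span_gen (Omega R) (@pOrho R) prho lt).
  by exists (fun j => if (j < d)%N then fs j else (fun _ => 0)); apply: eigen_sum_widen D.
have [hn [g [_ sg ug E]]] := gen_prod prho; rewrite sE in sg ug.
have G := ulim_ucvg E ug : is_gen _ _.
have [gs [Hg Eg]] := IHd g sg.
(* For e = p_rho + sum x_j g_j, the g_j component of A e = - eig d e reads 1 - x_j eig j = - x_j eig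
   d. *)
pose x j : R := (eig j - eig d)^-1.
have xE j : (j < d)%N -> x j * (eig j - eig d) = 1.
  by move=> jd; rewrite /x mulVf // subr_eq0 lt_eqF // eig_lt.
pose e w := pOrho rho w + \sum_(j < d) x j * gs j w.
have Gs k : is_gen (fun w => \sum_(j < k) x j * gs j w) (fun w => \sum_(j < k) x j * (- eig j * gs j w)).
  elim: k => [|k IHk].
    by apply: eq_is_gen is_gen0 => w _; rewrite big_ord0.
  apply: eq_is_gen (is_gen_linear 1 (x k) IHk (Hg k).2) => w _.
    by rewrite big_ord_recr /= mul1r.
  by rewrite big_ord_recr /= mul1r.
have Ge : is_gen e (fun w => - eig d * e w).
  apply: eq_is_gen (is_gen_linear 1 1 G (Gs d)) => w Ow; rewrite ?mul1r //.
  rewrite Eg // /e mulrDr -addrA; congr (_ + _); rewrite mulr_sumr -big_split.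
  by apply: eq_bigr => j _ /=; rewrite -[X in X + _]mul1r -(xE j (ltn_ord j)); ring.
have Le : LamO e.
  apply: LamOD; first by apply/LamOP; exists d.+1; apply: span_gen; rewrite ?sE.
  have K k : LamO (fun w => \sum_(j < k) x j * gs j w).
    elim: k => [|k IHk].
      by apply: eq_LamO (LamO_cst 0) => w _; rewrite big_ord0.
    apply: eq_LamO (LamOD IHk (LamOZ (x k) (Hg k).1)) => w _.
    by rewrite big_ord_recr.
  exact: K.
exists (fun j => if j == d then e else (fun w => - x j * gs j w)); split.
  move=> j; case: eqP => [->|_]; first by split.
  have [Lj Gj] := Hg j; split; first exact: LamOZ.
  by apply: eq_is_gen (is_gen_linear (- x j) 0 Gj Gj) => w _; rewrite mul0r addr0 //; ring.
move=> w Ow; rewrite big_ord_recr /= eqxx /e.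
have -> : \sum_(i < d) (if i == d :> nat then e else fun w0 => - x i * gs i w0) w =
          - \sum_(i < d) x i * gs i w.
  by rewrite -sumrN; apply: eq_bigr => j _; rewrite ltn_eqF // mulNr.
by rewrite addrC -addrA subrr addr0.
Qed.

End Generator.

(** * The semigroup *)

Section ExpBounds.
Variable R : realType.

(** exp(-x) <= 1 / (1 + x) <= 1 - x + x^2, as (1 - x + x^2)(1 + x) = 1 + x^3. *)
Lemma expRN_err (x : R) : 0 <= x -> 0 <= expR (- x) - 1 + x <= x ^+ 2.
Proof.
move=> x0; have h1 := expR_ge1Dx (- x); apply/andP; split; first by lra.
have h2 := expR_ge1Dx x; have p := expR_gt0 x.
rewrite expRN; set y := expR x in h2 p *.
have y1 : y^-1 * y = 1 by rewrite mulVf // gt_eqF.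
have v0 : 0 <= y^-1 by rewrite invr_ge0 ltW.
have : y^-1 * (1 + x) <= 1 by rewrite -[leRHS]y1 ler_wpM2l.
have [v1|v1] := lerP y^-1 (1 - x + x ^+ 2); first by move=> _; lra.
have : (1 - x + x ^+ 2) * (1 + x) < y^-1 * (1 + x) by rewrite ltr_pM2r //; lra.
have : 0 <= x ^+ 3 by rewrite exprn_ge0.
have -> : (1 - x + x ^+ 2) * (1 + x) = 1 + x ^+ 3 by ring.
by lra.
Qed.

Lemma expRN_lip (a b : R) : 0 <= a <= b -> `|expR (- a) - expR (- b)| <= b - a.
Proof.
move=> /andP[a0 ab]; have h := expR_ge1Dx (a - b).
have -> : expR (- b) = expR (- a) * expR (a - b).
  by rewrite -expRD; congr expR; ring.
have e1 : expR (- a) <= 1 by rewrite expR_le1 oppr_le0.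
have e0 : 0 <= expR (- a) := ltW (expR_gt0 _).
have e2 : expR (a - b) <= 1 by rewrite expR_le1 subr_le0.
have -> : expR (- a) - expR (- a) * expR (a - b) = expR (- a) * (1 - expR (a - b)) by ring.
rewrite ger0_norm ?mulr_ge0 ?subr_ge0 //.
apply: (@le_trans _ _ (1 * (1 - expR (a - b)))); last by lra.
by rewrite ler_wpM2r // subr_ge0.
Qed.

End ExpBounds.

(** * Limits of the iterated chains form a semigroup *)

Section Semigroup.
Variables (R : realType) (z z' : R[i]).
Hypothesis Hzz : admissible z z'.
Implicit Types (f g h : Th R -> R) (w : Th R) (S : R -> Th R -> R).

Notation T := (Tn z z').
Notation eig := (eig z z').
Notation is_gen := (is_gen z z').
Notation eigen_sum := (eigen_sum z z').

Definition steps (n : nat) (t : R) : nat := Num.truncn (n%:R ^+ 2 * t).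

Definition usem f S : Prop := forall t0, 0 <= t0 -> forall e, 0 < e ->
  exists N, forall n, (N <= n)%N -> forall t, 0 <= t <= t0 ->
  forall lam, lam \in Yn n ->
    `|iter (steps n t) (T n) (piY n f) lam - piY n (S t) lam| <= e.

Lemma usem_ulim f S t : 0 <= t -> usem f S ->
  ulim (fun n => iter (steps n t) (T n) (piY n f)) (S t).
Proof.
move=> t0 u e e0; have [N HN] := u t t0 e e0; exists N => n Nn lam lamY.
by apply: HN => //; rewrite t0 lexx.
Qed.

(** One step differs from multiplication by q = exp(-mu / n^2) by an error small against n^-2. As
    T_n is a contraction, the errors of about n^2 t steps merely add up, and q^k is close to exp(-mu
    t). *)
Lemma eigen_usem f mu : 0 <= mu -> LamO f -> is_gen f (fun w => - mu * f w) ->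
  usem f (fun t w => expR (- (mu * t)) * f w).
Proof.
move=> mu0 Lf Gf t0 t00 e e0.
have [C C0 HC] := contO_bounded (contO_LamO Lf).
pose e1 := e / (2 * (t0 + 1)).
have e10 : 0 < e1 by rewrite divr_gt0 // mulr_gt0 // ltr_wpDl.
have [N1 H1] := Gf e1 e10.
(* D collects the errors of order n^-2: the quadratic error of exp over all steps, and the rounding
   of n^2 t to an integer. *)
pose D := t0 * (C * mu ^+ 2) + C * mu.
have D0 : 0 <= D by rewrite addr_ge0 // !mulr_ge0 ?sqr_ge0 // ltW.
have e20 : 0 < e / (2 * (D + 1)) by rewrite divr_gt0 // mulr_gt0 // ltr_wpDl.
have [N2 H2] := inv_small e20.
exists (maxn N1 N2).+1 => -[//|n] /ltnSE; rewrite geq_max => /andP[n1 n2] t /andP[t_ge0 tt0] lam lamY.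
set n' := n.+1 in lamY *; set k := steps n' t.
pose m : R := n'%:R ^+ 2.
have n'0 : 0 < n'%:R :> R by rewrite ltr0n.
have m0 : 0 < m by rewrite exprn_gt0.
have m1 : m^-1 <= e / (2 * (D + 1)).
  apply: le_trans (H2 n n2); rewrite lef_pV2 ?posrE // /m -/n' expr2.
  have n'1 : 1 <= n'%:R :> R by rewrite ler1n.
  by apply: ler_peMr n'1; apply: ltW.
have /andP[k1 k2] := truncn_itv (mulr_ge0 (ltW m0) t_ge0).
rewrite -/(steps n' t) -/k in k1 k2.
pose q := expR (- (mu / m)).
have q0 : 0 <= q := ltW (expR_gt0 _).
have mum0 : 0 <= mu / m by rewrite divr_ge0 // ltW.
have q1 : q <= 1 by rewrite expR_le1 oppr_le0.
pose del := e1 / m + C * (mu / m) ^+ 2.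
have one lam' : lam' \in Yn n' -> `|T n' (piY n' f) lam' - q * piY n' f lam'| <= del.
  move=> lamY'; have := H1 n' (leqW n1) lam' lamY'; rewrite /scaled_gen -/m /piY.
  set a := T _ _ _; set b := f _ => Hab.
  have bC : `|b| <= C by apply: HC; apply: iotaY_Omega.
  have -> : a - q * b = (m * (a - b) - - mu * b) / m - (q - 1 + mu / m) * b.
    by field; rewrite gt_eqF.
  apply: le_trans (ler_normB _ _) _; apply: lerD.
    by rewrite normrM normfV (gtr0_norm m0) ler_pM2r ?invr_gt0.
  have /andP[g0 g1] := expRN_err mum0; rewrite normrM mulrC.
  by apply: ler_pM => //; rewrite ger0_norm.
have del0 : 0 <= del by apply: le_trans (one lam lamY).
have many j : forall lam', lam' \in Yn n' ->
   `|iter j (T n') (piY n' f) lam' - q ^+ j * piY n' f lam'| <= j%:R * del.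
  elim: j => [|j IH] lam' lamY'; first by rewrite /= expr0 mul1r subrr normr0 mul0r.
  rewrite iterS.
  have -> : T n' (iter j (T n') (piY n' f)) lam' - q ^+ j.+1 * piY n' f lam' =
    T n' (fun mu => 1 * iter j (T n') (piY n' f) mu + (- q ^+ j) * piY n' f mu) lam' +
    q ^+ j * (T n' (piY n' f) lam' - q * piY n' f lam').
    by rewrite Tn_linear exprS; ring.
  apply: le_trans (ler_normD _ _) _; rewrite -natr1 mulrDl mul1r; apply: lerD.
    apply: (Tn_bound Hzz) => // mu' muY; have := IH mu' muY.
    by rewrite mul1r mulNr.
  rewrite normrM -[leRHS]mul1r; apply: ler_pM => //; last exact: one.
  by rewrite ger0_norm ?exprn_ge0 // exprn_ile1.
have qk : q ^+ k = expR (- (mu * (k%:R / m))).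
  by rewrite -expRM_natl; congr expR; ring.
have km : k%:R / m <= t by rewrite ler_pdivrMr // mulrC.
have km0 : 0 <= k%:R / m by rewrite divr_ge0 // ltW.
have km2 : t - k%:R / m <= m^-1.
  rewrite lerBlDr -[X in X + _]mul1r -mulrDl ler_pdivlMr // mulrC addrC.
  by rewrite natr1 ltW.
have lip : `|q ^+ k - expR (- (mu * t))| <= mu / m.
  rewrite qk; apply: le_trans (expRN_lip _) _.
    by rewrite mulr_ge0 //= ler_wpM2l.
  by rewrite -mulrBr ler_wpM2l.
have bC : `|piY n' f lam| <= C by apply: HC; apply: iotaY_Omega.
have -> : iter k (T n') (piY n' f) lam - piY n' (fun w => expR (- (mu * t)) * f w) lam =
   (iter k (T n') (piY n' f) lam - q ^+ k * piY n' f lam) +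
   (q ^+ k - expR (- (mu * t))) * piY n' f lam.
  by rewrite /piY; ring.
apply: le_trans (ler_normD _ _) _; rewrite normrM.
have p1 : `|q ^+ k - expR (- (mu * t))| * `|piY n' f lam| <= mu / m * C by apply: ler_pM.
have p2 : k%:R * del <= t0 * e1 + t0 * (C * mu ^+ 2) * m^-1.
  have -> : k%:R * del = (k%:R / m) * (e1 + C * mu ^+ 2 * m^-1).
    by rewrite /del; field; rewrite gt_eqF.
  have -> : t0 * e1 + t0 * (C * mu ^+ 2) * m^-1 = t0 * (e1 + C * mu ^+ 2 * m^-1) by ring.
  rewrite ler_wpM2r ?(le_trans km) //.
  have C0' := ltW C0; have m0' := ltW m0.
  by apply: addr_ge0; [exact: ltW | rewrite !mulr_ge0 ?sqr_ge0 ?invr_ge0].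
have p3 : t0 * e1 <= e / 2.
  have -> : e / 2 = (t0 + 1) * e1.
    by rewrite /e1; field; rewrite gt_eqF // ltr_wpDl.
  by apply: ler_wpM2r; [exact: ltW | rewrite lerDl].
have p4 : D * m^-1 <= e / 2.
  have -> : e / 2 = (D + 1) * (e / (2 * (D + 1))).
    by field; rewrite gt_eqF // ltr_wpDl.
  by apply: ler_pM => //; [rewrite invr_ge0 ltW | rewrite lerDl].
have p5 := many k lam lamY.
apply: le_trans (lerD p5 p1) _.
have p6 : D * m^-1 = t0 * (C * mu ^+ 2) * m^-1 + mu / m * C by rewrite /D; ring.
by lra.
Qed.

Lemma usem_linear f f' S S' a b : usem f S -> usem f' S' ->
  usem (fun w => a * f w + b * f' w) (fun t w => a * S t w + b * S' t w).
Proof.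
move=> u u' t0 t00 e e0; have eC0 := lin_eps_gt0 a b e0.
have [N1 H1] := u _ t00 _ eC0; have [N2 H2] := u' _ t00 _ eC0.
exists (maxn N1 N2) => n; rewrite geq_max => /andP[n1 n2] t tt lam lamY.
have h1 := H1 n n1 t tt lam lamY; have h2 := H2 n n2 t tt lam lamY.
rewrite /piY in h1 h2 *.
rewrite (iter_Tn_linear z z' (steps n t) a b (piY n f) (piY n f') lamY).
set A := iter _ _ _ _ in h1 *; set B := iter _ _ _ _ in h2 *.
have -> : a * A + b * B - (a * S t (iotaY R n lam) + b * S' t (iotaY R n lam)) =
  a * (A - S t (iotaY R n lam)) + b * (B - S' t (iotaY R n lam)) by ring.
exact: lin_eps.
Qed.

Lemma eq_usem f f' S S' : (forall w, Omega R w -> f w = f' w) ->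
  (forall t w, 0 <= t -> Omega R w -> S t w = S' t w) -> usem f S -> usem f' S'.
Proof.
move=> E ES u t0 t00 e e0; have [N HN] := u t0 t00 e e0.
exists N => n Nn t tt lam lamY; have := HN n Nn t tt lam lamY.
have -> : piY n (S t) lam = piY n (S' t) lam.
  by apply: ES; [case/andP: tt | exact: iotaY_Omega].
rewrite (@eq_iter_Tn R z z' n _ (piY n f) (piY n f')) // => mu muY.
by apply: E; apply: iotaY_Omega.
Qed.

Definition flow d (fs : nat -> Th R -> R) (t : R) w : R :=
  \sum_(j < d) expR (- (eig j * t)) * fs j w.

Lemma flow_contO d fs t : (forall j, LamO (fs j)) -> contO (flow d fs t).
Proof. by move=> L; apply: contO_sum => j _; apply: contOZ; apply: contO_LamO. Qed.

Lemma flow_usem d f fs : eigen_sum d f fs -> usem f (flow d fs).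
Proof.
move=> [H E]; apply: (@eq_usem (fun w => \sum_(j < d) fs j w) _ (flow d fs)) => //.
  by move=> w /E.
rewrite /flow; elim: d {f E} => [|d IH].
  have u0 := eigen_usem (lexx 0) (H 0%N).1 (mu := 0).
  move=> t0 _ e e0; exists 0%N => n _ t _ lam lamY.
  rewrite (@eq_iter_Tn R z z' n _ _ (fun _ => 0)) // => [|mu _]; last by rewrite /piY big_ord0.
  by rewrite (iter_Tn_cst Hzz) // /piY big_ord0 subrr normr0 ltW.
have [Ld Gd] := H d.
apply: eq_usem (usem_linear 1 1 IH (eigen_usem (eig_ge0 Hzz d) Ld Gd)) => [w _|t w _ _].
  by rewrite big_ord_recr !mul1r.
by rewrite big_ord_recr !mul1r.
Qed.

Lemma ulim_norm_le G g C : contO g -> ulim G g ->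
  (exists N, forall n, (N <= n)%N -> forall lam, lam \in Yn n -> `|G n lam| <= C) ->
  forall w, Omega R w -> `|g w| <= C.
Proof.
move=> cg lg [N HN] w Ow; rewrite ler_norml; apply/andP; split; last first.
  apply: (ulim_le cg lg) => // e e0; exists N => n Nn lam lamY.
  by have := HN n Nn lam lamY; rewrite ler_norml => /andP[_]; lra.
rewrite lerNl -mulN1r.
have lN : ulim (fun n lam => - G n lam) (fun w => -1 * g w).
  apply: eq_ulim (ulim_linear (-1) 0 lg lg) => [n lam _|w' _]; first by rewrite mul0r addr0 mulN1r.
  by rewrite mul0r addr0.
apply: (ulim_le (contOZ (-1) cg) lN) => // e e0; exists N => n Nn lam lamY.
by have := HN n Nn lam lamY; rewrite ler_norml => /andP[+ _]; lra.
Qed.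

Lemma usem_bound f S t C : 0 <= t -> contO (S t) -> usem f S ->
  (forall w, Omega R w -> `|f w| <= C) -> forall w, Omega R w -> `|S t w| <= C.
Proof.
move=> t0 cS u fC; apply: ulim_norm_le cS (usem_ulim t0 u) _.
exists 0%N => n _ lam lamY; apply: (iter_Tn_bound Hzz) => // mu muY.
by apply: fC; apply: iotaY_Omega.
Qed.

Lemma sem_exists f : contO f -> exists S, (forall t, 0 <= t -> contO (S t)) /\ usem f S.
Proof.
move=> cf.
have /choice[FS HFS] : forall k : nat, exists gS : (Th R -> R) * (R -> Th R -> R),
    [/\ forall w, Omega R w -> `|f w - gS.1 w| <= k.+1%:R^-1,
        forall t, 0 <= t -> contO (gS.2 t) & usem gS.1 gS.2].
  move=> k; have k0 : 0 < k.+1%:R^-1 :> R by rewrite invr_gt0 ltr0n.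
  have [g Lg Hg] := stone_weierstrass cf k0.
  have [d sg] := (LamOP g).1 Lg; have [fs D] := eigen_decomposition Hzz sg.
  exists (g, flow d fs); split=> //=; last exact: flow_usem.
  by move=> t _; apply: flow_contO => j; have [H _] := D; have [] := H j.
pose F k := (FS k).1; pose S_ k := (FS k).2.
have close k l t w : 0 <= t -> Omega R w -> `|S_ k t w - S_ l t w| <= k.+1%:R^-1 + l.+1%:R^-1.
  move=> t0 Ow; have [hk ck uk] := HFS k; have [hl cl ul] := HFS l.
  have := @usem_bound (fun w => 1 * F k w + (-1) * F l w)
    (fun t w => 1 * S_ k t w + (-1) * S_ l t w) t (k.+1%:R^-1 + l.+1%:R^-1) t0 _
    (usem_linear 1 (-1) uk ul) _ w Ow.
  rewrite mul1r mulN1r; apply.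
    by apply: contOD; apply: contOZ; [apply: ck | apply: cl].
  move=> w' Ow'; rewrite mul1r mulN1r.
  have -> : F k w' - F l w' = (f w' - F l w') - (f w' - F k w') by ring.
  apply: le_trans (ler_normB _ _) _; rewrite addrC; apply: lerD; [exact: hk | exact: hl].
(* Since |S_k - S_l| <= 1/(k+1) + 1/(l+1), the supremum of these lower bounds is within 1/(k+1) of
   every S_k: it is the limit. *)
pose S t w := sup [set S_ k t w - k.+1%:R^-1 | k in setT].
have SS k t w : 0 <= t -> Omega R w -> `|S t w - S_ k t w| <= k.+1%:R^-1.
  move=> t0 Ow.
  have ub : ubound [set S_ l t w - l.+1%:R^-1 | l in setT] (S_ k t w + k.+1%:R^-1).
    move=> _ [l _ <-]; have := close l k t w t0 Ow.
    rewrite ler_norml => /andP[_].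
    by move: (l.+1%:R^-1) (k.+1%:R^-1) (S_ l t w) (S_ k t w) => a b c d; clear; lra.
  rewrite ler_norml; apply/andP; split.
    have : S_ k t w - k.+1%:R^-1 <= S t w.
      by apply: ub_le_sup; [exists (S_ k t w + k.+1%:R^-1) | exists k].
    by move: (k.+1%:R^-1) (S t w) (S_ k t w) => a b c; clear; lra.
  rewrite lerBlDr addrC; apply: ge_sup => //.
  by exists (S_ 0%N t w - 1%:R^-1), 0%N.
exists S; split.
  move=> t t0; apply: contO_unif => e e0; have [N HN] := inv_small e0.
  have [_ cN _] := HFS N; exists (S_ N t); first exact: cN.
  by move=> w Ow; apply: le_trans (SS N t w t0 Ow) (HN N (leqnn N)).
move=> t0 t00 e e0; have e30 : 0 < e / 3 by rewrite divr_gt0.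
have [K HK] := inv_small e30; have [hK cK uK] := HFS K.
have {}HK := HK K (leqnn K).
have [N HN] := uK t0 t00 _ e30; exists N => n Nn t tt lam lamY.
have h1 := HN n Nn t tt lam lamY.
have h2 : `|piY n (S t) lam - piY n (S_ K t) lam| <= e / 3.
  by apply: le_trans HK; apply: SS; [case/andP: tt | exact: iotaY_Omega].
have h3 : `|iter (steps n t) (T n) (piY n f) lam - iter (steps n t) (T n) (piY n (F K)) lam| <= e / 3.
  have -> : iter (steps n t) (T n) (piY n f) lam - iter (steps n t) (T n) (piY n (F K)) lam =
     iter (steps n t) (T n) (fun mu => 1 * piY n f mu + (-1) * piY n (F K) mu) lam.
    by rewrite iter_Tn_linear // mul1r mulN1r.
  apply: (iter_Tn_bound Hzz) => // mu muY; rewrite mul1r mulN1r.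
  by apply: le_trans HK; apply: hK; apply: iotaY_Omega.
move: h1 h2 h3; rewrite -/(F K) -/(S_ K) !ler_norml => /andP[? ?] /andP[? ?] /andP[? ?].
by apply/andP; split; lra.
Qed.

(** A choice of limit of the iterates, determined on Omega by [Tsem_uniq]; functions that are not
    continuous are sent to 0. *)
Definition Tsem (t : R) f : Th R -> R :=
  match pselect (contO f) with
  | left cf => projT1 (cid (sem_exists cf)) t
  | right _ => fun _ => 0
  end.

Lemma TsemP f : contO f ->
  (forall t, 0 <= t -> contO (Tsem t f)) /\ usem f (fun t => Tsem t f).
Proof.
move=> cf; have -> : (fun t => Tsem t f) =
    projT1 (cid (sem_exists cf)).
  apply/funext => t; rewrite /Tsem; case: pselect => // cf'.
  by rewrite (Prop_irrelevance cf' cf).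
have E t : Tsem t f = projT1 (cid (sem_exists cf)) t.
  by rewrite /Tsem; case: pselect => // cf'; rewrite (Prop_irrelevance cf' cf).
by have [c u] := projT2 (cid (sem_exists cf)); split=> // t t0; rewrite E; apply: c.
Qed.

Lemma Tsem_contO t f : 0 <= t -> contO f -> contO (Tsem t f).
Proof. by move=> t0 /TsemP[c _]; apply: c. Qed.

Lemma Tsem_usem f : contO f -> usem f (fun t => Tsem t f).
Proof. by case/TsemP. Qed.

(** Any explicit family to which the iterates converge is the semigroup; linearity, constants and
    the formula on Lambda^o all follow from this. *)
Lemma Tsem_uniq f S t w : contO f -> 0 <= t -> contO (S t) -> usem f S -> Omega R w ->
  Tsem t f w = S t w.
Proof.
move=> cf t0 cS u Ow.
exact: (ulim_uniq (Tsem_contO t0 cf) cS (usem_ulim t0 (Tsem_usem cf)) (usem_ulim t0 u)).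
Qed.

Lemma Tsem_linear t a b f g w : 0 <= t -> contO f -> contO g -> Omega R w ->
  Tsem t (fun x => a * f x + b * g x) w = a * Tsem t f w + b * Tsem t g w.
Proof.
move=> t0 cf cg Ow.
apply: (Tsem_uniq (S := fun t w => a * Tsem t f w + b * Tsem t g w)) => //.
- by apply: contOD; apply: contOZ.
- by apply: contOD; apply: contOZ; apply: Tsem_contO.
- by apply: usem_linear; apply: Tsem_usem.
Qed.

Lemma Tsem_bound t f C w : 0 <= t -> contO f -> (forall w, Omega R w -> `|f w| <= C) ->
  Omega R w -> `|Tsem t f w| <= C.
Proof.
by move=> t0 cf fC; apply: (usem_bound (S := fun t => Tsem t f) t0 (Tsem_contO t0 cf) (Tsem_usem cf)).
Qed.

Lemma Tsem_dist t f g C w : 0 <= t -> contO f -> contO g ->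
  (forall w, Omega R w -> `|f w - g w| <= C) -> Omega R w ->
  `|Tsem t f w - Tsem t g w| <= C.
Proof.
move=> t0 cf cg fgC Ow.
have := @Tsem_bound t (fun x => 1 * f x + (-1) * g x) C w t0.
rewrite Tsem_linear // mul1r mulN1r; apply=> //.
  by apply: contOD; apply: contOZ.
by move=> w' Ow'; rewrite mul1r mulN1r; apply: fgC.
Qed.

Lemma eq_Tsem t f g w : 0 <= t -> contO f -> (forall w, Omega R w -> f w = g w) ->
  Omega R w -> Tsem t f w = Tsem t g w.
Proof.
move=> t0 cf E Ow; apply/eqP; rewrite -subr_eq0 -normr_le0.
apply: Tsem_dist => //; first exact: eq_contO cf.
by move=> w' Ow'; rewrite E // subrr normr0.
Qed.

Lemma Tsem_flow d f fs t w : eigen_sum d f fs -> 0 <= t -> Omega R w ->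
  Tsem t f w = flow d fs t w.
Proof.
move=> D t0 Ow; have [H E] := D.
apply: (@Tsem_uniq f (flow d fs) t w) => //; last exact: flow_usem.
  have cs : contO (fun w => \sum_(j < d) fs j w).
    by apply: contO_sum => j _; apply: contO_LamO; have [] := H j.
  by apply: eq_contO cs => w' /E ->.
by apply: flow_contO => j; have [] := H j.
Qed.

Lemma Tsem0 f w : contO f -> Omega R w -> Tsem 0 f w = f w.
Proof.
move=> cf Ow; apply: (ulim_uniq _ cf (usem_ulim (lexx 0) (Tsem_usem cf))) => //.
  exact: Tsem_contO.
move=> e e0; exists 0%N => n _ lam _.
by rewrite /steps mulr0 truncn0 /= subrr normr0 ltW.
Qed.

Lemma Tsem_cst t c w : 0 <= t -> Omega R w -> Tsem t (fun _ => c) w = c.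
Proof.
move=> t0 Ow; apply: (Tsem_uniq (S := fun _ _ => c)) => //; try exact: contO_cst.
move=> t1 _ e e0; exists 0%N => n _ t' _ lam lamY.
by rewrite (@eq_iter_Tn R z z' n _ _ (fun _ => c)) // (iter_Tn_cst Hzz) // /piY subrr normr0 ltW.
Qed.

Lemma Tsem_ge0 t f w : 0 <= t -> contO f -> (forall w, Omega R w -> 0 <= f w) ->
  Omega R w -> 0 <= Tsem t f w.
Proof.
move=> t0 cf f0 Ow; rewrite -oppr_le0 -mulN1r.
have l := usem_ulim t0 (Tsem_usem cf); have c := Tsem_contO t0 cf.
have lN : ulim (fun n lam => - iter (steps n t) (T n) (piY n f) lam) (fun w => -1 * Tsem t f w).
  apply: eq_ulim (ulim_linear (-1) 0 l l) => [n lam _|w' _]; first by rewrite mul0r addr0 mulN1r.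
  by rewrite mul0r addr0.
apply: (ulim_le (contOZ (-1) c) lN) => // e e0; exists 0%N => n _ lam lamY.
rewrite add0r; apply: (@le_trans _ _ 0); last exact: ltW.
rewrite oppr_le0.
apply: (iter_Tn_ge0 Hzz) => // mu muY; apply: f0; exact: iotaY_Omega.
Qed.

Lemma LamO_eigen f : LamO f -> exists d fs, eigen_sum d f fs.
Proof.
by move=> /LamOP[d sf]; have [fs D] := eigen_decomposition Hzz sf; exists d, fs.
Qed.

Lemma flow_eigen d f fs t : eigen_sum d f fs ->
  eigen_sum d (flow d fs t) (fun j w => expR (- (eig j * t)) * fs j w).
Proof.
move=> [H _]; split=> // j; have [L G] := H j; split; first exact: LamOZ.
by apply: eq_is_gen (is_gen_linear (expR (- (eig j * t))) 0 G G) => w _; rewrite mul0r addr0 //; ring.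
Qed.

(** Integer parts of n^2 s and n^2 t do not add up, so the law is read off the exponentials on
    Lambda^o and extended by density and contractivity. *)
Lemma Tsem_semigroup s t f w : 0 <= s -> 0 <= t -> contO f -> Omega R w ->
  Tsem (s + t) f w = Tsem s (Tsem t f) w.
Proof.
move=> s0 t0 cf Ow; have st0 : 0 <= s + t by rewrite addr_ge0.
apply/eqP; rewrite -subr_eq0 -normr_le0; apply/ler_addgt0Pr => e e0; rewrite add0r.
have e20 : 0 < e / 2 by rewrite divr_gt0.
have [g Lg Hg] := stone_weierstrass cf e20; have cg := contO_LamO Lg.
have [d [fs D]] := LamO_eigen Lg.
have h1 := Tsem_dist st0 cf cg Hg Ow.
have h2 : `|Tsem s (Tsem t f) w - Tsem s (Tsem t g) w| <= e / 2.
  apply: Tsem_dist => //; try exact: Tsem_contO.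
  by move=> w' Ow'; apply: Tsem_dist.
have E : Tsem (s + t) g w = Tsem s (Tsem t g) w.
  have -> : Tsem s (Tsem t g) w = Tsem s (flow d fs t) w.
    apply: eq_Tsem => //; first exact: Tsem_contO.
    by move=> w' Ow'; rewrite (Tsem_flow D).
  rewrite (Tsem_flow D) //.
  rewrite (Tsem_flow (flow_eigen t D)) //; apply: eq_bigr => j _.
  by rewrite mulrA -expRD; congr (expR _ * _); ring.
move: h1 h2; rewrite E !ler_norml => /andP[? ?] /andP[? ?].
by apply/andP; split; lra.
Qed.

Lemma Tsem_cont0 f e : contO f -> 0 < e -> exists2 del, 0 < del &
  forall t w, 0 <= t <= del -> Omega R w -> `|Tsem t f w - f w| <= e.
Proof.
move=> cf e0; have e30 : 0 < e / 3 by rewrite divr_gt0.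
have [g Lg Hg] := stone_weierstrass cf e30; have cg := contO_LamO Lg.
have [d [fs D]] := LamO_eigen Lg; have [H E] := D.
have [C C0 HC] : exists2 C, 0 < C & forall w, Omega R w -> \sum_(j < d) eig j * `|fs j w| <= C.
  have cs : forall k, exists2 C, 0 < C & forall w, Omega R w -> \sum_(j < k) eig j * `|fs j w| <= C.
    elim=> [|k [C C0 HC]]; first by exists 1 => // w _; rewrite big_ord0.
    have [C' C'0 HC'] := contO_bounded (contO_LamO (H k).1).
    exists (C + eig k * C'); first by rewrite ltr_wpDr // mulr_ge0 ?(eig_ge0 Hzz) // ltW.
    move=> w Ow; rewrite big_ord_recr; apply: lerD; first exact: HC.
    by rewrite ler_wpM2l ?(eig_ge0 Hzz) //; apply: HC'.
  exact: cs.
exists (e / 3 / C); first by rewrite divr_gt0.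
move=> t w /andP[t0 tC] Ow.
have h1 := Tsem_dist t0 cf cg Hg Ow; have h2 := Hg w Ow.
have h3 : `|Tsem t g w - g w| <= e / 3.
  rewrite (Tsem_flow D) // E // /flow -sumrB; apply: le_trans (ler_norm_sum _ _ _) _.
  apply: (@le_trans _ _ (\sum_(j < d) t * (eig j * `|fs j w|))).
    apply: ler_sum => j _; rewrite -[X in _ - X]mul1r -mulrBl normrM mulrA ler_wpM2r //.
    have := @expRN_lip R 0 (eig j * t); rewrite oppr0 expR0 distrC addr0 => L.
    apply: le_trans (L _) _; last by rewrite mulrC.
    by rewrite lexx mulr_ge0 // (eig_ge0 Hzz).
  rewrite -mulr_sumr; apply: (@le_trans _ _ (t * C)); first by rewrite ler_wpM2l // HC.
  by rewrite -ler_pdivlMr.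
move: h1 h2 h3; rewrite !ler_norml => /andP[? ?] /andP[? ?] /andP[? ?].
by apply/andP; split; lra.
Qed.

Lemma flow_derive d fs w (x : R) :
  is_derive x 1 (fun s => flow d fs s w)
    (\sum_(j < d) - eig j * (expR (- (eig j * x)) * fs j w)).
Proof.
rewrite /flow; elim: d => [|d IH].
  rewrite big_ord0 (_ : (fun s => _) = cst 0); first exact: is_derive_cst.
  by apply/funext => s; rewrite big_ord0.
rewrite big_ord_recr /=.
rewrite (_ : (fun s => _) = (fun s => \sum_(j < d) expR (- (eig j * s)) * fs j w) +
     (fun s => expR (- (eig d * s)) * fs d w)); last first.
  by apply/funext => s; rewrite big_ord_recr.
apply: is_deriveD.
have D1 : is_derive x 1 (fun s : R => - (eig d * s)) (- eig d).
  rewrite (_ : (fun s : R => - (eig d * s)) = (- eig d) \*: id).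
    by apply: is_derive_eq; rewrite /GRing.scale /= mulr1.
  by apply/funext => s; rewrite /= /GRing.scale /= mulNr.
have D2 := @is_derive1_comp R expR _ x _ _ (is_derive_expR _) D1.
rewrite (_ : (fun s => _) = (fs d w) \*: (expR \o (fun s : R => - (eig d * s)))); last first.
  by apply/funext => s; rewrite /= /GRing.scale /= mulrC.
by apply: is_derive_eq; rewrite /GRing.scale /=; ring.
Qed.

(** At fixed w the mean value theorem writes the difference quotient as T(c) A f for some c in (0,
    t). The error thus depends on A f only, which is what passes to the closure. *)
Lemma flow_generator d f fs t w C : eigen_sum d f fs -> 0 < t -> Omega R w ->
  (forall s, 0 <= s <= t ->
     `|Tsem s (fun w => \sum_(j < d) - eig j * fs j w) w - \sum_(j < d) - eig j * fs j w| <= C) ->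
  `|(Tsem t f w - f w) / t - \sum_(j < d) - eig j * fs j w| <= C.
Proof.
move=> D t0 Ow HC; have [H E] := D.
have der (x : R) : x \in `]0, t[%R -> is_derive x 1 (fun s => flow d fs s w)
    (\sum_(j < d) - eig j * (expR (- (eig j * x)) * fs j w)).
  by move=> _; apply: flow_derive.
have cont : {within `[0, t], continuous (fun s => flow d fs s w)}.
  apply: derivable_within_continuous => x _.
  by have [] := flow_derive d fs w x.
have [c ct M] := MVT t0 der cont.
have E0 : flow d fs 0 w = f w.
  by rewrite E // /flow; apply: eq_bigr => j _; rewrite mulr0 oppr0 expR0 mul1r.
rewrite (Tsem_flow D (ltW t0) Ow) -E0 M subr0 mulfK ?gt_eqF //.
have DA : eigen_sum d (fun w => \sum_(j < d) - eig j * fs j w) (fun j w => - eig j * fs j w).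
  split=> // j; have [L G] := H j; split; first exact: LamOZ.
  by apply: eq_is_gen (is_gen_linear (- eig j) 0 G G) => w' _; rewrite mul0r addr0 //; ring.
have {}ct : 0 <= c <= t by move: ct; rewrite in_itv /= => /andP[/ltW -> /ltW ->].
have := HC c ct; rewrite (Tsem_flow DA) //; last by case/andP: ct.
have -> : \sum_(j < d) - eig j * (expR (- (eig j * c)) * fs j w) =
    flow d (fun j w => - eig j * fs j w) c w.
  by apply: eq_bigr => j _; ring.
by [].
Qed.

End Semigroup.

(** * The generator *)

Section Injectivity.
Variable R : realType.
Implicit Types (f g h : Th R -> R) (w : Th R).

Notation spanO := (span (Omega R) (@pOrho R)).

(* Finitely many values determine a function of a finite-dimensional space. *)
Definition reproduces n (p : nat -> Th R) (b : nat -> Th R -> R) f : Prop :=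
  forall w, Omega R w -> f w = \sum_(i < n) f (p i) * b i w.

(** Elimination: if p_rho is not yet reproduced, a point w0 where its residual is non-zero is added,
    with the normalised residual as new function, and the old functions are corrected to vanish at
    w0. *)
Lemma reproducing_points (rs : seq (seq nat)) : all is_partition rs ->
  exists n p b, [/\ forall i, Omega R (p i), forall i, contO (b i) &
    forall rho, rho \in rs -> reproduces n p b (@pOrho R rho)].
Proof.
elim: rs => [_|rho rs IH /= /andP[prho prs]].
  exists 0%N, (fun _ => (fun _ => 0, fun _ => 0)), (fun _ _ => 0); split=> // i.
    exact: Omega_zero.
  exact: contO_cst.
have [n [p [b [Op cb H]]]] := IH prs.
pose e w := pOrho rho w - \sum_(i < n) pOrho rho (p i) * b i w.
have ce : contO e.
  by apply: contOB; [apply: contO_pOrho | apply: contO_sum => i _; apply: contOZ].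
have [e0|/existsNP[w0 /not_implyP[Ow0 /eqP ne]]] := pselect (forall w, Omega R w -> e w = 0).
  exists n, p, b; split=> // sigma; rewrite inE => /predU1P[->|/H //] w Ow.
  by apply/eqP; rewrite -subr_eq0; apply/eqP; exact: (e0 w Ow).
pose c w := (e w0)^-1 * e w.
have c1 : c w0 = 1 by rewrite /c mulVf.
exists n.+1, (fun i => if i == n then w0 else p i),
  (fun i w => if i == n then c w else b i w - b i w0 * c w); split.
- by move=> i; case: ifP.
- move=> i; case: (i == n); first exact: contOZ.
  by apply: contOB => //; apply: contOZ; apply: contOZ.
have key f w : \sum_(i < n.+1) f (if i == n :> nat then w0 else p i) *
    (if i == n :> nat then c w else b i w - b i w0 * c w) =
  \sum_(i < n) f (p i) * b i w + (f w0 - \sum_(i < n) f (p i) * b i w0) * c w.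
  rewrite big_ord_recr /= eqxx mulrBl mulr_suml addrA addrAC -sumrB; congr (_ + _).
  by apply: eq_bigr => i _; rewrite ltn_eqF //; ring.
move=> sigma; rewrite inE => /predU1P[->|/H rs'] w Ow; rewrite key.
  by rewrite -/(e w0) /c mulrA mulfV // mul1r /e addrC subrK.
by rewrite -(rs' w Ow) -(rs' w0 Ow0) subrr mul0r addr0.
Qed.

Lemma reproducing_span d : exists n p b,
  [/\ forall i, Omega R (p i), forall i, contO (b i) &
   forall f, spanO d f -> reproduces n p b f].
Proof.
pose rs := flatten [seq Yn k | k <- iota 0 d].
have prs : all is_partition rs.
  by apply/allP => rho /flattenP[_ /mapP[k _ ->]]; rewrite mem_Yn => /andP[].
have [n [p [b [Op cb H]]]] := reproducing_points prs.
exists n, p, b; split=> // f; elim=> {f} [f H0|f c rho f' prho ltd _ IH E] w Ow.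
  by rewrite H0 // big1 // => i _; rewrite H0 ?mul0r.
rewrite E // IH // (H rho) //; last first.
  by apply/flatten_mapP; exists (sumn rho); rewrite ?mem_iota ?mem_Yn ?prho /=.
rewrite mulr_sumr -big_split; apply: eq_bigr => i _ /=.
by rewrite E //; ring.
Qed.

Lemma contO_family n (b : nat -> Th R -> R) w (e : R) : (forall i, contO (b i)) ->
  Omega R w -> 0 < e -> exists k, exists2 d : R, 0 < d &
  forall w', Omega R w' -> nearO k d w w' -> forall j, (j < n)%N -> `|b j w - b j w'| < e.
Proof.
move=> cb Ow e0; elim: n => [|n [k [d d0 H]]]; first by exists 0%N, 1.
have [k' [d' d'0 H']] := cb n w Ow e e0.
exists (maxn k k'), (Num.min d d'); first by rewrite lt_min d0.
move=> w' Ow' nw j; rewrite ltnS leq_eqVlt => /predU1P[->|].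
  by apply: H' => //; apply: nearO_le nw; rewrite ?leq_maxr // ge_min lexx orbT.
by apply: H => //; apply: nearO_le nw; rewrite ?leq_maxl // ge_min lexx.
Qed.

(** N must not depend on f, so only the continuity of the finitely many b_j enters: values at
    diagrams close to the p_i control the f (p_i), and these control f. *)
Lemma piY_injective d : exists N, forall n, (N <= n)%N -> forall f, spanO d f ->
  (forall lam, lam \in Yn n -> piY n f lam = 0) -> forall w, Omega R w -> f w = 0.
Proof.
have [r [p [b [Op cb H]]]] := reproducing_span d.
(* Chosen so that r del <= 1/2; the sum S of the |f (p_i)| then satisfies S <= S / 2. *)
pose del : R := (2 * r.+1%:R)^-1.
have del0 : 0 < del by rewrite invr_gt0 mulr_gt0 // ltr0n.
have [N HN] : exists N, forall n, (N <= n)%N -> forall i, (i < r)%N ->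
    exists2 lam, lam \in Yn n & forall j, (j < r)%N -> `|b j (p i) - b j (iotaY R n lam)| < del.
  have K s : exists N, forall n, (N <= n)%N -> forall i, (i < s)%N ->
    exists2 lam, lam \in Yn n & forall j, (j < r)%N -> `|b j (p i) - b j (iotaY R n lam)| < del.
    elim: s => [|s [N HN]]; first by exists 0%N.
    have [k [e e0 He]] := contO_family r cb (Op s) del0.
    have [N' HN'] := iotaY_dense k (Op s) e0.
    exists (maxn N N') => n; rewrite geq_max => /andP[n1 n2] i.
    rewrite ltnS leq_eqVlt => /predU1P[->|]; last exact: HN.
    have [lam lamY nl] := HN' n n2; exists lam => //.
    by apply: He => //; apply: iotaY_Omega.
  exact: K.
exists N => n Nn f sf f0.
pose S := \sum_(j < r) `|f (p j)|.
have S0 : 0 <= S by apply: sumr_ge0.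
have bnd i : (i < r)%N -> `|f (p i)| <= del * S.
  move=> ir; have [lam lamY Hl] := HN n Nn i ir.
  have -> : f (p i) = f (p i) - f (iotaY R n lam) by rewrite [X in _ - X]f0 // subr0.
  rewrite (H f sf (p i)) // (H f sf (iotaY R n lam)); last exact: iotaY_Omega.
  rewrite -sumrB mulr_sumr; apply: le_trans (ler_norm_sum _ _ _) _.
  apply: ler_sum => j _; rewrite -mulrBr normrM mulrC ler_wpM2r //.
  by apply: ltW; apply: Hl.
have SS : S <= r%:R * (del * S).
  rewrite mulr_natl -[X in _ *+ X](card_ord r) -sumr_const.
  by apply: ler_sum => j _; apply: bnd.
have rd : r%:R * del <= 2^-1.
  rewrite /del invfM mulrCA ler_piMr ?invr_ge0 // ler_pdivrMr ?ltr0n // mul1r.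
  by rewrite ler_nat.
have SE : S = 0.
  have : r%:R * del * S <= 2^-1 * S by rewrite ler_wpM2r.
  by move: SS S0; rewrite mulrA; move: (r%:R * del * S) => x; lra.
have pz i : (i < r)%N -> f (p i) = 0.
  by move=> ir; apply/eqP; rewrite -normr_le0; apply: le_trans (bnd i ir) _; rewrite SE mulr0.
by move=> w Ow; rewrite (H f sf w Ow) big1 // => i _; rewrite pz ?mul0r.
Qed.

End Injectivity.

(** * The operator A, its closure and the generator *)

Section LimitOperator.
Variables (R : realType) (z z' : R[i]).
Hypothesis Hzz : admissible z z'.
Implicit Types (f g h : Th R -> R) (w : Th R).

Notation spanO := (span (Omega R) (@pOrho R)).
Notation T := (Tn z z').
Notation is_gen := (is_gen z z').
Notation eigen_sum := (eigen_sum z z').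
Notation eig := (eig z z').
Notation Tsem := (Tsem Hzz).

(** On Lambda^o a limit exists by [gen_span] and is unique on Omega by density ([Aop_uniq]); where
    there is none the value is 0. *)
Definition Aop f : Th R -> R :=
  match pselect (exists g, LamO g /\ is_gen f g) with
  | left H => projT1 (cid H)
  | right _ => fun _ => 0
  end.

Lemma AopP f : LamO f -> LamO (Aop f) /\ is_gen f (Aop f).
Proof.
move=> /LamOP[d sf]; rewrite /Aop; case: pselect => [H|[]].
  exact: (projT2 (cid H)).
have [hn [h [_ sh u E]]] := gen_span Hzz sf; exists h; split.
  by apply/LamOP; exists d.
exact: ulim_ucvg E u.
Qed.

Lemma Aop_uniq f g w : LamO f -> contO g -> is_gen f g -> Omega R w -> Aop f w = g w.
Proof.
move=> Lf cg G Ow; have [LA GA] := AopP Lf.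
exact: ulim_uniq (contO_LamO LA) cg GA G w Ow.
Qed.

Lemma Aop_contO f : LamO f -> contO (Aop f).
Proof. by case/AopP => /contO_LamO. Qed.

Lemma Aop_linear f g a b w : LamO f -> LamO g -> Omega R w ->
  Aop (fun x => a * f x + b * g x) w = a * Aop f w + b * Aop g w.
Proof.
move=> Lf Lg Ow; have [LA GA] := AopP Lf; have [LB GB] := AopP Lg.
apply: (Aop_uniq (g := fun w => a * Aop f w + b * Aop g w)) => //.
- by apply: LamOD; apply: LamOZ.
- by apply: contOD; apply: contOZ; apply: contO_LamO.
- exact: is_gen_linear.
Qed.

Lemma Aop_le m f : LamO_le m f -> LamO_le m (Aop f).
Proof.
move=> Lm; have Lf : LamO f by exists m.
have [hn [h [_ sh u E]]] := gen_span Hzz ((LamO_leP m f).1 Lm).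
apply/LamO_leP; apply: (eq_span _ sh) => w Ow; apply/esym/Aop_uniq => //.
  exact: contO_span sh.
exact: ulim_ucvg E u.
Qed.

Lemma Tn_span d f n : (0 < n)%N -> spanO d f ->
  exists2 g, spanO d g & forall lam, lam \in Yn n -> T n (piY n f) lam = piY n g lam.
Proof.
move=> n0 sf; have [hn [h [sn _ _ E]]] := gen_span Hzz sf.
have n0' : n%:R != 0 :> R by rewrite pnatr_eq0 -lt0n.
exists (fun w => f w + (n%:R ^+ 2)^-1 * hn n w); first by apply: spanD => //; apply: spanZ.
move=> lam lamY; rewrite /piY -E // /scaled_gen mulKf ?expf_neq0 //.
by rewrite /piY addrC subrK.
Qed.

(** For large n, injectivity of pi_n identifies g_n on Omega with the explicit element of
    [gen_span], whose uniform convergence is known. *)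
Lemma Aop_limit m f (gs : nat -> Th R -> R) : LamO_le m f ->
  (exists N, forall n, (N <= n)%N -> LamO_le m (gs n) /\
     forall lam, lam \in Yn n -> piY n (gs n) lam = scaled_gen z z' n f lam) ->
  (fun n => nrmO (fun w => gs n w - Aop f w)) @ \oo --> (0 : R).
Proof.
move=> Lm [N1 H1]; have Lf : LamO f by exists m.
have [hn [h [sn sh u E]]] := gen_span Hzz ((LamO_leP m f).1 Lm).
have [N2 H2] := piY_injective R m.+1.
apply/cvgn_leP => e e0; have [N3 H3] := u e e0.
exists (maxn (maxn N1 N2) (maxn N3 1)) => n; rewrite !geq_max => /andP[/andP[n1 n2] /andP[n3 n0]].
rewrite subr0 ger0_norm ?nrmO_ge0 //; apply: nrmO_le => w Ow.
have [/LamO_leP sg Hg] := H1 n n1.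
have Eg : gs n w = hn n w.
  apply/eqP; rewrite -subr_eq0; apply/eqP.
  apply: (H2 n n2 (fun w => gs n w - hn n w)) => //; first exact: spanB.
  move=> lam lamY; apply/eqP; rewrite /piY subr_eq0; apply/eqP.
  by rewrite -(E n lam n0 lamY) -Hg.
rewrite Eg (@Aop_uniq f h) //; [exact: H3 | exact: contO_span sh | exact: ulim_ucvg E u].
Qed.

Lemma eigen_sum_gen d f fs w : eigen_sum d f fs -> Omega R w ->
  Aop f w = \sum_(j < d) - eig j * fs j w.
Proof.
move=> [H E] Ow.
have Gs k : is_gen (fun w => \sum_(j < k) fs j w) (fun w => \sum_(j < k) - eig j * fs j w) /\
            LamO (fun w => \sum_(j < k) fs j w).
  elim: k => [|k [IH1 IH2]].
    split; first by apply: eq_is_gen (is_gen0 z z') => w' _; rewrite big_ord0.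
    by apply: eq_LamO (LamO_cst 0) => w' _; rewrite big_ord0.
  have [Lk Gk] := H k; split.
    by apply: eq_is_gen (is_gen_linear 1 1 IH1 Gk) => w' _; rewrite big_ord_recr !mul1r.
  by apply: eq_LamO (LamOD IH2 Lk) => w' _; rewrite big_ord_recr.
have [G L] := Gs d.
apply: (Aop_uniq (g := fun w => \sum_(j < d) - eig j * fs j w)) => //.
- by apply: eq_LamO L => w' /E ->.
- by apply: contO_sum => j _; apply: contOZ; apply: contO_LamO; have [] := H j.
- by apply: eq_is_gen G => // w' /E ->.
Qed.

Lemma Aop_estimate f t w C : LamO f -> 0 < t -> Omega R w ->
  (forall s, 0 <= s <= t -> `|Tsem s (Aop f) w - Aop f w| <= C) ->
  `|(Tsem t f w - f w) / t - Aop f w| <= C.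
Proof.
move=> Lf t0 Ow HC; have [d [fs D]] := LamO_eigen Hzz Lf.
rewrite (eigen_sum_gen D Ow); apply: (flow_generator D t0 Ow) => s /[dup] st /andP[s0 _].
rewrite -(eigen_sum_gen D Ow) -(@eq_Tsem _ _ _ Hzz s (Aop f)) //; first exact: HC.
  exact: Aop_contO.
by move=> w' Ow'; apply: eigen_sum_gen.
Qed.

Definition gen_eps f h : Prop := forall e, 0 < e -> exists2 del, 0 < del &
  forall t, 0 < t < del -> forall w, Omega R w -> `|(Tsem t f w - f w) / t - h w| <= e.

Lemma closure_gen_eps f h (fk : nat -> Th R -> R) : contO f -> contO h ->
  (forall k, LamO (fk k)) ->
  (forall e, 0 < e -> exists N, forall k, (N <= k)%N -> forall w, Omega R w -> `|fk k w - f w| <= e) ->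
  (forall e, 0 < e -> exists N, forall k, (N <= k)%N -> forall w, Omega R w -> `|Aop (fk k) w - h w| <= e) ->
  gen_eps f h.
Proof.
move=> cf ch Lk Hf HA e e0.
have e20 : 0 < e / 2 by rewrite divr_gt0.
have e120 : 0 < e / 12 by rewrite divr_gt0.
have [del del0 Hd] := Tsem_cont0 Hzz ch e20.
exists del => // t /andP[t0 td] w Ow.
(* The index k is chosen after t, because the distance from f_k to f gets divided by t; [del]
   depends on h alone. *)
have te0 : 0 < t * (e / 12) by rewrite mulr_gt0.
have [N1 H1] := Hf _ te0; have [N2 H2] := HA _ e120.
pose k := maxn N1 N2.
have h1 := H1 k (leq_maxl _ _); have h2 := H2 k (leq_maxr _ _).
have cA := Aop_contO (Lk k); have ck := contO_LamO (Lk k).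
have est : `|(Tsem t (fk k) w - fk k w) / t - Aop (fk k) w| <= e / 2 + e / 12 + e / 12.
  apply: Aop_estimate => // s /andP[s0 st].
  have p1 := Tsem_dist Hzz s0 cA ch h2 Ow; have p2 := h2 w Ow.
  have p3 : `|Tsem s h w - h w| <= e / 2 by apply: Hd; rewrite // s0 (le_trans st) // ltW.
  move: p1 p2 p3; rewrite !ler_norml => /andP[? ?] /andP[? ?] /andP[? ?].
  by apply/andP; split; lra.
have p1 : `|Tsem t f w - Tsem t (fk k) w| <= t * (e / 12).
  by apply: (Tsem_dist Hzz (ltW t0)) => // w' Ow'; rewrite distrC; apply: h1.
have p2 := h1 w Ow; have p3 := h2 w Ow.
have -> : (Tsem t f w - f w) / t - h w =
  ((Tsem t (fk k) w - fk k w) / t - Aop (fk k) w) +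
  ((Tsem t f w - Tsem t (fk k) w) + (fk k w - f w)) / t + (Aop (fk k) w - h w).
  by field; rewrite gt_eqF.
have p4 : `|((Tsem t f w - Tsem t (fk k) w) + (fk k w - f w)) / t| <= e / 12 + e / 12.
  rewrite normrM normfV (gtr0_norm t0) ler_pdivrMr // mulrDl [X in _ <= X + X]mulrC.
  by apply: le_trans (ler_normD _ _) _; apply: lerD.
apply: le_trans (ler_normD _ _) _; apply: le_trans (lerD (ler_normD _ _) (lexx _)) _.
apply: le_trans (lerD (lerD est p4) p3) _.
by lra.
Qed.

Lemma cvg_right0P (F : R -> R) : F @ 0^'+ --> (0 : R) <->
  (forall e, 0 < e -> exists2 del, 0 < del & forall t, 0 < t < del -> `|F t| <= e).
Proof.
split=> [/cvgr0Pnorm_le H e e0|H].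
  have := H e e0; rewrite near_withinE => /nbhs_ballP[del /= del0 Hd].
  exists del => // t /andP[t0 td]; apply: Hd => //.
  by rewrite /ball /= sub0r normrN gtr0_norm.
apply/cvgr0Pnorm_le => e e0; have [del del0 Hd] := H e e0.
rewrite near_withinE; apply/nbhs_ballP; exists del => // t.
rewrite /ball /= sub0r normrN => td t0; apply: Hd; rewrite t0 /=.
by apply: le_lt_trans td; apply: ler_norm.
Qed.

Lemma contO_quotient f h t : contO f -> contO h -> 0 < t ->
  contO (fun w => (Tsem t f w - f w) / t - h w).
Proof.
move=> cf ch t0; apply: contOB => //; apply: contOM; last exact: contO_cst.
by apply: contOB => //; apply: Tsem_contO => //; apply: ltW.
Qed.

Lemma generator_graphP f h :
  generator_graph Tsem f h <-> [/\ contO f, contO h & gen_eps f h].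
Proof.
split=> [[cf [ch /cvg_right0P H]]|[cf ch H]].
  split=> // e e0; have [del del0 Hd] := H e e0; exists del => // t td w Ow.
  apply: le_trans (Hd t td); apply: le_trans (ler_norm _).
  case/andP: td => t0 _.
  exact: (nrmO_ub (contO_quotient cf ch t0) Ow).
split=> //; split=> //; apply/cvg_right0P => e e0.
have [del del0 Hd] := H e e0; exists del => // t td.
by rewrite ger0_norm ?nrmO_ge0 //; apply: nrmO_le => w Ow; apply: Hd.
Qed.

Lemma nrmO_cvg0P (F : nat -> Th R -> R) : (forall k, contO (F k)) ->
  (fun k => nrmO (F k)) @ \oo --> (0 : R) <->
  (forall e, 0 < e -> exists N, forall k, (N <= k)%N -> forall w, Omega R w -> `|F k w| <= e).
Proof.
move=> cF; split=> [/cvgn_leP H e e0|H].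
  have [N HN] := H e e0; exists N => k Nk w Ow.
  by have := HN k Nk; rewrite subr0 ger0_norm ?nrmO_ge0 //; apply: le_trans; apply: nrmO_ub.
apply/cvgn_leP => e e0; have [N HN] := H e e0; exists N => k Nk.
by rewrite subr0 ger0_norm ?nrmO_ge0 //; apply: nrmO_le => w Ow; apply: HN.
Qed.

Lemma gen_eps_linear a b f g h k : contO f -> contO g -> gen_eps f h -> gen_eps g k ->
  gen_eps (fun w => a * f w + b * g w) (fun w => a * h w + b * k w).
Proof.
move=> cf cg Gf Gg e e0; have eC0 := lin_eps_gt0 a b e0.
have [d1 d10 H1] := Gf _ eC0; have [d2 d20 H2] := Gg _ eC0.
exists (Num.min d1 d2); first by rewrite lt_min d10.
move=> t /andP[t0]; rewrite lt_min => /andP[td1 td2] w Ow.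
have h1 : `|(Tsem t f w - f w) / t - h w| <= e / (`|a| + `|b| + 1) by apply: H1; rewrite ?t0.
have h2 : `|(Tsem t g w - g w) / t - k w| <= e / (`|a| + `|b| + 1) by apply: H2; rewrite ?t0.
rewrite (Tsem_linear Hzz a b (ltW t0) cf cg Ow).
set A := (Tsem t f w - f w) / t - h w in h1.
set B := (Tsem t g w - g w) / t - k w in h2.
have -> : (a * Tsem t f w + b * Tsem t g w - (a * f w + b * g w)) / t - (a * h w + b * k w) =
  a * A + b * B by rewrite /A /B; ring.
exact: lin_eps.
Qed.

(** (1 + 1/t) f equals f - h, up to a small error, plus T(t) f / t, whose norm is at most that of f
    / t; the terms with 1/t cancel in the estimate. *)
Lemma gen_eps_dissipative f h C w : contO f -> gen_eps f h ->
  (forall w, Omega R w -> `|f w - h w| <= C) -> Omega R w -> `|f w| <= C.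
Proof.
move=> cf G fh Ow; apply/ler_addgt0Pr => e e0.
have [del del0 Hd] := G e e0; pose t := del / 2.
have t0 : 0 < t by rewrite divr_gt0.
have td : 0 < t < del by rewrite t0 /t ltr_pdivrMr // ltr_pMr // ltr1n.
suff H : nrmO f <= C + e by apply: le_trans H; apply: nrmO_ub.
have H : nrmO f <= (C + e + nrmO f / t) / (1 + t^-1).
  have it0 : 0 < t^-1 by rewrite invr_gt0.
  apply: nrmO_le => w' Ow'; rewrite ler_pdivlMr; last by rewrite addr_gt0.
  have -> : `|f w'| * (1 + t^-1) = `|f w' * (1 + t^-1)|.
    by rewrite normrM [X in _ = _ * X]ger0_norm // addr_ge0 // ltW.
  have -> : f w' * (1 + t^-1) = (f w' - h w') - ((Tsem t f w' - f w') / t - h w') + Tsem t f w' / t.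
    by field; rewrite gt_eqF.
  apply: le_trans (ler_normD _ _) _; apply: lerD; last first.
    rewrite normrM normfV (gtr0_norm t0) ler_wpM2r ?(ltW it0) //.
    apply: (Tsem_bound Hzz (ltW t0) cf) => // w'' Ow''; exact: nrmO_ub.
  by apply: le_trans (ler_normB _ _) _; apply: lerD; [apply: fh | apply: Hd].
have it0 : 0 < t^-1 by rewrite invr_gt0.
move: H; rewrite ler_pdivlMr; last by rewrite addr_gt0.
by rewrite mulrDr mulr1 lerD2r.
Qed.

Lemma resolvent f : LamO f -> exists2 u, LamO u & forall w, Omega R w -> u w - Aop u w = f w.
Proof.
move=> Lf; have [d [fs D]] := LamO_eigen Hzz Lf; have [H E] := D.
pose us j w := (1 + eig j)^-1 * fs j w.
have Du : eigen_sum d (fun w => \sum_(j < d) us j w) us.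
  split=> // j; have [L G] := H j; split; first exact: LamOZ.
  by apply: eq_is_gen (is_gen_linear (1 + eig j)^-1 0 G G) => w _; rewrite mul0r addr0 // /us; ring.
exists (fun w => \sum_(j < d) us j w).
  have K k : LamO (fun w => \sum_(j < k) us j w).
    elim: k => [|k IH]; first by apply: eq_LamO (LamO_cst 0) => w _; rewrite big_ord0.
    by apply: eq_LamO (LamOD IH (Du.1 k).1) => w _; rewrite big_ord_recr.
  exact: K.
move=> w Ow; rewrite (eigen_sum_gen Du Ow) E // -sumrB; apply: eq_bigr => j _.
have e0 := eig_ge0 Hzz j; rewrite /us.
by field; rewrite gt_eqF // ltr_wpDr.
Qed.

(** For the converse, f - h is approximated by g in Lambda^o and u - A u = g is solved there.
    Dissipativity of the generator bounds u - f by g - (f - h), and then A u is close to h. *)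
Lemma closure_generator f h :
  closure_graph (@LamO R) Aop f h <-> generator_graph Tsem f h.
Proof.
split=> [[cf [ch [fk [Lk [Hf HA]]]]]|/generator_graphP[cf ch G]].
  apply/generator_graphP; split=> //; apply: (closure_gen_eps (fk := fk)) => //.
    by apply/nrmO_cvg0P => // k; apply: contOB => //; apply: contO_LamO.
  by apply/nrmO_cvg0P => // k; apply: contOB => //; apply: Aop_contO.
split=> //; split=> //.
have /choice[u Hu] : forall k : nat, exists u,
    [/\ LamO u, forall w, Omega R w -> `|u w - f w| <= k.+1%:R^-1 &
        forall w, Omega R w -> `|Aop u w - h w| <= k.+1%:R^-1 + k.+1%:R^-1].
  move=> k; have k0 : 0 < k.+1%:R^-1 :> R by rewrite invr_gt0 ltr0n.
  have [g Lg Hg] := stone_weierstrass (contOB cf ch) k0.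
  have [u Lu Eu] := resolvent Lg; exists u.
  have Gu : gen_eps u (Aop u).
    apply: (closure_gen_eps (fk := fun _ => u)); first exact: contO_LamO.
    - exact: Aop_contO.
    - by [].
    - by move=> e e0; exists 0%N => j _ w _; rewrite subrr normr0 ltW.
    - by move=> e e0; exists 0%N => j _ w _; rewrite subrr normr0 ltW.
  have cu := contO_LamO Lu.
  have fu w : Omega R w -> `|u w - f w| <= k.+1%:R^-1.
    move=> Ow; have := gen_eps_dissipative (C := k.+1%:R^-1) _ (gen_eps_linear 1 (-1) cf cu G Gu) _ Ow.
    rewrite mul1r mulN1r distrC; apply.
      by apply: contOD; apply: contOZ.
    move=> w' Ow'; have := Hg w' Ow'; rewrite -Eu //.
    by rewrite !mul1r !mulN1r; congr (`| _ | <= _); ring.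
  split=> // w Ow; have p1 := fu w Ow; have := Hg w Ow; rewrite -Eu // => p2.
  have -> : Aop u w - h w = (u w - f w) + (f w - h w - (u w - Aop u w)) by ring.
  by apply: le_trans (ler_normD _ _) _; apply: lerD.
exists u; split; first by move=> k; have [] := Hu k.
split; apply/nrmO_cvg0P.
- by move=> k; apply: contOB => //; apply: contO_LamO; have [] := Hu k.
- move=> e e0; have [N HN] := inv_small e0; exists N => k Nk w Ow.
  by have [_ H _] := Hu k; apply: le_trans (H w Ow) (HN k Nk).
- by move=> k; apply: contOB => //; apply: Aop_contO; have [] := Hu k.
move=> e e0; have e20 : 0 < e / 2 by rewrite divr_gt0.
have [N HN] := inv_small e20; exists N => k Nk w Ow.
have [_ _ H] := Hu k; apply: le_trans (H w Ow) _.
by rewrite [leRHS]splitr lerD // HN.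
Qed.

(** The limit h is the value of the generator at 0, and T(t) 0 = 0. *)
Lemma Aop_closable : closable (@LamO R) Aop.
Proof.
move=> fk h Lk ch Hf HA w Ow; apply/eqP; rewrite -normr_le0; apply/ler_addgt0Pr => e e0.
have G : gen_eps (fun _ => 0) h.
  apply: (closure_gen_eps (fk := fk)) => //; first exact: contO_cst.
    move=> e' e'0; have [N HN] := (nrmO_cvg0P (fun k => contO_LamO (Lk k))).1 Hf e' e'0.
    by exists N => k Nk w' Ow'; rewrite subr0; apply: HN.
  by apply/nrmO_cvg0P => // k; apply: contOB => //; apply: Aop_contO.
have [del del0 Hd] := G e e0.
have td : 0 < del / 2 < del by rewrite divr_gt0 // ltr_pdivrMr // ltr_pMr // ltr1n.
have := Hd _ td w Ow; rewrite Tsem_cst //; last by case/andP: td => /ltW.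
by rewrite subrr mul0r sub0r normrN add0r.
Qed.

Lemma Tsem_conservative : conservative_markov_semigroup Tsem.
Proof.
split; first by move=> t f; apply: Tsem_contO.
split; first by move=> t a b f g t0 cf cg w; apply: Tsem_linear.
split; first by move=> f cf w; apply: Tsem0.
split; first by move=> s t f s0 t0 cf w; apply: Tsem_semigroup.
split.
  move=> f cf; apply/cvg_right0P => e e0; have [del del0 H] := Tsem_cont0 Hzz cf e0.
  exists del => // t /andP[t0 td]; rewrite ger0_norm ?nrmO_ge0 //; apply: nrmO_le => w Ow.
  by apply: H; rewrite // !ltW.
split.
  move=> t f t0 cf; apply: nrmO_le => w Ow; apply: Tsem_bound => // w' Ow'.
  exact: nrmO_ub.
split; first by move=> t f t0 cf f0 w; apply: Tsem_ge0.
by move=> t t0 w; apply: Tsem_cst.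
Qed.

End LimitOperator.

Unset Implicit Arguments.
Set Printing Implicit Defensive.

Theorem theorem5p1 (R : realType) (z z' : R[i]) (Hzz : admissible z z') :
  (* pi_n is injective on Lambda^{o,<=m} and T_n preserves pi_n(Lambda^{o,<=m}) *)
  (forall m : nat, exists N : nat, forall n : nat, (N <= n)%N ->
     (forall f g : Th R -> R, LamO_le m f -> LamO_le m g ->
        (forall lam, lam \in Yn n -> piY n f lam = piY n g lam) ->
        forall w, Omega R w -> f w = g w) /\
     (forall f : Th R -> R, LamO_le m f -> exists g : Th R -> R, LamO_le m g /\
        forall lam, lam \in Yn n -> Tn z z' n (piY n f) lam = piY n g lam)) /\
  exists A : (Th R -> R) -> (Th R -> R),
    (* A f is the limit in Lambda^{o,<=m} of the g_n *)
    (forall (m : nat) (f : Th R -> R), LamO_le m f ->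
       LamO_le m (A f) /\
       forall gs : nat -> Th R -> R,
         (exists N : nat, forall n : nat, (N <= n)%N ->
            LamO_le m (gs n) /\
            forall lam, lam \in Yn n ->
              piY n (gs n) lam =
              (n%:R) ^+ 2 * (Tn z z' n (piY n f) lam - piY n f lam)) ->
         (fun n => nrmO (fun w => gs n w - A f w)) @ \oo --> 0) /\
    (* A is linear on Lambda^o *)
    (forall (f g : Th R -> R) (a b : R), LamO f -> LamO g ->
       forall w, Omega R w ->
         A (fun x => a * f x + b * g x) w = a * A f w + b * A g w) /\
    (* A with domain Lambda^o is closable in C(Omega) *)
    closable (@LamO R) A /\
    exists T : R -> (Th R -> R) -> (Th R -> R),
      conservative_markov_semigroup T /\
      (* the closure of A is the generator of T *)
      (forall f h : Th R -> R,
         closure_graph (@LamO R) A f h <-> generator_graph T f h) /\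
      (* approximation, uniformly in t on bounded intervals *)
      (forall f : Th R -> R, contO f ->
         forall t0 : R, 0 <= t0 -> forall e : R, 0 < e ->
         exists N : nat, forall n : nat, (N <= n)%N ->
           forall t : R, 0 <= t <= t0 ->
           forall lam, lam \in Yn n ->
             `| iter (Num.truncn ((n%:R) ^+ 2 * t)) (Tn z z' n) (piY n f) lam
                - piY n (T t f) lam | <= e).
Proof.
split.
  move=> m; have [N HN] := piY_injective R m.+1.
  exists (maxn N 1) => n; rewrite geq_max => /andP[Nn n0]; split.
    move=> f g /LamO_leP sf /LamO_leP sg E w Ow; apply/eqP; rewrite -subr_eq0; apply/eqP.
    apply: (HN n Nn (fun w => f w - g w)) => //; first exact: spanB.
    by move=> lam lamY; apply/eqP; rewrite /piY subr_eq0; apply/eqP/E.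
  move=> f /LamO_leP sf; have [g sg Hg] := Tn_span Hzz n0 sf.
  by exists g; split=> //; apply/LamO_leP.
exists (Aop z z'); split.
  move=> m f Lm; split; first exact: Aop_le.
  by move=> gs; apply: Aop_limit.
split; first by move=> f g a b Lf Lg w; apply: Aop_linear.
split; first exact: Aop_closable.
exists (Tsem Hzz); split; first exact: Tsem_conservative.
split; first by move=> f h; apply: closure_generator.
move=> f cf t0 t00 e e0; have [N HN] := Tsem_usem Hzz cf t00 e0.
by exists N => n Nn t tt lam lamY; apply: HN.
Qed.
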